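(* Let $G$ be the Bass-Serre fundamental group of a finite connected graph of groups on a graph $X$, with all vertex and edge groups isomorphic to $\mathbf{Z}^n$, and let $d$ be the rank of the (free) fundamental group of the graph $X$. In each of the following cases, $G$ has the Haagerup Property and satisfies $\Lambda(G)=1$: (1) $d=0$, i.e. $X$ is a tree; (2) $d=1$, i.e. $X$ has the homotopy type of a circle; (3) $n=1$.
   Context: Equivalently, $G$ is a group acting cocompactly without inversion on a tree $\tilde X$ with all vertex and edge stabilizers isomorphic to $\mathbf{Z}^n$ ($n\ge1$), and $X=G\backslash\tilde X$. $G$ is considered as a discrete group. Haagerup Property: existence of a net of continuous $C_0$ positive definite functions converging to $1$ uniformly on compact sets. The Cowling-Haagerup constant $\Lambda(G)$ is the best possible (infimum) constant $\Lambda$ for which there exists a net $(\varphi_i)$ of continuous compactly supported functions on $G$ converging to $1$ uniformly on compact sets with $\sup_i\|\varphi_i\|_{\mathrm{cb}}\le\Lambda$, where $\|\cdot\|_{\mathrm{cb}}$ is the completely bounded norm on multipliers of the Fourier algebra of $G$. *)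

(* Defs.v *)
From HB Require Import structures.
From mathcomp Require Import all_boot all_order all_algebra.
From mathcomp Require Import generic_quotient.
From mathcomp Require Import all_classical all_reals all_analysis.
From mathcomp Require Import complex lra.

Set Implicit Arguments.
Unset Strict Implicit.
Unset Printing Implicit Defensive.

Import Order.TTheory GRing.Theory Num.Theory.
Import ComplexField.Normc.

Local Open Scope classical_set_scope.
Local Open Scope quotient_scope.

(* Groups are [groupType]s (possibly infinite), always regarded as discrete.  *)
Section Presentation.
Local Open Scope group_scope.
Context (S : choiceType).

(* The letter (s, true) stands for s and (s, false) for its inverse.          *)
Definition word : Type := seq (S * bool).

Definition winv (w : word) : word := [seq (p.1, ~~ p.2) | p <- rev w].

Lemma winv_cat u v : winv (u ++ v) = winv v ++ winv u.
Proof. by rewrite /winv rev_cat map_cat. Qed.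

Lemma winvK : involutive winv.
Proof.
move=> w; rewrite /winv -map_rev revK -map_comp -[RHS]map_id.
by apply: eq_map => -[s b] /=; rewrite negbK.
Qed.

Context (rel : word -> word -> Prop).

Inductive word_eq : word -> word -> Prop :=
| word_eq_rel u v : rel u v -> word_eq u v
| word_eq_cancel s b : word_eq [:: (s, b); (s, ~~ b)] [::]
| word_eq_cat u u' v v' :
    word_eq u u' -> word_eq v v' -> word_eq (u ++ v) (u' ++ v')
| word_eq_refl u : word_eq u u
| word_eq_sym u v : word_eq u v -> word_eq v u
| word_eq_trans u v w : word_eq u v -> word_eq v w -> word_eq u w.

Definition word_eqb (u v : word) : bool := `[< word_eq u v >].

Lemma word_eqb_refl : reflexive word_eqb.
Proof. by move=> u; apply/asboolP/word_eq_refl. Qed.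

Lemma word_eqb_sym : symmetric word_eqb.
Proof.
by move=> u v; apply/idP/idP => /asboolP h; apply/asboolP/word_eq_sym.
Qed.

Lemma word_eqb_trans : transitive word_eqb.
Proof.
move=> v u w /asboolP h1 /asboolP h2; apply/asboolP; exact: word_eq_trans h1 h2.
Qed.

Canonical word_equiv : equiv_rel (seq (S * bool)) :=
  EquivRel word_eqb word_eqb_refl word_eqb_sym word_eqb_trans.

Definition presented_group : Type := {eq_quot word_equiv}.

HB.instance Definition _ := Choice.on presented_group.
HB.instance Definition _ := EqQuotient.on presented_group.

Definition pclass (w : word) : presented_group := \pi_presented_group w.

Lemma pclassE u v : (pclass u = pclass v) <-> word_eq u v.
Proof.
rewrite /pclass; split=> [/eqmodP /asboolP //|h].
by apply/eqmodP/asboolP.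
Qed.

Lemma pclass_repr (x : presented_group) : pclass (repr x) = x.
Proof. exact: reprK. Qed.

Lemma repr_pclass w : word_eq (repr (pclass w)) w.
Proof. by apply/pclassE; rewrite pclass_repr. Qed.

Lemma word_eq_winv w : word_eq (w ++ winv w) [::].
Proof.
elim: w => [|[s b] w IH]; first exact: word_eq_refl.
rewrite -cat1s winv_cat -!catA (catA w).
apply: (@word_eq_trans _ ([:: (s, b)] ++ [::] ++ [:: (s, ~~ b)])).
  apply: word_eq_cat; first exact: word_eq_refl.
  by apply: word_eq_cat => //; exact: word_eq_refl.
exact: word_eq_cancel.
Qed.

Lemma winv_word_eq u v : word_eq u v -> word_eq (winv u) (winv v).
Proof.
move=> uv.
have cancell w : word_eq (winv w ++ w) [::].
  by rewrite -{2}[w]winvK; exact: word_eq_winv.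
apply: (@word_eq_trans _ (winv u ++ v ++ winv v)).
  rewrite -{1}[winv u]cats0; apply: word_eq_cat; first exact: word_eq_refl.
  exact/word_eq_sym/word_eq_winv.
rewrite catA -[X in word_eq _ X]cat0s.
apply: word_eq_cat; last exact: word_eq_refl.
apply: word_eq_trans (cancell u).
by apply: word_eq_cat; [exact: word_eq_refl|exact: word_eq_sym].
Qed.

Definition pmul (x y : presented_group) := pclass (repr x ++ repr y).
Definition pone : presented_group := pclass [::].
Definition pinv (x : presented_group) := pclass (winv (repr x)).

Lemma pmulE u v : pmul (pclass u) (pclass v) = pclass (u ++ v).
Proof. by apply/pclassE; apply: word_eq_cat; exact: repr_pclass. Qed.

Lemma pinvE u : pinv (pclass u) = pclass (winv u).
Proof. by apply/pclassE/winv_word_eq/repr_pclass. Qed.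

Lemma pmulA : associative pmul.
Proof.
move=> x y z; rewrite -(pclass_repr x) -(pclass_repr y) -(pclass_repr z).
by rewrite !pmulE catA.
Qed.

Lemma pmul1 : left_id pone pmul.
Proof. by move=> x; rewrite -(pclass_repr x) pmulE. Qed.

Lemma pmulr1 : right_id pone pmul.
Proof. by move=> x; rewrite -(pclass_repr x) pmulE cats0. Qed.

Lemma pmulrV : right_inverse pone pinv pmul.
Proof.
move=> x; rewrite -(pclass_repr x) pinvE pmulE; apply/pclassE.
exact: word_eq_winv.
Qed.

Lemma pmulVr : left_inverse pone pinv pmul.
Proof.
move=> x; have := pmulrV (pinv x).
by rewrite -(pclass_repr x) !pinvE winvK.
Qed.

HB.instance Definition _ := isGroup.Build presented_group
  pmulA pmul1 pmulr1 pmulVr pmulrV.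

Definition pgen (s : S) : presented_group := pclass [:: (s, true)].

End Presentation.

Definition free_group (S : choiceType) : groupType :=
  presented_group (fun _ _ : word S => False).

Definition group_iso (G H : groupType) : Prop :=
  exists f : {multiplicative G -> H}, bijective f.

Definition iso_Zn (n : nat) (G : groupType) : Prop :=
  exists f : G -> 'rV[int]_n,
    bijective f /\ forall x y : G, f (x * y)%g = (f x + f y)%R.

Section Subgroup.
Local Open Scope group_scope.
Context (G : groupType) (P : G -> Prop).

Record is_subgroup : Prop := IsSubgroup {
  subgroup1 : P 1;
  subgroupM : forall x y, P x -> P y -> P (x * y);
  subgroupV : forall x, P x -> P x^-1 }.

Definition subgroup_pred (HP : is_subgroup) : {pred G} := fun x => `[< P x >].

Context (HP : is_subgroup).

Definition subgroup_type : Type := {x : G | x \in subgroup_pred HP}.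

Lemma subgroup_pred_closed : group_closed (subgroup_pred HP).
Proof.
split; first exact/asboolP/(subgroup1 HP).
move=> x y /asboolP Px /asboolP Py; apply/asboolP.
by apply: (subgroupM HP) => //; exact: (subgroupV HP).
Qed.

HB.instance Definition _ := SubChoice.on subgroup_type.
HB.instance Definition _ := SubChoice_isSubGroup.Build
  G (mem (subgroup_pred HP)) subgroup_type subgroup_pred_closed.

End Subgroup.

(* A finite graph with a chosen orientation: each geometric edge occurs once. *)
(* Loops and multiple edges are allowed.                                      *)
Record graph := Graph {
  vertex : finType;
  edge : finType;
  source : edge -> vertex;
  target : edge -> vertex }.

Arguments source {g} e.
Arguments target {g} e.

Definition adjacent (X : graph) : rel (vertex X) :=
  [rel u v | [exists e : edge X,
     ((source e == u) && (target e == v)) ||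
     ((source e == v) && (target e == u))]].

Definition graph_connected (X : graph) : Prop :=
  forall u v : vertex X, connect (@adjacent X) u v.

Section GraphPi1.
Local Open Scope group_scope.
Context (X : graph).

(* Edge paths are multiplied in the free group on the edges, where equality   *)
(* is equality up to insertion and deletion of backtrackings.                 *)
Inductive edge_path : vertex X -> vertex X -> free_group (edge X) -> Prop :=
| edge_path1 v : edge_path v v 1
| edge_path_edge e : edge_path (source e) (target e) (pgen _ e)
| edge_path_edgeV e : edge_path (target e) (source e) (pgen _ e)^-1
| edge_pathM u v w x y :
    edge_path u v x -> edge_path v w y -> edge_path u w (x * y).

Lemma edge_pathV u v x : edge_path u v x -> edge_path v u x^-1.
Proof.
elim=> {u v x} [v|e|e|u v w x y _ IHx _ IHy].
- by rewrite invg1; exact: edge_path1.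
- exact: edge_path_edgeV.
- by rewrite invgK; exact: edge_path_edge.
- by rewrite invgM; exact: edge_pathM IHy IHx.
Qed.

Lemma edge_loop_subgroup v : is_subgroup (edge_path v v).
Proof.
split=> [|x y|x]; [exact: edge_path1|exact: edge_pathM|exact: edge_pathV].
Qed.

Definition graph_pi1 (v0 : vertex X) : groupType :=
  subgroup_type (edge_loop_subgroup v0).

End GraphPi1.

Record graph_of_groups (X : graph) := GraphOfGroups {
  vgroup : vertex X -> groupType;
  egroup : edge X -> groupType;
  smap : forall e, {multiplicative egroup e -> vgroup (source e)};
  tmap : forall e, {multiplicative egroup e -> vgroup (target e)};
  smap_inj : forall e, injective (smap e);
  tmap_inj : forall e, injective (tmap e) }.

Section BassSerre.
Local Open Scope group_scope.
Context (X : graph) (A : graph_of_groups X).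

Definition gog_letter : choiceType :=
  ({v : vertex X & vgroup A v} + edge X)%type.

Definition vletter (v : vertex X) (g : vgroup A v) : gog_letter :=
  inl (Tagged (fun v => vgroup A v) g).

Definition eletter (e : edge X) : gog_letter := inr e.

(* Serre's group F(A, X): generated by the vertex groups and by the edges,    *)
(* with e a^(target) e^-1 = a^(source) for a in the group of the edge e.      *)
Inductive gog_rel : word gog_letter -> word gog_letter -> Prop :=
| gog_rel_vertex v (g h : vgroup A v) :
    gog_rel [:: (vletter g, true); (vletter h, true)]
            [:: (vletter (g * h), true)]
| gog_rel_edge e (a : egroup A e) :
    gog_rel [:: (eletter e, true); (vletter (tmap A e a), true);
                (eletter e, false)]
            [:: (vletter (smap A e a), true)].

Definition path_group : groupType := presented_group gog_rel.

Definition of_vertex (v : vertex X) (g : vgroup A v) : path_group :=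
  pgen gog_rel (vletter g).

Definition of_edge (e : edge X) : path_group := pgen gog_rel (eletter e).

(* The values in F(A, X) of the path words g0 e1 g1 ... en gn from u to v.    *)
Inductive gog_path : vertex X -> vertex X -> path_group -> Prop :=
| gog_path_vertex v (g : vgroup A v) : gog_path v v (of_vertex g)
| gog_path_edge e : gog_path (source e) (target e) (of_edge e)
| gog_path_edgeV e : gog_path (target e) (source e) (of_edge e)^-1
| gog_pathM u v w x y :
    gog_path u v x -> gog_path v w y -> gog_path u w (x * y).

Lemma of_vertexM v (g h : vgroup A v) :
  of_vertex (g * h) = of_vertex g * of_vertex h.
Proof.
rewrite [RHS](pmulE gog_rel); apply/pclassE/word_eq_sym/word_eq_rel.
exact: gog_rel_vertex.
Qed.

Lemma of_vertex1 v : of_vertex (1 : vgroup A v) = 1.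
Proof.
by apply: (@mulgI _ (of_vertex (1 : vgroup A v))); rewrite -of_vertexM !mulg1.
Qed.

Lemma of_vertexV v (g : vgroup A v) : of_vertex g^-1 = (of_vertex g)^-1.
Proof.
by apply: (@mulgI _ (of_vertex g)); rewrite -of_vertexM !mulgV of_vertex1.
Qed.

Lemma gog_pathV u v x : gog_path u v x -> gog_path v u x^-1.
Proof.
elim=> {u v x} [v g|e|e|u v w x y _ IHx _ IHy].
- by rewrite -of_vertexV; exact: gog_path_vertex.
- exact: gog_path_edgeV.
- by rewrite invgK; exact: gog_path_edge.
- by rewrite invgM; exact: gog_pathM IHy IHx.
Qed.

Lemma gog_loop_subgroup v : is_subgroup (gog_path v v).
Proof.
split=> [|x y|x]; [|exact: gog_pathM|exact: gog_pathV].
by rewrite -(of_vertex1 v); exact: gog_path_vertex.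
Qed.

Definition bass_serre_pi1 (v0 : vertex X) : groupType :=
  subgroup_type (gog_loop_subgroup v0).

End BassSerre.

Local Open Scope ring_scope.

Record directed_set := DirectedSet {
  dset :> Type;
  dle : dset -> dset -> Prop;
  dle_refl : forall i, dle i i;
  dle_trans : forall j i k, dle i j -> dle j k -> dle i k;
  dset_inhabited : inhabited dset;
  dle_directed : forall i j, exists k, dle i k /\ dle j k }.

Section Functions.
Context (R : realType) (G : groupType).
Implicit Types (phi : G -> R[i]).

(* The compact subsets of a discrete group are its finite subsets.            *)
Definition cvg1_on_compacts (D : directed_set) (phi : D -> G -> R[i]) : Prop :=
  forall K : set G, finite_set K -> forall eps : R, 0 < eps ->
  exists i0, forall i, dle i0 i -> forall g, K g -> normc (phi i g - 1) < eps.

Definition vanishes_at_infinity phi : Prop :=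
  forall eps : R, 0 < eps -> finite_set [set g | eps <= normc (phi g)].

Definition compactly_supported phi : Prop :=
  finite_set [set g | phi g != 0].

(* In R[i], 0 <= z means that z is real and nonnegative.                      *)
Definition positive_definite phi : Prop :=
  forall (m : nat) (g : 'I_m -> G) (c : 'I_m -> R[i]),
  0 <= \sum_(i < m) \sum_(j < m) (c i)^* * c j * phi ((g i)^-1 * g j)%g.

Definition haagerup_property : Prop :=
  exists (D : directed_set) (phi : D -> G -> R[i]),
    (forall i, vanishes_at_infinity (phi i) /\ positive_definite (phi i)) /\
    cvg1_on_compacts phi.

Definition l2sq (f : G -> R[i]) : \bar R :=
  \esum_(g in [set: G]) (normc (f g) ^+ 2)%:E.

Definition l2_pred : {pred G -> R[i]^o} := fun f => `[< (l2sq f < +oo)%E >].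

Lemma normc_ge0 (z : R[i]) : 0 <= normc z.
Proof. by case: z => a b /=; exact: sqrtr_ge0. Qed.

Lemma normcD_sqr (x y : R[i]) :
  normc (x + y) ^+ 2 <= 2 * normc x ^+ 2 + 2 * normc y ^+ 2.
Proof.
have := le_normcD x y; have := normc_ge0 (x + y).
have := normc_ge0 x; have := normc_ge0 y.
move: (normc x) (normc y) (normc (x + y)) => a b c b0 a0 c0 cab.
apply: (@le_trans _ _ ((a + b) ^+ 2)).
  by apply: lerXn2r => //; rewrite nnegrE addr_ge0.
by have := sqr_ge0 (a - b); rewrite sqrrB sqrrD; lra.
Qed.

Lemma esum_scale_lty (c : R) (f : G -> R) : 0 <= c -> (forall g, 0 <= f g) ->
  (\esum_(g in [set: G]) (f g)%:E < +oo)%E ->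
  (\esum_(g in [set: G]) (c * f g)%:E < +oo)%E.
Proof.
move=> c0 f0 fy.
apply: (@le_lt_trans _ _ (c%:E * \esum_(g in [set: G]) (f g)%:E)%E); last first.
  by rewrite lte_mul_pinfty.
apply: ge_ereal_sup => _ [A [finA _] <-].
under eq_fsbigr do rewrite EFinM.
rewrite -ge0_mule_fsumr; last by move=> g; rewrite lee_fin.
apply: lee_wpmul2l; first by rewrite lee_fin.
by apply: ereal_sup_ubound; exists A.
Qed.

Lemma l2_submod_closed : submod_closed l2_pred.
Proof.
split.
  by apply/asboolP; rewrite /l2sq esum1// => g _; rewrite normc0 expr0n.
move=> a f h /asboolP f2 /asboolP h2; apply/asboolP.
pose F g : R := 2 * normc a ^+ 2 * normc (f g) ^+ 2.
pose H g : R := 2 * normc (h g) ^+ 2.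
apply: (@le_lt_trans _ _ (\esum_(g in [set: G]) ((F g)%:E + (H g)%:E))%E).
  apply: le_esum => g _; rewrite -EFinD lee_fin.
  apply: le_trans (normcD_sqr _ _) _.
  by rewrite normcM exprMn mulrA.
have F0 g : 0 <= F g by rewrite !mulr_ge0 ?normc_ge0.
have H0 g : 0 <= H g by rewrite !mulr_ge0 ?normc_ge0.
rewrite esumD; [|by move=> *; rewrite lee_fin..].
apply: lte_add_pinfty; apply: esum_scale_lty => //.
- by rewrite mulr_ge0 ?sqr_ge0.
- by move=> g; exact: sqr_ge0.
- by move=> g; exact: sqr_ge0.
Qed.

HB.instance Definition _ := GRing.isSubmodClosed.Build R[i] (G -> R[i]^o)
  l2_pred l2_submod_closed.

Definition ell2 : Type := {f : G -> R[i]^o | f \in l2_pred}.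

HB.instance Definition _ := SubChoice.on ell2.
HB.instance Definition _ := [SubChoice_isSubLmodule of ell2 by <:].

Implicit Types (xi eta : ell2).

(* Unconditional sums; meaningful for absolutely summable families.           *)
Definition rsum (f : G -> R) : R :=
  fine (\esum_(g in [set: G]) (Num.max (f g) 0)%:E) -
  fine (\esum_(g in [set: G]) (Num.max (- f g) 0)%:E).

Definition csum (f : G -> R[i]) : R[i] :=
  (rsum (fun g => complex.Re (f g)) +i* rsum (fun g => complex.Im (f g)))%C.

Definition l2dot xi eta : R[i] := csum (fun g => val xi g * (val eta g)^*).

Lemma left_transl_l2 (g : G) xi :
  (fun h => val xi (g^-1 * h)%g : R[i]^o) \in l2_pred.
Proof.
apply/asboolP; have /asboolP := valP xi; congr (_ < _)%E.
rewrite /l2sq (@reindex_esum _ _ _ [set: G] [set: G] (fun h => g^-1 * h)%g)//.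
split=> [//|h1 h2 _ _ /mulgI //|h _]; exists (g * h)%g => //.
by rewrite mulKg.
Qed.

Definition lregular (g : G) (xi : ell2) : ell2 :=
  @exist (G -> R[i]^o) (fun f => f \in l2_pred) _ (left_transl_l2 g xi).

(* Operators are everywhere defined linear maps; boundedness is separate.     *)
Definition operator : Type := {linear ell2 -> ell2}.

Implicit Types x y : operator.

Definition bounded_operator x : Prop :=
  exists K : R, forall xi,
    (l2sq (val (x xi)) <= (K ^+ 2)%:E * l2sq (val xi))%E.

(* VN(G), the bicommutant of the left regular representation.                 *)
Definition in_regular_commutant y : Prop :=
  bounded_operator y /\
  forall g xi, y (lregular g xi) = lregular g (y xi).

Definition in_VN x : Prop :=
  bounded_operator x /\
  forall y, in_regular_commutant y -> forall xi, x (y xi) = y (x xi).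

(* The norm of a matrix of operators acting on the m-fold sum of l^2(G).      *)
Definition mx_opnorm (m : nat) (x : 'I_m -> 'I_m -> operator) : \bar R :=
  ereal_inf [set K%:E | K in [set K : R | 0 <= K /\
    forall xi : 'I_m -> ell2,
      (\sum_(i < m) l2sq (val (\sum_(j < m) x i j (xi j))%R)
        <= (K ^+ 2)%:E * \sum_(j < m) l2sq (val (xi j)))%E]].

(* The Fourier algebra A(G) is the set of coefficients of the left regular    *)
(* representation.                                                            *)
Definition coefficient xi eta : G -> R[i] := fun g => l2dot (lregular g xi) eta.

Definition in_fourier_algebra (f : G -> R[i]) : Prop :=
  exists xi eta, f = coefficient xi eta.

Definition fourier_multiplier phi : Prop :=
  forall f, in_fourier_algebra f -> in_fourier_algebra (fun g => phi g * f g).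

(* VN(G) is the dual of A(G) via <x, coefficient xi eta> = l2dot (x xi) eta;  *)
(* y is the image of x under the transpose of the multiplication by phi:      *)
(* <y, f> = <x, phi f>.                                                       *)
Definition transpose_multiplier phi x y : Prop :=
  forall xi eta xi' eta',
    (forall g, coefficient xi' eta' g = phi g * coefficient xi eta g) ->
    l2dot (y xi) eta = l2dot (x xi') eta'.

(* The matrix amplifications of the transpose on VN(G) have norm at most C.   *)
Definition cb_bounded phi (C : R) : Prop :=
  forall (m : nat) (x : 'I_m -> 'I_m -> operator),
    (forall i j, in_VN (x i j)) ->
    exists y : 'I_m -> 'I_m -> operator,
      (forall i j, in_VN (y i j) /\ transpose_multiplier phi (x i j) (y i j)) /\
      (mx_opnorm y <= C%:E * mx_opnorm x)%E.

Definition cb_norm phi : \bar R :=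
  ereal_inf [set C%:E | C in [set C : R |
    [/\ 0 <= C, fourier_multiplier phi & cb_bounded phi C]]].

Definition cowling_haagerup : \bar R :=
  ereal_inf [set L%:E | L in [set L : R |
    exists (D : directed_set) (phi : D -> G -> R[i]),
      [/\ forall i, compactly_supported (phi i), cvg1_on_compacts phi &
          (ereal_sup (range (fun i => cb_norm (phi i))) <= L%:E)%E]]].

End Functions.

(* Main.v *)
From HB Require Import structures.
From mathcomp Require Import all_boot all_order all_algebra.
From mathcomp Require Import finmap.
From mathcomp Require Import all_classical all_reals all_analysis.
From mathcomp Require Import complex ring lra zify.
Require Import Defs.

Set Implicit Arguments.
Unset Strict Implicit.
Unset Printing Implicit Defensive.

Import Order.TTheory GRing.Theory Num.Theory.
Import ComplexField.Normc.

Local Open Scope classical_set_scope.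
Local Open Scope ring_scope.

(** The group [G] acts on its Bass-Serre tree with stabilizers isomorphic to
    [Z^n], and it also acts on [Q^n] by affine maps: a vertex group acts by
    translations, and crossing an edge [e] applies the linear map [C_e]
    determined by the two inclusions of the edge group.  The linear part of
    this action depends only on the loop of [X] underlying an element, because
    vertex groups contribute translations.  In each of the three cases the
    linear parts commute: the fundamental group of [X] is trivial or infinite
    cyclic, or the matrices have size one.  So the affine image [pi(G)] is
    metabelian, hence amenable, while [pi] is injective on each vertex group.

    Amenability is used through explicit finitely supported functions [psi] on
    the affine image: a Folner set of pairs (matrix, vector) is a product [F1 x F2],
    where [F1] is almost invariant under finitely many commuting matrices and
    [F2] under the finitely many translations that [F1] produces; both come
    from the polynomial growth of boxes ([folner_comm], [affine_folner]).

    Let [l(g)] be the displacement of the base vertex of the tree.  The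
    functions [r^l(g) psi(pi(g))] are positive definite and tend to [1] as [r]
    tends to [1] and [psi] to [1].  They vanish at infinity because the tree
    is locally finite and [pi] is injective on vertex groups, so that only
    finitely many [g] have a given [pi(g)] and bounded [l(g)]
    ([finite_fibers]).  This gives the Haagerup property.

    For the Cowling-Haagerup constant, cut [r^l] off at a large radius [N].
    The indicator of a sphere of radius [n] is a Schur multiplier of norm at most
    [2 (n + 1)], as two vertices at distance [n] are characterized by their
    common ancestors ([even_ball_sum]); so the cut costs at most
    [sum_(n >= N) 2 (n + 1) r^n], which is small ([schur_truncated]).  Hence [G] has
    finitely supported functions tending to [1] whose Schur norms tend to [1]
    ([tree_schur_approximable]).

    A Schur factorization bounds the completely bounded norm ([schur_bound]):
    on finitely supported vectors the multiplied operator is a sum of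
    compressions of the given one by diagonal operators.  It remains to know
    that an operator [x] of the von Neumann algebra pairs with a finitely
    supported coefficient through its Fourier coefficients alone.  Rather than
    through the bicommutant theorem, this follows from the approximation itself:
    the multipliers carry [x] to finite combinations of translations, which
    are bounded uniformly and converge weakly to [x] ([VN_duality]).

    The Bass-Serre tree is accessed through normal forms.  Serre's group acts on the
    right of the set of reduced words with chosen coset representatives, a
    letter affecting only the end of the word.  The vertices of the tree are
    the words without their final vertex group element, an ancestor of a word being a
    prefix, and the length of the normal form of [g^-1 h] is the tree
    distance between those of [g] and [h] ([size_tree_word]). *)

(** * Unconditional sums and the inner product of l^2(G) *)

Section HasSum.
Context (R : realType) (T : choiceType).
Local Open Scope fset_scope.
Local Open Scope ring_scope.
Implicit Types (f g : T -> R) (F : {fset T}).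

(** Unconditional convergence. In this form linearity of sums is immediate,
    and bounds on sums reduce to bounds on finite ones. *)
Definition has_sum f (s : R) : Prop := forall eps : R, 0 < eps ->
  exists F0 : {fset T}, forall F, F0 `<=` F -> `|s - \sum_(t <- F) f t| < eps.

Lemma sum_fsubset (V : nmodType) (f : T -> V) F F' : F `<=` F' ->
  \sum_(t <- F') f t = \sum_(t <- F) f t + \sum_(t <- F' `\` F) f t.
Proof.
move=> sF; rewrite (big_fsetID _ (mem F)) /=; congr (_ + _); apply: eq_fbigl => t.
  by rewrite !inE andbC; case: (boolP (t \in F)) => //= /(fsubsetP sF).
by rewrite !inE andbC.
Qed.

Lemma has_sum_unique f s s' : has_sum f s -> has_sum f s' -> s = s'.
Proof.
move=> hs hs'; apply/eqP; rewrite -subr_eq0 -normr_eq0; apply/eqP/le_anti.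
rewrite normr_ge0 andbT; apply/ler_addgt0Pr => e e0; rewrite add0r.
have e2 : 0 < e / 2 by lra.
have [F0 h0] := hs _ e2; have [F1 h1] := hs' _ e2.
have := h0 _ (fsubsetUl F0 F1); have := h1 _ (fsubsetUr F0 F1).
set S := \sum_(t <- _) _ => a b.
have -> : s - s' = (s - S) - (s' - S) by ring.
by rewrite (le_trans (ler_normB _ _))//; lra.
Qed.

Lemma has_sumD f g s t : has_sum f s -> has_sum g t ->
  has_sum (fun x => f x + g x) (s + t).
Proof.
move=> hf hg e e0; have e2 : 0 < e / 2 by lra.
have [F0 h0] := hf _ e2; have [F1 h1] := hg _ e2.
exists (F0 `|` F1) => F sF; rewrite big_split /=.
have := h0 _ (fsubset_trans (fsubsetUl _ _) sF).
have := h1 _ (fsubset_trans (fsubsetUr _ _) sF).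
move: (\sum_(i <- F) f i) (\sum_(i <- F) g i) => S S' a b.
have -> : s + t - (S + S') = (s - S) + (t - S') by ring.
by rewrite (le_lt_trans (ler_normD _ _))//; lra.
Qed.

Lemma has_sumZ c f s : has_sum f s -> has_sum (fun x => c * f x) (c * s).
Proof.
move=> hf e e0; have c1 : 0 < `|c| + 1 by rewrite ltr_wpDl.
have [F0 h0] := hf (e / (`|c| + 1)) (divr_gt0 e0 c1).
exists F0 => F /h0 h; rewrite -mulr_sumr -mulrBr normrM.
rewrite ltr_pdivlMr// in h; apply: le_lt_trans h.
by rewrite mulrC ler_wpM2l// lerDl.
Qed.

Lemma has_sum_fset f F : (forall t, t \notin F -> f t = 0) ->
  has_sum f (\sum_(t <- F) f t).
Proof.
move=> f0 e e0; exists F => F' sF.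
rewrite (sum_fsubset _ sF); suff -> : \sum_(t <- F' `\` F) f t = 0.
  by rewrite addr0 subrr normr0.
by rewrite big1_seq// => t; rewrite !inE => /andP[_ /andP[/f0]].
Qed.

Lemma has_sum_le f s F : has_sum f s -> (forall t, 0 <= f t) ->
  \sum_(t <- F) f t <= s.
Proof.
move=> hs f0; apply/ler_addgt0Pr => e e0.
have [F0 h] := hs _ e0; have := h _ (fsubsetUl F0 F).
rewrite (sum_fsubset _ (fsubsetUr F0 F)).
have : 0 <= \sum_(t <- (F0 `|` F) `\` F) f t by apply: sumr_ge0.
by rewrite ltr_distl => ? /andP[]; lra.
Qed.

Lemma has_sum_ge f s M : has_sum f s -> (forall F, \sum_(t <- F) f t <= M) ->
  s <= M.
Proof.
move=> hs fM; apply/ler_addgt0Pr => e e0.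
have [F0 h] := hs _ e0; have := h _ (fsubset_refl F0); have := fM F0.
by rewrite ltr_distl => ? /andP[]; lra.
Qed.

Lemma esum_fset_le f F : (forall t, 0 <= f t) ->
  ((\sum_(t <- F) f t)%:E <= \esum_(t in [set: T]) (f t)%:E)%E.
Proof.
move=> f0; rewrite -sumEFin; apply: ereal_sup_ubound.
exists [set` F]; first by split => //; exact: finite_fset.
by rewrite fsbig_finite ?finite_fset //= set_fsetK.
Qed.

Lemma esum_le_fset f M : (forall F, \sum_(t <- F) f t <= M) ->
  (\esum_(t in [set: T]) (f t)%:E <= M%:E)%E.
Proof.
move=> fM; apply: ge_ereal_sup => _ [A [finA _] <-].
by rewrite fsbig_finite // sumEFin lee_fin.
Qed.

Lemma has_sum_esum f : (forall t, 0 <= f t) ->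
  (\esum_(t in [set: T]) (f t)%:E < +oo)%E ->
  has_sum f (fine (\esum_(t in [set: T]) (f t)%:E)).
Proof.
move=> f0 fy e e0.
set S := \esum_(t in _) _ in fy *.
have S0 : (0 <= S)%E by apply: esum_ge0 => t _; rewrite lee_fin.
have fS : S \is a fin_num by rewrite ge0_fin_numE.
have : ((fine S - e)%:E < S)%E by rewrite -{2}(fineK fS) lte_fin ltrBlDr ltrDl.
move=> /ereal_sup_gt [_ [A [finA _] <-]]; rewrite fsbig_finite// sumEFin lte_fin => h.
exists (fset_set A) => F sF.
have le1 : \sum_(t <- fset_set A) f t <= \sum_(t <- F) f t.
  by rewrite [leRHS](sum_fsubset _ sF) lerDl sumr_ge0.
have : ((\sum_(t <- F) f t)%:E <= S)%E by apply: esum_fset_le.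
rewrite -{1}(fineK fS) lee_fin => le2.
by rewrite ltr_distl; apply/andP; split; lra.
Qed.

Lemma has_sum_ext f g s : f =1 g -> has_sum f s -> has_sum g s.
Proof. by move=> /funext ->. Qed.
End HasSum.

Section Ell2.
Context (R : realType) (G : groupType).
Implicit Types (xi eta : ell2 R G) (F : {fset G}) (g h k : G).
Local Open Scope fset_scope.
Local Open Scope ring_scope.

(** Bounded absolute finite sums make the positive and the negative part
    summable, so that the difference of the two suprema is a limit along
    finite sets. *)
Lemma has_sum_rsum (f : G -> R) M :
  (forall F, \sum_(t <- F) `|f t| <= M) -> has_sum f (rsum f).
Proof.
move=> fM.
have lty (h : G -> R) : (forall t, h t <= `|f t|) ->
    (\esum_(t in [set: G]) (h t)%:E < +oo)%E.
  move=> hf; apply: (@le_lt_trans _ _ M%:E); last exact: ltry.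
  apply: esum_le_fset => F; apply: le_trans (fM F); exact: ler_sum.
have hp : has_sum (fun t => Num.max (f t) 0)
    (fine (\esum_(t in [set: G]) (Num.max (f t) 0)%:E)).
  apply: has_sum_esum => [t|]; first by rewrite le_max lexx orbT.
  by apply: lty => t; rewrite ge_max ler_norm normr_ge0.
have hn : has_sum (fun t => Num.max (- f t) 0)
    (fine (\esum_(t in [set: G]) (Num.max (- f t) 0)%:E)).
  apply: has_sum_esum => [t|]; first by rewrite le_max lexx orbT.
  by apply: lty => t; rewrite ge_max -normrN ler_norm normr_ge0.
have := has_sumD hp (has_sumZ (-1) hn); rewrite mulN1r.
apply: has_sum_ext => t; rewrite mulN1r.
by case: (leP 0 (f t)) => ft; rewrite /Num.max; do 2!case: ltP; lra.
Qed.

Definition norm2 (f : G -> R[i]) : G -> R := fun g => normc (f g) ^+ 2.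

(** A real number, since elements of [ell2] have finite square norm. *)
Definition sqn xi : R := fine (l2sq (val xi)).

Lemma norm2_ge0 f g : 0 <= norm2 f g. Proof. exact: sqr_ge0. Qed.

Lemma l2sqE xi : l2sq (val xi) = (sqn xi)%:E.
Proof.
rewrite /sqn fineK// ge0_fin_numE; first by have /asboolP := valP xi.
by apply: esum_ge0 => g _; rewrite lee_fin sqr_ge0.
Qed.

Lemma has_sum_sqn xi : has_sum (norm2 (val xi)) (sqn xi).
Proof.
apply: has_sum_esum; first exact: norm2_ge0.
by have /asboolP := valP xi.
Qed.

Lemma sum_sqn_le xi F : \sum_(g <- F) norm2 (val xi) g <= sqn xi.
Proof. exact: has_sum_le (has_sum_sqn xi) (norm2_ge0 _). Qed.

Lemma sqn_le xi M : (forall F, \sum_(g <- F) norm2 (val xi) g <= M) -> sqn xi <= M.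
Proof. exact: has_sum_ge (has_sum_sqn xi). Qed.

Lemma sqn_ge0 xi : 0 <= sqn xi.
Proof. by have := sum_sqn_le xi fset0; rewrite big_seq_fset0. Qed.

Lemma normc_sqr (z : R[i]) : normc z ^+ 2 = complex.Re z ^+ 2 + complex.Im z ^+ 2.
Proof. by case: z => a b /=; rewrite sqr_sqrtr// addr_ge0 ?sqr_ge0. Qed.

Lemma conjE (z : R[i]) : z^* = (complex.Re z -i* complex.Im z)%C.
Proof. by case: z. Qed.

Lemma Re_mulJ (z w : R[i]) : complex.Re (z * w^*) =
  complex.Re z * complex.Re w + complex.Im z * complex.Im w.
Proof. by case: z => a b; case: w => c d; rewrite conjE /=; ring. Qed.

Lemma Im_mulJ (z w : R[i]) : complex.Im (z * w^*) =
  complex.Im z * complex.Re w - complex.Re z * complex.Im w.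
Proof. by case: z => a b; case: w => c d; rewrite conjE /=; ring. Qed.

(** The form of the Cauchy-Schwarz inequality used throughout: a free weight
    [s] replaces the square roots. *)
Lemma amgm_Re (s : R) (z w : R[i]) : 0 < s ->
  2 * `|complex.Re (z * w^*)| <= s * normc z ^+ 2 + s^-1 * normc w ^+ 2.
Proof.
move=> s0; rewrite Re_mulJ !normc_sqr.
move: (complex.Re z) (complex.Im z) (complex.Re w) (complex.Im w) => a b c d.
have key x y : 2 * `|x * y| <= s * x ^+ 2 + s^-1 * y ^+ 2.
  rewrite normrM -[x ^+ 2]real_normK ?num_real// -[y ^+ 2]real_normK ?num_real//.
  move: `|x| `|y| => {}x {}y.
  rewrite -subr_ge0 (_ : _ - _ = s^-1 * (s * x - y) ^+ 2).
    by rewrite mulr_ge0 ?sqr_ge0 ?invr_ge0 ?ltW.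
  by field; rewrite gt_eqF.
have := ler_normD (a * c) (b * d); have := key a c; have := key b d.
by rewrite !mulrDr; lra.
Qed.

(** The case of the imaginary part follows by rotating [w] by [i]. *)
Lemma amgm_Im (s : R) (z w : R[i]) : 0 < s ->
  2 * `|complex.Im (z * w^*)| <= s * normc z ^+ 2 + s^-1 * normc w ^+ 2.
Proof.
move=> s0; have := amgm_Re z (w * 'i%C) s0.
rewrite normcM.
have -> : normc ('i%C : R[i]) = 1 by rewrite /= expr0n expr1n add0r sqrtr1.
rewrite mulr1; congr (_ * `|_| <= _).
by case: z => a b; case: w => c d; rewrite Im_mulJ !conjE /=; ring.
Qed.

Definition has_csum (f : G -> R[i]) (z : R[i]) : Prop :=
  has_sum (fun g => complex.Re (f g)) (complex.Re z) /\
  has_sum (fun g => complex.Im (f g)) (complex.Im z).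

Lemma ReD (z w : R[i]) : complex.Re (z + w) = complex.Re z + complex.Re w.
Proof. by case: z; case: w. Qed.

Lemma ImD (z w : R[i]) : complex.Im (z + w) = complex.Im z + complex.Im w.
Proof. by case: z; case: w. Qed.

Lemma Re_sum (I : Type) (r : seq I) (f : I -> R[i]) :
  complex.Re (\sum_(i <- r) f i) = \sum_(i <- r) complex.Re (f i).
Proof. by apply: (big_morph _ ReD). Qed.

Lemma Im_sum (I : Type) (r : seq I) (f : I -> R[i]) :
  complex.Im (\sum_(i <- r) f i) = \sum_(i <- r) complex.Im (f i).
Proof. by apply: (big_morph _ ImD). Qed.

Lemma has_csum_unique f z w : has_csum f z -> has_csum f w -> z = w.
Proof.
case: z w => a b [c d] [/= h1 h2] [/= h3 h4].
by rewrite (has_sum_unique h1 h3) (has_sum_unique h2 h4).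
Qed.

Lemma has_csumD f f' z w : has_csum f z -> has_csum f' w ->
  has_csum (fun g => f g + f' g) (z + w).
Proof.
move=> [h1 h2] [h3 h4]; split; rewrite ?ReD ?ImD.
  by apply: has_sum_ext (has_sumD h1 h3) => g; rewrite ReD.
by apply: has_sum_ext (has_sumD h2 h4) => g; rewrite ImD.
Qed.

Lemma has_csumZ c f z : has_csum f z -> has_csum (fun g => c * f g) (c * z).
Proof.
case: c z => a b [u v] [/= h1 h2].
have hm (x y : R[i]) : complex.Re (x * y) = complex.Re x * complex.Re y -
    complex.Im x * complex.Im y by case: x y => ? ? [].
have hi (x y : R[i]) : complex.Im (x * y) = complex.Re x * complex.Im y +
    complex.Im x * complex.Re y by case: x y => ? ? [].
split; rewrite ?hm ?hi /= -?mulNr.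
  by apply: has_sum_ext (has_sumD (has_sumZ a h1) (has_sumZ (- b) h2)) => g; rewrite hm mulNr.
by apply: has_sum_ext (has_sumD (has_sumZ a h2) (has_sumZ b h1)) => g; rewrite hi.
Qed.

Lemma has_csum_fset f F : (forall g, g \notin F -> f g = 0) ->
  has_csum f (\sum_(g <- F) f g).
Proof.
by move=> f0; split; rewrite ?Re_sum ?Im_sum;
  apply: has_sum_fset => g /f0 ->.
Qed.

Lemma has_csum_dot xi eta :
  has_csum (fun g => val xi g * (val eta g)^*) (l2dot xi eta).
Proof.
have bd (f : G -> R) : (forall g, 2 * `|f g| <= 1 * norm2 (val xi) g + 1^-1 * norm2 (val eta) g) ->
    forall F, \sum_(t <- F) `|f t| <= sqn xi + sqn eta.
  move=> hf F.
  apply: (@le_trans _ _ (\sum_(t <- F) (norm2 (val xi) t + norm2 (val eta) t))).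
    apply: ler_sum => t _; have := hf t; have := normr_ge0 (f t).
    by rewrite invr1 !mul1r; lra.
  by rewrite big_split /= lerD ?sum_sqn_le.
split; apply: has_sum_rsum (bd _ _) => g; first exact: amgm_Re.
exact: amgm_Im.
Qed.

Lemma dot_fset xi eta F : (forall g, g \notin F -> val xi g * (val eta g)^* = 0) ->
  l2dot xi eta = \sum_(g <- F) val xi g * (val eta g)^*.
Proof. by move=> /has_csum_fset; exact: has_csum_unique (has_csum_dot xi eta). Qed.

Lemma dotDl xi xi' eta : l2dot (xi + xi') eta = l2dot xi eta + l2dot xi' eta.
Proof.
apply: has_csum_unique (has_csum_dot _ _) _.
have := has_csumD (has_csum_dot xi eta) (has_csum_dot xi' eta).
by congr has_csum; apply/funext => g; rewrite -mulrDl.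
Qed.

Lemma dotZl c xi eta : l2dot (c *: xi) eta = c * l2dot xi eta.
Proof.
apply: has_csum_unique (has_csum_dot _ _) _.
have := has_csumZ c (has_csum_dot xi eta).
by congr has_csum; apply/funext => g; rewrite mulrA.
Qed.

Lemma dotDr xi eta eta' : l2dot xi (eta + eta') = l2dot xi eta + l2dot xi eta'.
Proof.
apply: has_csum_unique (has_csum_dot _ _) _.
have := has_csumD (has_csum_dot xi eta) (has_csum_dot xi eta').
by congr has_csum; apply/funext => g; rewrite -mulrDr -rmorphD.
Qed.

Lemma dotNl xi eta : l2dot (- xi) eta = - l2dot xi eta.
Proof. by rewrite -scaleN1r dotZl mulN1r. Qed.

Lemma dot_suml (I : Type) (r : seq I) (f : I -> ell2 R G) eta :
  l2dot (\sum_(i <- r) f i) eta = \sum_(i <- r) l2dot (f i) eta.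
Proof.
elim: r => [|i r IH]; rewrite ?big_nil ?big_cons ?dotDl ?IH//.
by rewrite -(scale0r 0) dotZl mul0r.
Qed.

Lemma Re_dot_le s xi eta : 0 < s ->
  2 * complex.Re (l2dot xi eta) <= s * sqn xi + s^-1 * sqn eta.
Proof.
move=> s0.
have := has_sumD (has_sumD (has_sumZ s (has_sum_sqn xi)) (has_sumZ s^-1 (has_sum_sqn eta)))
  (has_sumZ (-2) (has_csum_dot xi eta).1).
move=> /(@has_sum_le _ _ _ _ fset0).
rewrite big_seq_fset0 => h.
suff : 0 <= s * sqn xi + s^-1 * sqn eta + -2 * complex.Re (l2dot xi eta) by lra.
apply: h => g; have := amgm_Re (val xi g) (val eta g) s0.
have := ler_norm (complex.Re (val xi g * (val eta g)^* )).
by rewrite /norm2; lra.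
Qed.

End Ell2.

(** * Operators on l^2(G) and the group von Neumann algebra *)

Section Operators.
Context (R : realType) (G : groupType).
Implicit Types (xi eta : ell2 R G) (F : {fset G}) (g h k : G) (x y : operator R G).
Local Open Scope fset_scope.
Local Open Scope ring_scope.

Lemma mem_l2 (f : G -> R[i]^o) M :
  (forall F, \sum_(g <- F) norm2 f g <= M) -> f \in l2_pred (G := G).
Proof.
by move=> fM; apply/asboolP/(@le_lt_trans _ _ M%:E); [exact: esum_le_fset|exact: ltry].
Qed.

Lemma fvec_subproof F (f : G -> R[i]) :
  (fun g => if g \in F then f g else 0 : R[i]^o) \in l2_pred (G := G).
Proof.
set u := fun _ => _.
apply: (@mem_l2 _ (\sum_(g <- F) norm2 u g)) => F'.
have : has_sum (norm2 u) (\sum_(g <- F) norm2 u g).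
  by apply: has_sum_fset => g /negPf; rewrite /norm2 /u => ->; rewrite normc0 expr0n.
by move=> /has_sum_le; apply => g; exact: sqr_ge0.
Qed.

(** Restriction of a function to a finite set; these vectors are dense. *)
Definition fvec F (f : G -> R[i]) : ell2 R G :=
  @exist (G -> R[i]^o) (fun f => f \in l2_pred (G := G)) _ (fvec_subproof F f).

Definition delta h : ell2 R G := fvec [fset h] (fun=> 1).

Lemma fvecE F f g : val (fvec F f) g = if g \in F then f g else 0.
Proof. by []. Qed.

Lemma deltaE h g : val (delta h) g = (g == h)%:R.
Proof. by rewrite fvecE inE; case: eqP. Qed.

Lemma sqn_fvec F f : sqn (fvec F f) = \sum_(g <- F) norm2 f g.
Proof.
apply: has_sum_unique (has_sum_sqn _) _.
have := @has_sum_fset R G (norm2 (val (fvec F f))) F.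
have -> : \sum_(t <- F) norm2 (val (fvec F f)) t = \sum_(g <- F) norm2 f g.
  by apply: eq_big_seq => g gF; rewrite /norm2 fvecE gF.
by apply => g /negPf gF; rewrite /norm2 fvecE gF normc0 expr0n.
Qed.

Lemma val_sum (I : Type) (r : seq I) (f : I -> ell2 R G) g :
  val (\sum_(i <- r) f i) g = \sum_(i <- r) val (f i) g.
Proof. by elim: r => [|i r IH]; rewrite ?big_nil ?big_cons//= -IH. Qed.

Lemma ell2P xi eta : (forall g, val xi g = val eta g) -> xi = eta.
Proof. by move=> h; apply/val_inj/funext. Qed.

Lemma fvec_delta F f : fvec F f = \sum_(h <- F) f h *: delta h.
Proof.
apply: ell2P => g; rewrite val_sum fvecE.
have -> : \sum_(i <- F) val (f i *: delta i) g = \sum_(i <- F) f i * (g == i)%:R.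
  by apply: eq_bigr => h _; rewrite -deltaE.
case: ifP => [gF|/negbT gF].
  rewrite (big_fsetD1 g)//= eqxx mulr1 big1_seq ?addr0// => h.
  by rewrite !inE eq_sym => /andP[_ /andP[/negPf -> _]]; rewrite mulr0.
rewrite big1_seq// => h /andP[_ hF]; case: eqP => [e|]; last by rewrite mulr0.
by rewrite e hF in gF.
Qed.

Definition operator_of (f : ell2 R G -> ell2 R G) (lf : linear f) : operator R G :=
  HB.pack f (GRing.isLinear.Build R[i] (ell2 R G) (ell2 R G) *:%R f lf).

Lemma operator_ofE f lf xi : @operator_of f lf xi = f xi.
Proof. by []. Qed.

Lemma l2sq_reindex (f : G -> R[i]) (s : G -> G) : bijective s ->
  l2sq (f \o s) = l2sq f.
Proof.
move=> bs; rewrite /l2sq; apply/esym/(@reindex_esum _ _ _ [set: G] [set: G] s) => //.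
split=> // [a b _ _|a _]; first exact: (bij_inj bs).
by case: bs => t st ts; exists (t a).
Qed.

Lemma sqn_lregular g xi : sqn (lregular g xi) = sqn xi.
Proof.
congr fine; apply: (@l2sq_reindex (val xi) (fun h => g^-1 * h)%g).
by exists (fun h => g * h)%g => h; rewrite ?mulKg ?mulVKg// ?mulgA ?mulgV ?mul1g.
Qed.

Lemma lregular_linear g : linear (@lregular R G g).
Proof. by move=> c xi eta; apply: ell2P. Qed.

Lemma right_transl_l2 h xi :
  (fun k => val xi (k * h)%g : R[i]^o) \in l2_pred (G := G).
Proof.
apply/asboolP; have /asboolP := valP xi; congr (_ < _)%E.
rewrite -(@l2sq_reindex (val xi) (fun k => k * h)%g)//.
by exists (fun k => k * h^-1)%g => k; rewrite -mulgA ?mulgV ?mulVg mulg1.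
Qed.

Definition rregular h xi : ell2 R G :=
  @exist (G -> R[i]^o) (fun f => f \in l2_pred (G := G)) _ (right_transl_l2 h xi).

Lemma rregular_linear h : linear (rregular h).
Proof. by move=> c xi eta; apply: ell2P. Qed.

Lemma sqn_rregular h xi : sqn (rregular h xi) = sqn xi.
Proof.
congr fine; apply: (@l2sq_reindex (val xi) (fun k => k * h)%g).
by exists (fun k => k * h^-1)%g => k; rewrite -mulgA ?mulgV ?mulVg mulg1.
Qed.

Lemma bounded_operatorP x :
  bounded_operator x <-> exists K : R, forall xi, sqn (x xi) <= K ^+ 2 * sqn xi.
Proof.
by split=> -[K hK]; exists K => xi; have := hK xi; rewrite !l2sqE -EFinM lee_fin.
Qed.

(** Right translations commute with the left regular representation, so an
    element of the bicommutant commutes with them and is determined by its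
    value at the base vector: it is a left convolution operator. *)
Lemma in_VN_delta x h k : in_VN x ->
  val (x (delta h)) k = val (x (delta 1%g)) (k * h^-1)%g.
Proof.
move=> [_ xc].
have [cr1 cr2] : in_regular_commutant (operator_of (rregular_linear h^-1)).
  split.
    by apply/bounded_operatorP; exists 1 => xi; rewrite sqn_rregular expr1n mul1r.
  by move=> g xi; apply: ell2P => t /=; rewrite mulgA.
have -> : delta h = rregular h^-1%g (delta 1%g).
  apply: ell2P => t /=; rewrite !inE; congr (if _ then _ else _).
  by rewrite -[RHS](inj_eq (mulIg h)) mulgVK mul1g.
by rewrite -(operator_ofE (rregular_linear h^-1%g)) xc.
Qed.

Lemma sqnD_le xi eta : sqn (xi + eta) <= 2 * sqn xi + 2 * sqn eta.
Proof.
apply: sqn_le => F.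
apply: (@le_trans _ _ (\sum_(g <- F) (2 * norm2 (val xi) g + 2 * norm2 (val eta) g))).
  by apply: ler_sum => g _; exact: normcD_sqr.
rewrite big_split /= -!mulr_sumr; have := sum_sqn_le xi F.
by have := sum_sqn_le eta F; lra.
Qed.

Lemma sqnZ c xi : sqn (c *: xi) = normc c ^+ 2 * sqn xi.
Proof.
apply: has_sum_unique (has_sum_sqn _) _.
apply: has_sum_ext (has_sumZ (normc c ^+ 2) (has_sum_sqn xi)) => g.
by rewrite /norm2 -exprMn -normcM.
Qed.

Lemma sqn0 : sqn (0 : ell2 R G) = 0.
Proof. by rewrite -(scale0r 0) sqnZ normc0 expr0n mul0r. Qed.

(** The operator whose Fourier coefficient at [g] is [phi g] times that of
    [x]: a finite combination of left translations. *)
Definition mul_op (phi : G -> R) F x xi : ell2 R G :=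
  \sum_(g <- F) ((phi g)%:C%C * val (x (delta 1%g)) g) *: lregular g xi.

Lemma mul_op_linear phi F x : linear (mul_op phi F x).
Proof.
move=> c xi eta; rewrite /mul_op scaler_sumr -big_split /=.
apply: eq_bigr => g _; rewrite lregular_linear scalerDr !scalerA.
by rewrite [c * _]mulrC.
Qed.

Definition multop phi F x : operator R G := operator_of (mul_op_linear phi F x).

Lemma multopE phi F x xi k : val (multop phi F x xi) k =
  \sum_(g <- F) ((phi g)%:C%C * val (x (delta 1%g)) g) * val xi (g^-1 * k)%g.
Proof. by rewrite /= val_sum. Qed.

(** Finite combinations of translations are bounded and commute with every
    operator that commutes with translations. *)
Lemma multop_VN phi F x : in_VN (multop phi F x).
Proof.
split.
  apply/bounded_operatorP.
  suff [K0 h] : exists K0, forall xi, sqn (multop phi F x xi) <= K0 * sqn xi.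
    exists (Num.sqrt (Num.max K0 0)) => xi; rewrite sqr_sqrtr ?le_max ?lexx ?orbT//.
    apply: le_trans (h xi) _; apply: ler_wpM2r; first exact: sqn_ge0.
    by rewrite le_max lexx.
  rewrite /multop /operator_of /= /mul_op; elim: (enum_fset F) => [|g r [K IH]].
    by exists 0 => xi; rewrite big_nil sqn0 mul0r.
  set c := (phi g)%:C%C * val (x (delta 1%g)) g.
  exists (2 * normc c ^+ 2 + 2 * K) => xi; rewrite big_cons.
  apply: le_trans (sqnD_le _ _) _; rewrite sqnZ sqn_lregular.
  by have := IH xi; rewrite mulrDl !mulrA; lra.
move=> y [_ yc] xi; rewrite /= /mul_op linear_sum; apply: eq_bigr => g _.
by rewrite linearZ /= yc.
Qed.

Lemma op_fvec x F f k :
  val (x (fvec F f)) k = \sum_(h <- F) f h * val (x (delta h)) k.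
Proof.
rewrite fvec_delta (linear_sum x) val_sum; apply: eq_bigr => h _.
by rewrite (linearZZ x).
Qed.

(** In matrix terms, the multiplier acts on [x] as the Schur product with the
    kernel [phi(k h^-1)]. *)
Lemma multop_delta phi F x h k : (forall g, g \notin F -> phi g = 0) -> in_VN x ->
  val (multop phi F x (delta h)) k =
  (phi (k * h^-1)%g)%:C%C * val (x (delta h)) k.
Proof.
move=> phi0 xVN; rewrite multopE (in_VN_delta _ _ xVN).
set u := (k * h^-1)%g.
have eu g : (g^-1 * k == h)%g = (g == u).
  by rewrite -[LHS](inj_eq (mulgI g)) mulVKg -[LHS](inj_eq (mulIg h^-1%g)) mulgK eq_sym.
under eq_bigr do rewrite deltaE eu.
have [uF|uF] := boolP (u \in F).
  rewrite (big_fsetD1 u)//= eqxx mulr1 big1_seq ?addr0// => g.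
  by rewrite !inE => /andP[_ /andP[/negPf -> _]]; rewrite mulr0.
rewrite phi0// mul0r big1_seq// => g /andP[_ gF].
by case: eqP => [e|]; [rewrite -e gF in uF|rewrite mulr0].
Qed.

End Operators.

(** * Schur kernels bound amplified multipliers *)

Section SchurDef.
Context (R : realType).

(** Kernels [kappa(s,t) = <a_t, b_s>] with vectors of square norm at most [C].
    Only finite sets of points are factored at a time: the norm of an operator
    is tested on finitely supported vectors, and the vectors may then be
    finite lists of coordinates. *)
Definition schur_kernel (T : eqType) (kappa : T -> T -> R) (C : R) : Prop :=
  forall E : seq T, exists l : seq ((T -> R) * (T -> R)),
    [/\ {in E &, forall s t, kappa s t = \sum_(p <- l) p.1 s * p.2 t},
        {in E, forall s, \sum_(p <- l) p.1 s ^+ 2 <= C} &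
        {in E, forall t, \sum_(p <- l) p.2 t ^+ 2 <= C}].

Definition schur_le (G : groupType) (phi : G -> R) (C : R) : Prop :=
  schur_kernel (fun g h => phi (g^-1 * h)%g) C.

End SchurDef.

Section SchurBound.
Context (R : realType) (G : groupType).
Implicit Types (F : {fset G}) (g h k : G).
Local Open Scope fset_scope.
Local Open Scope ring_scope.

Lemma normcR (a : R) : normc (a%:C%C) ^+ 2 = a ^+ 2.
Proof. by rewrite normc_sqr /= expr0n addr0. Qed.

Lemma conj_realc (a : R) : (a%:C%C)^* = a%:C%C.
Proof. by rewrite conjE /= oppr0. Qed.

Lemma sum_sqn_le_fset m (xi : 'I_m -> ell2 R G) M :
  (forall F, \sum_(i < m) \sum_(k <- F) norm2 (val (xi i)) k <= M) ->
  \sum_(i < m) sqn (xi i) <= M.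
Proof.
move=> hM.
have : has_sum (fun k => \sum_(i < m) norm2 (val (xi i)) k) (\sum_(i < m) sqn (xi i)).
  elim: (index_enum _) => [|i r IH].
    rewrite big_nil; have := @has_sum_fset R G (fun=> 0) fset0.
    rewrite big_seq_fset0 => /(_ (fun _ _ => erefl)).
    by apply: has_sum_ext => k; rewrite big_nil.
  rewrite big_cons; apply: has_sum_ext (has_sumD (has_sum_sqn (xi i)) IH) => k.
  by rewrite big_cons.
by move=> /has_sum_ge; apply=> F; rewrite exchange_big.
Qed.

(** Write [phi(k h^-1) = sum_p b_p(k) a_p(h)]. On finitely supported vectors
    the multiplied operator is [sum_p b_p x a_p], with diagonal operators
    [a_p] and [b_p]. For [Q] the square norm of the image, pairing the image
    with itself and splitting each product by the arithmetic-geometric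
    inequality with weight [C] gives [2 Q <= (C K)^2 N + Q]. The passage to
    all vectors is exact: a coordinate of the image involves only finitely
    many coordinates of the vector. *)
Lemma schur_bound (phi : G -> R) C F m (x : 'I_m -> 'I_m -> operator R G) K :
  0 < C -> schur_le phi C -> (forall g, g \notin F -> phi g = 0) ->
  (forall i j, in_VN (x i j)) ->
  (forall xi : 'I_m -> ell2 R G,
    \sum_(i < m) sqn (\sum_(j < m) x i j (xi j)) <= K ^+ 2 * \sum_(j < m) sqn (xi j)) ->
  forall xi : 'I_m -> ell2 R G,
    \sum_(i < m) sqn (\sum_(j < m) multop phi F (x i j) (xi j))
      <= (C * K) ^+ 2 * \sum_(j < m) sqn (xi j).
Proof.
move=> C0 hphi phi0 xVN xK xi; apply: sum_sqn_le_fset => F'.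
(* The only coordinates of the vectors that affect those of the image in [F']. *)
pose E := [fset (g^-1 * k)%g | g in F, k in F'].
pose xi' j := fvec E (val (xi j)).
pose eta i k := val (\sum_(j < m) multop phi F (x i j) (xi' j)) k.
have -> : \sum_(i < m) \sum_(k <- F')
      norm2 (val (\sum_(j < m) multop phi F (x i j) (xi j))) k =
    \sum_(i < m) \sum_(k <- F') norm2 (eta i) k.
  apply: eq_bigr => i _; apply: eq_big_seq => k kF'; rewrite /norm2 /eta !val_sum.
  congr (normc _ ^+ 2); apply: eq_bigr => j _; rewrite !multopE.
  apply: eq_big_seq => g gF; rewrite fvecE ifT//.
  by apply/imfset2P; exists g => //; exists k.
(* [phi (k * h^-1)] is the value of the kernel at [k^-1] and [h^-1]. *)
have [l [hl hl1 hl2]] :=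
  hphi ([seq k^-1%g | k <- enum_fset F'] ++ [seq h^-1%g | h <- enum_fset E]).
pose xp (p : (G -> R) * (G -> R)) j :=
  fvec E (fun h => (p.2 h^-1%g)%:C%C * val (xi j) h).
pose v p i k := val (\sum_(j < m) x i j (xp p j)) k.
have etaE i k : k \in F' -> eta i k = \sum_(p <- l) (p.1 k^-1%g)%:C%C * v p i k.
  move=> kF'.
  transitivity (\sum_(j < m) \sum_(h <- E) \sum_(p <- l)
      (p.1 k^-1%g)%:C%C * ((p.2 h^-1%g)%:C%C * val (xi j) h * val (x i j (delta R h)) k)).
    rewrite /eta val_sum; apply: eq_bigr => j _.
    rewrite op_fvec; apply: eq_big_seq => h hE.
    have kE : k^-1%g \in [seq k^-1%g | k <- enum_fset F'] ++ [seq h^-1%g | h <- enum_fset E].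
      by rewrite mem_cat; apply/orP; left; apply: map_f.
    have hEE : h^-1%g \in [seq k^-1%g | k <- enum_fset F'] ++ [seq h^-1%g | h <- enum_fset E].
      by rewrite mem_cat; apply/orP; right; apply: map_f.
    rewrite multop_delta// -{1}[k]invgK hl// rmorph_sum mulr_suml mulr_sumr.
    by apply: eq_bigr => p _; rewrite rmorphM; ring.
  under eq_bigr do rewrite exchange_big /=.
  rewrite exchange_big /=; apply: eq_bigr => p _.
  rewrite /v val_sum mulr_sumr; apply: eq_bigr => j _.
  by rewrite op_fvec mulr_sumr.
set Q := (X in X <= _).
set N := \sum_(j < m) sqn (xi j).
have N0 : 0 <= N by apply: sumr_ge0 => j _; exact: sqn_ge0.
pose A := \sum_(p <- l) \sum_(i < m) \sum_(k <- F') norm2 (v p i) k.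
pose B := \sum_(p <- l) \sum_(i < m) \sum_(k <- F') p.1 k^-1%g ^+ 2 * norm2 (eta i) k.
have QAB : 2 * Q <= C * A + C^-1 * B.
  rewrite /A /B !mulr_sumr -big_split /=.
  have -> : \sum_(i < m) 2 * (\sum_(k <- F') norm2 (eta i) k) =
     \sum_(p <- l) \sum_(i < m) \sum_(k <- F')
       2 * complex.Re (v p i k * ((p.1 k^-1%g)%:C%C * eta i k)^*).
    rewrite exchange_big /=; apply: eq_bigr => i _.
    rewrite exchange_big /= mulr_sumr; apply: eq_big_seq => k kF'.
    rewrite -mulr_sumr -Re_sum; congr (_ * _).
    rewrite /norm2 normc_sqr !expr2 -Re_mulJ {1}etaE// mulr_suml; congr complex.Re.
    apply: eq_bigr => p _; rewrite rmorphM mulrA; congr (_ * _).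
    by rewrite mulrC; congr (_ * _); exact/esym/conj_realc.
  apply: ler_sum => p _; rewrite !mulr_sumr -big_split /=.
  apply: ler_sum => i _; rewrite !mulr_sumr -big_split /=.
  apply: ler_sum => k _.
  have := amgm_Re (v p i k) ((p.1 k^-1%g)%:C%C * eta i k) C0.
  have := ler_norm (complex.Re (v p i k * ((p.1 k^-1%g)%:C%C * eta i k)^*)).
  by rewrite normcM exprMn normcR /norm2; lra.
have BQ : B <= C * Q.
  rewrite /B exchange_big mulr_sumr /=; apply: ler_sum => i _.
  rewrite exchange_big mulr_sumr /=; rewrite big_seq [leRHS]big_seq; apply: ler_sum => k kF'.
  rewrite -mulr_suml; apply: ler_wpM2r; first exact: sqr_ge0.
  by apply: hl1; rewrite mem_cat; apply/orP; left; apply: map_f.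
have AN : A <= K ^+ 2 * (C * N).
  apply: (@le_trans _ _ (\sum_(p <- l) K ^+ 2 * \sum_(j < m) sqn (xp p j))).
    apply: ler_sum => p _; apply: le_trans (xK (xp p)).
    by apply: ler_sum => i _; exact: sum_sqn_le.
  rewrite -mulr_sumr; apply: ler_wpM2l; first exact: sqr_ge0.
  rewrite exchange_big mulr_sumr /=; apply: ler_sum => j _.
  under eq_bigr do rewrite sqn_fvec.
  rewrite exchange_big /=.
  apply: (@le_trans _ _ (\sum_(h <- E) C * norm2 (val (xi j)) h)).
    rewrite big_seq [leRHS]big_seq; apply: ler_sum => h hE.
    under eq_bigr do rewrite /norm2 normcM exprMn normcR.
    rewrite -mulr_suml; apply: ler_wpM2r; first exact: sqr_ge0.
    by apply: hl2; rewrite mem_cat; apply/orP; right; apply: map_f.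
  by rewrite -mulr_sumr ler_pM2l// sum_sqn_le.
have CB : C^-1 * B <= Q by rewrite mulrC ler_pdivrMr// mulrC.
have CA : C * A <= (C * K) ^+ 2 * N.
  rewrite exprMn [leRHS](_ : _ = C * (K ^+ 2 * (C * N))); last by ring.
  by rewrite ler_pM2l.
lra.
Qed.

End SchurBound.

(** * Duality between the von Neumann algebra and the Fourier algebra *)

Section Duality.
Context (R : realType) (G : groupType).
Implicit Types (F : {fset G}) (g h k : G) (xi eta : ell2 R G) (x : operator R G).
Local Open Scope fset_scope.
Local Open Scope ring_scope.

(** Weak amenability with constant one, in the form produced by the geometry. *)
Definition schur_approximable : Prop := forall (K : seq G) (eps : R), 0 < eps ->
  exists (phi : G -> R) F,
    [/\ forall g, g \notin F -> phi g = 0, schur_le phi (1 + eps) &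
        {in K, forall g, `|phi g - 1| < eps}].

Lemma Re_le_normc (z : R[i]) : complex.Re z <= normc z.
Proof.
apply: le_trans (ler_norm _) _.
rewrite -(@ler_sqr R) ?nnegrE ?normr_ge0 ?normc_ge0// normc_sqr real_normK ?num_real//.
by rewrite lerDl sqr_ge0.
Qed.

Lemma normc_sum_le (I : Type) (r : seq I) (f : I -> R[i]) :
  normc (\sum_(i <- r) f i) <= \sum_(i <- r) normc (f i).
Proof.
elim: r => [|i r IH]; first by rewrite !big_nil normc0.
by rewrite !big_cons (le_trans (le_normcD _ _))// lerD2l.
Qed.

Lemma sqn_tail xi (eps : R) : 0 < eps ->
  exists F, sqn (xi - fvec F (val xi)) < eps.
Proof.
move=> e0; have [F hF] := has_sum_sqn xi e0; exists F.
have h := has_sumD (has_sum_sqn xi) (has_sumZ (-1) (has_sum_sqn (fvec F (val xi)))).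
have -> : sqn (xi - fvec F (val xi)) = sqn xi + -1 * sqn (fvec F (val xi)).
  apply: has_sum_unique (has_sum_sqn _) _; apply: has_sum_ext h => g.
  have -> : norm2 (val (xi - fvec F (val xi))) g =
    norm2 (fun g => val xi g - val (fvec F (val xi)) g) g by [].
  rewrite /norm2 fvecE; case: ifP => _; first by rewrite subrr mulN1r subrr normc0 expr0n.
  by rewrite normc0 expr0n mulr0 addr0 subr0.
rewrite sqn_fvec mulN1r; apply: le_lt_trans (ler_norm _) _; exact: hF (fsubset_refl F).
Qed.

Lemma sqn_fvec_le xi F : sqn (fvec F (val xi)) <= sqn xi.
Proof. by rewrite sqn_fvec sum_sqn_le. Qed.

Lemma sqnB_le xi eta : sqn (xi - eta) <= 2 * sqn xi + 2 * sqn eta.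
Proof.
apply: le_trans (sqnD_le _ _) _; rewrite -scaleN1r sqnZ.
have -> : normc (-1 : R[i]) = 1 by rewrite normcN normc1.
by rewrite expr1n mul1r.
Qed.

Lemma schur_bound1 (phi : G -> R) C F x K :
  0 < C -> schur_le phi C -> (forall g, g \notin F -> phi g = 0) -> in_VN x ->
  (forall xi, sqn (x xi) <= K ^+ 2 * sqn xi) ->
  forall xi, sqn (multop phi F x xi) <= (C * K) ^+ 2 * sqn xi.
Proof.
move=> C0 sphi phi0 xVN xK xi.
have := @schur_bound R G phi C F 1 (fun _ _ => x) K C0 sphi phi0 (fun _ _ => xVN).
move=> /(_ _ (fun=> xi)); rewrite !big_ord1; apply => xi'.
by rewrite !big_ord1.
Qed.

Lemma dot_multop (phi : G -> R) F x xi eta :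
  l2dot (multop phi F x xi) eta =
  \sum_(g <- F) (phi g)%:C%C * (val (x (delta R 1%g)) g * coefficient xi eta g).
Proof.
rewrite /= /mul_op dot_suml; apply: eq_bigr => g _.
by rewrite dotZl mulrA.
Qed.

Lemma scale_small (a e : R) : 0 <= a -> 0 < e -> exists2 s : R, 0 < s & s^-1 * a <= e.
Proof.
move=> a0 e0; have a1 : 0 < a + 1 by lra.
exists ((a + 1) / e); first exact: divr_gt0.
by rewrite invf_div mulrAC ler_pdivrMr// ler_pM2l// lerDl.
Qed.

Lemma small_factor (w e : R) : 0 <= w -> 0 < e ->
  exists d : R, [/\ 0 < d, d <= 1 & d * w <= e].
Proof.
move=> w0 e0; have w1 : 0 < w + 1 by lra.
exists (Num.min 1 (e / (w + 1))); split.
- by rewrite lt_min ltr01 divr_gt0.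
- by rewrite ge_min lexx.
apply: (@le_trans _ _ (e / (w + 1) * w)).
  by apply: ler_wpM2r => //; rewrite ge_min lexx orbT.
by rewrite mulrAC ler_pdivrMr// ler_pM2l// lerDl.
Qed.

(** The operator [y] obtained from [x] by a multiplier close to [1] on the
    finitely many elements involved: it is bounded independently of the
    multiplier, its matrix entries are close to those of [x] on [B x A], and
    its pairing with a coefficient supported in [F] is close to the expected
    sum. *)
Lemma VN_approx (wa : schur_approximable) x K (d : R) (B A F : {fset G}) xi eta :
  in_VN x -> (forall xi, sqn (x xi) <= K ^+ 2 * sqn xi) -> 0 < d -> d <= 1 ->
  (forall g, g \notin F -> coefficient xi eta g = 0) ->
  exists y : operator R G,
  [/\ forall zeta, sqn (y zeta) <= (2 * K) ^+ 2 * sqn zeta,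
      {in A, forall h, {in B, forall k, exists2 c : R, `|c| <= d &
        val (x (delta R h)) k - val (y (delta R h)) k = c%:C%C * val (x (delta R h)) k}} &
      complex.Re (l2dot (y xi) eta) -
      complex.Re (\sum_(g <- F) val (x (delta R 1%g)) g * coefficient xi eta g) <=
      d * \sum_(g <- F) normc (val (x (delta R 1%g)) g * coefficient xi eta g)].
Proof.
move=> xVN xK d0 d1 u0.
have [phi [S [phi0 sphi phi1]]] :=
  wa (enum_fset F ++ [seq (k * h^-1)%g | k <- enum_fset B, h <- enum_fset A]) d d0.
exists (multop phi S x); split.
- move=> zeta; have d2 : 0 < 1 + d by lra.
  apply: le_trans (schur_bound1 d2 sphi phi0 xVN xK zeta) _.
  apply: ler_wpM2r; first exact: sqn_ge0.
  rewrite !exprMn; apply: ler_wpM2r; first exact: sqr_ge0.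
  by apply: lerXn2r; rewrite ?nnegrE; lra.
- move=> h hA k kB; exists (1 - phi (k * h^-1)%g); last first.
    by rewrite multop_delta// rmorphB rmorph1; ring.
  rewrite distrC ltW// phi1//.
  by rewrite mem_cat; apply/orP; right; apply/allpairsP; exists (k, h).
have -> : l2dot (multop phi S x xi) eta =
    \sum_(g <- F) (phi g)%:C%C * (val (x (delta R 1%g)) g * coefficient xi eta g).
  rewrite dot_multop; apply: (@has_csum_unique _ _
     (fun g => (phi g)%:C%C * (val (x (delta R 1%g)) g * coefficient xi eta g))).
    by apply: has_csum_fset => g /phi0 ->; rewrite mul0r.
  by apply: has_csum_fset => g /u0 ->; rewrite !mulr0.
rewrite !Re_sum -sumrB mulr_sumr big_seq [leRHS]big_seq; apply: ler_sum => g gF.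
set c := _ * coefficient _ _ _.
have -> : complex.Re ((phi g)%:C%C * c) - complex.Re c =
    complex.Re ((phi g - 1)%:C%C * c).
  by case: (c) => c1 c2 /=; ring.
apply: le_trans (Re_le_normc _) _; rewrite normcM.
apply: ler_wpM2r; first exact: normc_ge0.
rewrite /= expr0n addr0 sqrtr_sqr ltW// phi1//.
by rewrite mem_cat; apply/orP; left.
Qed.

Lemma half_le (a b c e : R) : 2 * a <= b + c -> b <= e / 2 -> c <= e ->
  a <= 3 / 4 * e.
Proof. by move=> *; lra. Qed.

(** Truncating both vectors reduces the difference [x - y] to finitely many
    matrix entries; the truncation errors are controlled by the uniform bound
    on [y]. The truncations are chosen first, and only then the multiplier. *)
Lemma VN_duality_Re (wa : schur_approximable) x xi eta F : in_VN x ->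
  (forall g, g \notin F -> coefficient xi eta g = 0) ->
  complex.Re (l2dot (x xi) eta) <=
  complex.Re (\sum_(g <- F) val (x (delta R 1%g)) g * coefficient xi eta g).
Proof.
move=> xVN u0; apply/ler_addgt0Pr => e' e0'.
have [e e0 ->] : exists2 e, 0 < e & e' = 2 * e.
  by exists (e' / 2); [exact: divr_gt0|field].
have [/bounded_operatorP[K xK] _] := xVN.
(* [10 = 2 * 1 ^ 2 + 2 * 2 ^ 2] accounts for [x], bounded by [K], and for [y],
   bounded by [2 * K]; the summand [1] makes [M] positive. *)
have [M M0 MK] : exists2 M, 0 < M & M = 10 * K ^+ 2 + 1.
  by exists (10 * K ^+ 2 + 1) => //; have := sqr_ge0 K; lra.
have [s sp hs] := scale_small (sqn_ge0 eta) e0.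
have [s' sp' hs'] := scale_small (mulr_ge0 (ltW M0) (sqn_ge0 xi)) e0.
have eA : 0 < e / 2 / (s * M).
  by apply: divr_gt0; [exact: divr_gt0|exact: mulr_gt0].
have eB : 0 < e / 2 / s' by apply: divr_gt0 => //; exact: divr_gt0.
have [A hA] := @sqn_tail xi _ eA; have [B hB] := @sqn_tail eta _ eB.
have xf2 := sqn_fvec_le xi A.
have [xf xfE] : exists xf, xf = fvec A (val xi) by exists (fvec A (val xi)).
have [ef efE] : exists ef, ef = fvec B (val eta) by exists (fvec B (val eta)).
rewrite -xfE in xf2 hA; rewrite -efE in hB.
pose a h k := normc (val xi h * val (x (delta R h)) k * (val eta k)^* ).
have [W WE W0] : exists2 W, W = \sum_(k <- B) \sum_(h <- A) a h k & 0 <= W.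
  by eexists => //; apply: sumr_ge0 => k _; apply: sumr_ge0 => h _; exact: normc_ge0.
have [W' WE' W0'] : exists2 W', W' = \sum_(g <- F)
    normc (val (x (delta R 1%g)) g * coefficient xi eta g) & 0 <= W'.
  by eexists => //; apply: sumr_ge0 => k _; exact: normc_ge0.
have [d [d0 d1 dW]] : exists d, [/\ 0 < d, d <= 1 & d * (W + W') <= e / 4].
  by apply: small_factor; [exact: addr_ge0|exact: divr_gt0].
have [y [yK yAB]] := VN_approx wa B A xVN xK d0 d1 u0.
set b := complex.Re (\sum_(g <- F) _); rewrite -WE' => B4.
pose z zeta := x zeta - y zeta.
have zK zeta : sqn (z zeta) <= M * sqn zeta.
  apply: le_trans (sqnB_le _ _) _; move: (xK zeta) (yK zeta) (sqn_ge0 zeta).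
  have -> : (2 * K) ^+ 2 * sqn zeta = 4 * (K ^+ 2 * sqn zeta) by ring.
  have -> : M * sqn zeta = 10 * (K ^+ 2 * sqn zeta) + sqn zeta by rewrite MK; ring.
  move: (sqn (x zeta)) (sqn (y zeta)) (K ^+ 2 * sqn zeta) (sqn zeta).
  by clear; move=> *; lra.
have zB u v : z (u - v) = z u - z v.
  by rewrite /z (linearB x) (linearB y) !opprD addrACA.
have E1 : l2dot (x xi) eta = l2dot (y xi) eta + l2dot (z (xi - xf)) eta +
    l2dot (z xf) (eta - ef) + l2dot (z xf) ef.
  have h1 : l2dot (z xf) eta = l2dot (z xf) (eta - ef) + l2dot (z xf) ef.
    by rewrite -dotDr subrK.
  have h2 : l2dot (z xi) eta = l2dot (z (xi - xf)) eta + l2dot (z xf) eta.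
    by rewrite zB (dotDl (z xi)) (dotNl (z xf)) subrK.
  have h3 : l2dot (x xi) eta = l2dot (y xi) eta + l2dot (z xi) eta.
    by rewrite /z (dotDl (x xi)) dotNl addrC subrK.
  by rewrite h3 h2 h1 !addrA.
have E3 : l2dot (z xf) ef = \sum_(k <- B) \sum_(h <- A)
    (val xi h * (val (x (delta R h)) k - val (y (delta R h)) k) * (val eta k)^* ).
  rewrite efE (@dot_fset _ _ _ _ B); last first.
    by move=> g /negPf gB; rewrite fvecE gB conjC0 mulr0.
  apply: eq_big_seq => k kB.
  have -> : val (z xf) k = val (x xf) k - val (y xf) k by [].
  rewrite fvecE kB xfE !op_fvec -sumrB mulr_suml; apply: eq_bigr => h _.
  by rewrite mulrBr.
have B1 : complex.Re (l2dot (z (xi - xf)) eta) <= 3 / 4 * e.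
  have h2 : s * (M * sqn (xi - xf)) <= e / 2.
    by move: hA; rewrite ltr_pdivlMr ?mulr_gt0// => /ltW; rewrite mulrC -mulrA.
  apply: half_le (Re_dot_le _ eta sp) (le_trans _ h2) hs.
  by rewrite ler_pM2l.
have B2 : complex.Re (l2dot (z xf) (eta - ef)) <= 3 / 4 * e.
  have si : 0 < s'^-1 by rewrite invr_gt0.
  have := Re_dot_le (z xf) (eta - ef) si; rewrite invrK [X in _ <= X]addrC => h0.
  apply: half_le h0 _ _; first by rewrite mulrC -ler_pdivlMr// ltW.
  apply: le_trans hs'; rewrite ler_pM2l//; apply: le_trans (zK xf) _.
  by rewrite ler_pM2l.
have B3 : complex.Re (l2dot (z xf) ef) <= d * W.
  apply: le_trans (Re_le_normc _) _; rewrite E3 WE mulr_sumr.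
  apply: le_trans (normc_sum_le _ _) _; rewrite big_seq [leRHS]big_seq.
  apply: ler_sum => k kB; rewrite mulr_sumr.
  apply: le_trans (normc_sum_le _ _) _; rewrite big_seq [leRHS]big_seq.
  apply: ler_sum => h hA'; have [c cd ->] := yAB h hA' k kB.
  rewrite mulrCA -mulrA normcM; apply: ler_wpM2r; first exact: normc_ge0.
  by rewrite /= expr0n addr0 sqrtr_sqr.
rewrite E1 !ReD; move: B1 B2 B3 B4 dW e0; rewrite mulrDr.
move: (complex.Re _) (complex.Re _) (complex.Re _) (complex.Re _) (d * W) (d * W').
by clear; move=> *; lra.
Qed.

(** Scaling the first vector by [1], [-1], [i] and [-i] turns the one-sided
    inequality between real parts into an equality. *)
Lemma VN_duality (wa : schur_approximable) x xi eta F : in_VN x ->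
  (forall g, g \notin F -> coefficient xi eta g = 0) ->
  l2dot (x xi) eta =
  \sum_(g <- F) val (x (delta R 1%g)) g * coefficient xi eta g.
Proof.
move=> xVN u0; set a := LHS; set b := RHS.
(* Multiplying [xi] by [c] multiplies both sides by [c]. *)
have key c : complex.Re (c * a) <= complex.Re (c * b).
  have cE g : coefficient (c *: xi) eta g = c * coefficient xi eta g.
    by rewrite -dotZl; congr l2dot; exact: ell2P.
  have := @VN_duality_Re wa x (c *: xi) eta F xVN.
  rewrite (linearZZ x) dotZl /b mulr_sumr => h.
  apply: le_trans (h _) _ => [g /u0 uz|]; first by rewrite cE uz mulr0.
  by rewrite le_eqVlt; apply/orP; left; apply/eqP; congr complex.Re;
     apply: eq_bigr => g _; rewrite cE mulrCA.
have := key 1; have := key (-1); have := key 'i%C; have := key (- 'i%C).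
case: (a) => a1 a2; case: (b) => b1 b2 /=; rewrite !oppr0 !mul0r !mulN1r !mul1r.
by move=> ? ? ? ?; congr Complex; lra.
Qed.
End Duality.

(** * Cowling-Haagerup constant one from Schur approximation *)

Section CowlingHaagerup.
Context (R : realType) (G : groupType).
Implicit Types (F : {fset G}) (g h k : G) (xi eta : ell2 R G) (x : operator R G).
Local Open Scope fset_scope.
Local Open Scope ring_scope.

Lemma coefficient_delta1 xi g : coefficient xi (delta R 1%g) g = val xi g^-1%g.
Proof.
rewrite /coefficient (@dot_fset _ _ _ _ [fset 1%g]); last first.
  by move=> h; rewrite inE deltaE => /negPf ->; rewrite conjC0 mulr0.
by rewrite big_seq_fset1 deltaE eqxx conjC1 mulr1 /= mulg1.
Qed.

(** A finitely supported function is the coefficient of its own reflection,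
    which lies in [ell2], and of the base vector. *)
Lemma fourier_multiplier_fset (phi : G -> R[i]) F :
  (forall g, g \notin F -> phi g = 0) -> fourier_multiplier phi.
Proof.
move=> phi0 f _.
exists (fvec [fset g^-1%g | g in F] (fun g => phi g^-1%g * f g^-1%g)), (delta R 1%g).
apply/funext => g; rewrite coefficient_delta1 fvecE invgK.
case: ifPn => // /imfsetP gF; rewrite phi0 ?mul0r//; apply/negP => gF'.
by apply: gF; exists g.
Qed.

Lemma mx_opnormP m (x : 'I_m -> 'I_m -> operator R G) (K : R) :
  (forall xi : 'I_m -> ell2 R G,
    (\sum_(i < m) l2sq (val (\sum_(j < m) x i j (xi j))%R)
        <= (K ^+ 2)%:E * \sum_(j < m) l2sq (val (xi j)))%E) <->
  (forall xi : 'I_m -> ell2 R G,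
    \sum_(i < m) sqn (\sum_(j < m) x i j (xi j)) <= K ^+ 2 * \sum_(j < m) sqn (xi j)).
Proof.
have E (xi : 'I_m -> ell2 R G) :
    (\sum_(j < m) l2sq (val (xi j)))%E = (\sum_(j < m) sqn (xi j))%:E.
  by rewrite -sumEFin; apply: eq_bigr => j _; rewrite l2sqE.
split=> h xi; have := h xi; rewrite (E xi) (E (fun i => \sum_(j < m) x i j (xi j))).
  by rewrite -EFinM lee_fin.
by rewrite -EFinM lee_fin.
Qed.

Lemma cb_norm_schur (wa : schur_approximable R G) (phi : G -> R) F C :
  0 < C -> (forall g, g \notin F -> phi g = 0) -> schur_le phi C ->
  (cb_norm (fun g => (phi g)%:C%C) <= C%:E)%E.
Proof.
move=> C0 phi0 sphi; apply: ereal_inf_lbound; exists C => //; split.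
- exact: ltW.
- by apply: (@fourier_multiplier_fset _ F) => g /phi0 ->.
move=> m x xVN; exists (fun i j => multop phi F (x i j)); split.
  move=> i j; split; first exact: multop_VN.
  move=> xi eta xi' eta' coefE.
  have u0 g : g \notin F -> coefficient xi' eta' g = 0.
    by move=> /phi0 phig; rewrite coefE phig mul0r.
  rewrite (VN_duality wa (xVN i j) u0) dot_multop; apply: eq_bigr => g _.
  by rewrite coefE mulrCA.
rewrite muleC -lee_pdivrMr//; apply: le_ereal_inf_tmp => _ [K [K0 /mx_opnormP xK] <-].
rewrite lee_pdivrMr// -EFinM; apply: ereal_inf_lbound; exists (K * C) => //; split.
  by rewrite mulr_ge0// ltW.
by apply/mx_opnormP; rewrite mulrC; apply: schur_bound.
Qed.

Lemma lregular1 xi : lregular 1%g xi = xi.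
Proof. by apply: ell2P => g; rewrite /= invg1 mul1g. Qed.

(** The adjoint multiplier sends the identity to an operator whose diagonal
    entry at the base vector is [phi 1]; its norm is thus at least that. *)
Lemma cb_norm_ge1 (phi : G -> R[i]) (L : R) : (cb_norm phi <= L%:E)%E ->
  normc (phi 1%g) <= L.
Proof.
move=> phiL; apply/ler_addgt0Pr => e e0.
have e2 : 0 < e / 2 by exact: divr_gt0.
have : (cb_norm phi < (L + e / 2)%:E)%E.
  by apply: le_lt_trans phiL _; rewrite lte_fin ltrDl.
move=> /ereal_inf_lt[_ [C [C0 _ cb] <-]]; rewrite lte_fin => CL.
pose x : 'I_1 -> 'I_1 -> operator R G := fun _ _ => idfun.
have xVN i j : in_VN (x i j).
  by split => //; apply/bounded_operatorP; exists 1 => xi; rewrite expr1n mul1r.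
have [y [yP yC]] := cb 1%N x xVN.
have x1 : (mx_opnorm x <= 1%:E)%E.
  apply: ereal_inf_lbound; exists 1 => //; split=> //; apply/mx_opnormP => xi.
  by rewrite !big_ord1 expr1n mul1r.
have : (mx_opnorm y < (L + e)%:E)%E.
  apply: le_lt_trans yC _; apply: (@le_lt_trans _ _ (C%:E * 1%:E)%E).
    by apply: lee_wpmul2l => //; rewrite lee_fin.
  by rewrite mule1 lte_fin; lra.
move=> /ereal_inf_lt[_ [K [K0 /mx_opnormP yK] <-]]; rewrite lte_fin => /ltW; apply: le_trans.
have := yK (fun=> delta R 1%g); rewrite !big_ord1 [sqn (delta _ _)]sqn_fvec.
rewrite big_seq_fset1 /norm2 normc1 expr1n mulr1 => yK1.
have [_ yt] := yP ord0 ord0.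
have /yt E : forall g, coefficient (phi 1%g *: delta R 1%g) (delta R 1%g) g =
    phi g * coefficient (delta R 1%g) (delta R 1%g) g.
  move=> g; rewrite !coefficient_delta1.
  have -> : val (phi 1%g *: delta R 1%g) g^-1%g = phi 1%g * val (delta R 1%g) g^-1%g by [].
  rewrite deltaE; have [/eqP|_] := eqVneq g^-1%g 1%g; last by rewrite !mulr0.
  by rewrite invg_eq1 => /eqP ->.
have dotd (xi : ell2 R G) : l2dot xi (delta R 1%g) = val xi 1%g.
  by have := coefficient_delta1 xi 1%g; rewrite /coefficient lregular1 invg1.
have phiE : val (y ord0 ord0 (delta R 1%g)) 1%g = phi 1%g.
  rewrite -dotd E; have -> : x ord0 ord0 (phi 1%g *: delta R 1%g) = phi 1%g *: delta R 1%g.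
    by [].
  by rewrite dotZl dotd deltaE eqxx mulr1.
rewrite -ler_sqr ?nnegrE ?normc_ge0// -phiE; apply: le_trans yK1.
have := sum_sqn_le (y ord0 ord0 (delta R 1%g)) [fset 1%g].
by rewrite big_seq_fset1.
Qed.

Lemma dir_refl (i : {fset G} * nat) : i.1 `<=` i.1 /\ (i.2 <= i.2)%N.
Proof. by []. Qed.

Lemma dir_trans (j i k : {fset G} * nat) : i.1 `<=` j.1 /\ (i.2 <= j.2)%N ->
  j.1 `<=` k.1 /\ (j.2 <= k.2)%N -> i.1 `<=` k.1 /\ (i.2 <= k.2)%N.
Proof.
by move=> [a b] [c d]; split; [exact: fsubset_trans c|exact: leq_trans d].
Qed.

Lemma dir_directed (i j : {fset G} * nat) : exists k : {fset G} * nat,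
  (i.1 `<=` k.1 /\ (i.2 <= k.2)%N) /\ (j.1 `<=` k.1 /\ (j.2 <= k.2)%N).
Proof.
exists (i.1 `|` j.1, maxn i.2 j.2) => /=.
by rewrite fsubsetUl fsubsetUr leq_maxl leq_maxr.
Qed.

Definition fset_nat_directed : directed_set :=
  DirectedSet dir_refl dir_trans (inhabits (fset0, 0%N)) dir_directed.

Lemma cvg1_fset_nat (phi : fset_nat_directed -> G -> R) :
  (forall i, {in i.1, forall g, `|phi i g - 1| < i.2.+1%:R^-1}) ->
  cvg1_on_compacts (fun i g => (phi i g)%:C%C).
Proof.
move=> h K finK e e0.
exists (fset_set K, (Num.truncn e^-1)) => -[F n] /= [KF en] g Kg.
have gF : g \in F by apply: (fsubsetP KF); rewrite in_fset_set// inE.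
rewrite subrr expr0n addr0 sqrtr_sqr.
apply: lt_trans (h (F, n) g gF) _ => /=.
rewrite -[ltRHS]invrK ltf_pV2 ?posrE ?invr_gt0//.
apply: (@lt_le_trans _ _ ((Num.truncn e^-1).+1%:R)); last by rewrite ler_nat.
exact: truncnS_gt.
Qed.

Theorem cowling_haagerup_eq1 : schur_approximable R G -> cowling_haagerup R G = 1%E.
Proof.
move=> wa; apply/le_anti/andP; split; last first.
  apply: le_ereal_inf_tmp => _ [L [D [phi [_ phi1 phiL]]] <-].
  rewrite lee_fin; apply/ler_addgt0Pr => e e0.
  have [i0 hi] := phi1 [set 1%g] (finite_set1 _) e e0.
  have := hi i0 (dle_refl i0) 1%g erefl.
  have : normc (phi i0 1%g) <= L.
    apply: cb_norm_ge1; apply: le_trans phiL; apply: ereal_sup_ubound.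
    by exists i0.
  have := le_normcD (phi i0 1%g) (1 - phi i0 1%g); rewrite addrC subrK normc1.
  by rewrite -[normc (1 - _)]normcN opprB; lra.
apply/lee_addgt0Pr => e e0; rewrite -EFinD.
apply: ereal_inf_lbound; exists (1 + e) => //.
have H (i : {fset G} * nat) : exists phi : G -> R, exists F : {fset G},
    [/\ forall g, g \notin F -> phi g = 0, schur_le phi (1 + e) &
        {in i.1, forall g, `|phi g - 1| < i.2.+1%:R^-1}].
  have d0 : 0 < Num.min e i.2.+1%:R^-1 by rewrite lt_min e0 invr_gt0 ltr0n.
  have [phi [F [h1 h2 h3]]] := wa (enum_fset i.1) _ d0.
  exists phi, F; split=> //.
    move=> E; have [l [l1 l2 l3]] := h2 E; exists l; split=> // g gE.
      by apply: le_trans (l2 g gE) _; rewrite lerD2l ge_min lexx.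
    by apply: le_trans (l3 g gE) _; rewrite lerD2l ge_min lexx.
  by move=> g /h3; rewrite lt_min => /andP[].
have [phi phiP] := choice H.
exists fset_nat_directed, (fun i g => (phi i g)%:C%C); split.
- move=> i; have [F [h1 _ _]] := phiP i.
  apply: (@sub_finite_set _ _ [set` F]); last exact: finite_fset.
  move=> g /=; case: (boolP (g \in F)) => // /h1 ->; by rewrite eqxx.
- by apply: cvg1_fset_nat => i; have [F []] := phiP i.
apply: ge_ereal_sup => _ [i _ <-]; have [F [h1 h2 _]] := phiP i.
by apply: (cb_norm_schur wa) h1 h2; lra.
Qed.

End CowlingHaagerup.

(** * Calculus of Schur and Gram kernels, and the Haagerup property *)

Section Gram.
Context (R : realType).

(** Positive semidefinite kernels, through an explicit Gram factorization of
    their finite restrictions. *)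
Definition gram_kernel (T : eqType) (kappa : T -> T -> R) : Prop :=
  forall E : seq T, exists l : seq (T -> R),
    {in E &, forall s t, kappa s t = \sum_(p <- l) p s * p t}.

Definition gram (G : groupType) (phi : G -> R) : Prop :=
  gram_kernel (fun g h => phi (g^-1 * h)%g).

Section Kernels.
Context (T : eqType).
Implicit Types (kappa : T -> T -> R).

(** The Gram vectors serve on both sides, and their square norms are the
    diagonal values. *)
Lemma gram_schur kappa C : gram_kernel kappa -> (forall t, kappa t t <= C) ->
  schur_kernel kappa C.
Proof.
move=> hk hC E; have [l hl] := hk E; exists [seq (p, p) | p <- l]; split.
- by move=> s t sE tE; rewrite big_map /= hl.
- move=> s sE; rewrite big_map /=; apply: le_trans (hC s); rewrite hl//.
- move=> s sE; rewrite big_map /=; apply: le_trans (hC s); rewrite hl//.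
Qed.

Lemma gram_kernelM kappa kappa' : gram_kernel kappa -> gram_kernel kappa' ->
  gram_kernel (fun s t => kappa s t * kappa' s t).
Proof.
move=> hk hk' E; have [l hl] := hk E; have [l' hl'] := hk' E.
exists [seq (fun t => p t * q t) | p <- l, q <- l'] => s t sE tE.
rewrite hl// hl'// mulr_suml big_allpairs_dep; apply: eq_bigr => p _.
by rewrite mulr_sumr; apply: eq_bigr => q _; rewrite mulrACA.
Qed.

Lemma schur_kernelM kappa kappa' C C' : 0 <= C -> 0 <= C' ->
  schur_kernel kappa C -> schur_kernel kappa' C' ->
  schur_kernel (fun s t => kappa s t * kappa' s t) (C * C').
Proof.
move=> C0 C0' hk hk' E; have [l [hl l1 l2]] := hk E; have [l' [hl' l1' l2']] := hk' E.
exists [seq ((fun t => p.1 t * q.1 t), (fun t => p.2 t * q.2 t)) | p <- l, q <- l']; split.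
- move=> s t sE tE; rewrite hl// hl'// mulr_suml big_allpairs_dep; apply: eq_bigr => p _.
  by rewrite mulr_sumr; apply: eq_bigr => q _; rewrite mulrACA.
- move=> s sE; rewrite big_allpairs_dep /=.
  have -> : \sum_(i <- l) \sum_(j <- l') (i.1 s * j.1 s) ^+ 2 =
    (\sum_(i <- l) i.1 s ^+ 2) * (\sum_(j <- l') j.1 s ^+ 2).
    rewrite mulr_suml; apply: eq_bigr => p _; rewrite mulr_sumr.
    by apply: eq_bigr => q _; rewrite exprMn.
  by apply: ler_pM; rewrite ?l1 ?l1'//; apply: sumr_ge0 => p _; exact: sqr_ge0.
- move=> s sE; rewrite big_allpairs_dep /=.
  have -> : \sum_(i <- l) \sum_(j <- l') (i.2 s * j.2 s) ^+ 2 =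
    (\sum_(i <- l) i.2 s ^+ 2) * (\sum_(j <- l') j.2 s ^+ 2).
    rewrite mulr_suml; apply: eq_bigr => p _; rewrite mulr_sumr.
    by apply: eq_bigr => q _; rewrite exprMn.
  by apply: ler_pM; rewrite ?l2 ?l2'//; apply: sumr_ge0 => p _; exact: sqr_ge0.
Qed.

Lemma schur_kernelD kappa kappa' C C' :
  schur_kernel kappa C -> schur_kernel kappa' C' ->
  schur_kernel (fun s t => kappa s t + kappa' s t) (C + C').
Proof.
move=> hk hk' E; have [l [hl l1 l2]] := hk E; have [l' [hl' l1' l2']] := hk' E.
exists (l ++ l'); split.
- by move=> s t sE tE; rewrite big_cat /= hl// hl'.
- by move=> s sE; rewrite big_cat /= lerD ?l1 ?l1'.
- by move=> s sE; rewrite big_cat /= lerD ?l2 ?l2'.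
Qed.

(** The scalar is shared evenly between the two sides; its sign goes to one. *)
Lemma schur_kernelZ (c : R) kappa C : schur_kernel kappa C ->
  schur_kernel (fun s t => c * kappa s t) (`|c| * C).
Proof.
move=> hk E; have [l [hl l1 l2]] := hk E.
pose a := Num.sqrt `|c|.
exists [seq ((fun t => Num.sg c * a * p.1 t), (fun t => a * p.2 t)) | p <- l].
have aa : a ^+ 2 = `|c| by rewrite /a sqr_sqrtr.
split.
- move=> s t sE tE; rewrite big_map hl// mulr_sumr; apply: eq_bigr => p _ /=.
  by rewrite [RHS]mulrACA -[Num.sg c * a * a]mulrA -expr2 aa mulr_sg_norm.
- move=> s sE; rewrite big_map /=.
  apply: (@le_trans _ _ (\sum_(p <- l) `|c| * p.1 s ^+ 2)).
    apply: ler_sum => p _; rewrite !exprMn aa -mulrA.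
    apply: ler_piMl; first by rewrite mulr_ge0 ?sqr_ge0.
    by case: sgrP; rewrite ?expr0n ?sqrrN ?expr1n ?ler01.
  by rewrite -mulr_sumr ler_wpM2l ?l1.
- move=> s sE; rewrite big_map /=; under eq_bigr do rewrite exprMn aa.
  by rewrite -mulr_sumr ler_wpM2l ?l2.
Qed.

Lemma schur_kernel0 : schur_kernel (fun _ _ : T => 0 : R) 0.
Proof. by move=> E; exists [::]; split=> [s t _ _|s _|t _]; rewrite big_nil. Qed.

Lemma schur_kernel_sum (I : Type) (r : seq I) (kappa : I -> T -> T -> R) (C : I -> R) :
  (forall i, schur_kernel (kappa i) (C i)) ->
  schur_kernel (fun s t => \sum_(i <- r) kappa i s t) (\sum_(i <- r) C i).
Proof.
move=> h; elim: r => [|i r IH].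
  rewrite big_nil (_ : (fun _ _ => _) = fun _ _ => 0); first exact: schur_kernel0.
  by apply/funext => s; apply/funext => t; rewrite big_nil.
rewrite big_cons (_ : (fun _ _ => _) =
  fun s t => kappa i s t + \sum_(j <- r) kappa j s t); first exact: schur_kernelD.
by apply/funext => s; apply/funext => t; rewrite big_cons.
Qed.

Lemma schur_kernel_local kappa C : (forall E : seq T, exists2 kappa',
    schur_kernel kappa' C & {in E &, forall s t, kappa s t = kappa' s t}) ->
  schur_kernel kappa C.
Proof.
move=> h E; have [k' hk' kk'] := h E; have [l [hl l1 l2]] := hk' E.
by exists l; split=> // s t sE tE; rewrite kk'// hl.
Qed.

Lemma schur_kernel_le kappa C C' : C <= C' -> schur_kernel kappa C ->
  schur_kernel kappa C'.
Proof.
move=> CC hk E; have [l [hl l1 l2]] := hk E; exists l; split=> // s sE.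
  exact: le_trans (l1 s sE) CC.
exact: le_trans (l2 s sE) CC.
Qed.

Lemma sum_eq_nat (U : eqType) (r : seq U) (x y : U) : uniq r -> x \in r ->
  \sum_(u <- r) (x == u)%:R * (y == u)%:R = (x == y)%:R :> R.
Proof.
move=> ur xr; rewrite (bigD1_seq x)//= eqxx mul1r big1 ?addr0 1?eq_sym//.
by move=> u /negPf; rewrite eq_sym => ->; rewrite mul0r.
Qed.

(** Both families consist of basis vectors, indexed by the values of [f]. *)
Lemma schur_kernel_eq (U : eqType) (f f' : T -> U) :
  schur_kernel (fun s t => (f s == f' t)%:R : R) 1.
Proof.
move=> E; exists [seq ((fun s => (f s == u)%:R), (fun t => (f' t == u)%:R)) |
  u <- undup [seq f s | s <- E]].
split.
- move=> s t sE tE; rewrite big_map sum_eq_nat ?undup_uniq// mem_undup.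
  exact: map_f.
- move=> s sE; rewrite big_map /=; under eq_bigr do rewrite expr2.
  rewrite sum_eq_nat ?undup_uniq ?eqxx// mem_undup; exact: map_f.
move=> t tE; rewrite big_map /=; under eq_bigr do rewrite expr2.
have [ft|ft] := boolP (f' t \in undup [seq f s | s <- E]).
  by rewrite sum_eq_nat ?undup_uniq ?eqxx.
rewrite big1_seq ?ler01// => u /andP[_ uE]; case: eqP => [fu|]; last by rewrite mul0r.
by rewrite fu uE in ft.
Qed.

End Kernels.
End Gram.

Section PositiveDefinite.
Context (R : realType) (G : groupType).

Definition gram_approximable : Prop := forall (K : seq G) (eps : R), 0 < eps ->
  exists phi : G -> R, [/\ gram phi,
    forall e : R, 0 < e -> finite_set [set g | e <= `|phi g|] &
    {in K, forall g, `|phi g - 1| < eps}].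

Lemma conj_mul_realc (z : R[i]) (a : R) : (z * a%:C%C)^* = z^* * a%:C%C.
Proof. by rewrite rmorphM; congr (_ * _); exact: conj_realc. Qed.

Lemma gram_positive_definite (phi : G -> R) : gram phi ->
  positive_definite (fun g => (phi g)%:C%C).
Proof.
move=> hphi m g c; have [l hl] := hphi [seq g i | i <- enum 'I_m].
have -> : \sum_(i < m) \sum_(j < m) (c i)^* * c j * (phi ((g i)^-1 * g j)%g)%:C%C =
    \sum_(p <- l) (\sum_(j < m) c j * (p (g j))%:C%C) *
                  (\sum_(j < m) c j * (p (g j))%:C%C)^*.
  transitivity (\sum_(i < m) \sum_(j < m) \sum_(p <- l)
      (c j * (p (g j))%:C%C) * (c i * (p (g i))%:C%C)^*).
    apply: eq_bigr => i _; apply: eq_bigr => j _; rewrite hl ?map_f ?mem_enum//.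
    rewrite rmorph_sum mulr_sumr; apply: eq_bigr => p _.
    by rewrite rmorphM conj_mul_realc; ring.
  under eq_bigr do rewrite exchange_big /=.
  rewrite exchange_big /=; apply: eq_bigr => p _.
  rewrite rmorph_sum mulr_sumr; apply: eq_bigr => i _.
  by rewrite mulr_suml.
by apply: sumr_ge0 => p _; exact: mul_conjC_ge0.
Qed.

Lemma haagerup_of_gram : gram_approximable -> haagerup_property R G.
Proof.
move=> hG.
have H (i : {fset G} * nat) : exists phi : G -> R, [/\ gram phi,
    forall e : R, 0 < e -> finite_set [set g | e <= `|phi g|] &
    {in i.1, forall g, `|phi g - 1| < i.2.+1%:R^-1}].
  by apply: (hG (enum_fset i.1)); rewrite invr_gt0.
have [phi phiP] := choice H.
exists (fset_nat_directed G), (fun i g => (phi i g)%:C%C); split.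
- move=> i; have [h1 h2 _] := phiP i; split; last exact: gram_positive_definite.
  move=> e /h2; congr finite_set; apply/funext => g /=.
  by rewrite expr0n addr0 sqrtr_sqr.
- by apply: cvg1_fset_nat => i; have [] := phiP i.
Qed.

End PositiveDefinite.

(** * Kernels on a rooted tree *)

Section TreeCombinatorics.
Context (D : eqType).
Implicit Types (u v : seq D).
Local Open Scope nat_scope.

(** The depth of the last common ancestor of two vertices of a tree, a vertex
    being the list of the steps that lead to it from the root. *)
Fixpoint meet_size u v : nat :=
  if u is a :: u' then
    if v is b :: v' then if a == b then (meet_size u' v').+1 else 0 else 0
  else 0.

Definition tdist u v : nat := size u + size v - (meet_size u v).*2.

Lemma leq_meet_size k u v : (k <= meet_size u v) =
  [&& k <= size u, k <= size v & take k u == take k v].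
Proof.
elim: u v k => [|a u IH] [|b v] [|k] //=; rewrite ?andbF //.
by rewrite eqseq_cons; case: eqP => _ //=; rewrite ?andbF// !ltnS IH.
Qed.

Lemma meet_size_l u v : meet_size u v <= size u.
Proof. by have := leqnn (meet_size u v); rewrite leq_meet_size => /and3P[]. Qed.

Lemma meet_size_r u v : meet_size u v <= size v.
Proof. by have := leqnn (meet_size u v); rewrite leq_meet_size => /and3P[]. Qed.

Lemma meet_size_take u v : take (meet_size u v) u = take (meet_size u v) v.
Proof. by have := leqnn (meet_size u v); rewrite leq_meet_size => /and3P[_ _ /eqP]. Qed.

Lemma meet_size_rcons u v c : meet_size u v <= meet_size u (rcons v c) <= (meet_size u v).+1.
Proof.
elim: u v => [|a u IH] [|b v] //=; first by case: ifP => //; case: (u).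
by case: ifP => // _; rewrite !ltnS.
Qed.

Lemma tdist_rcons u v c :
  (tdist u (rcons v c) <= (tdist u v).+1) && (tdist u v <= (tdist u (rcons v c)).+1).
Proof.
rewrite /tdist size_rcons.
have := meet_size_rcons u v c; have := meet_size_l u v; have := meet_size_r u v.
have := meet_size_l u (rcons v c); have := meet_size_r u (rcons v c).
rewrite size_rcons; lia.
Qed.

Lemma tdist_nil v : tdist [::] v = size v.
Proof. by rewrite /tdist /= subn0. Qed.

Lemma tdist_self u : tdist u u = 0.
Proof.
have : size u <= meet_size u u by rewrite leq_meet_size leqnn eqxx.
by rewrite /tdist; lia.
Qed.

(** Going up [i] steps from [u] and [n - i] steps from [v], where a path that
    has reached the root continues along an imaginary ray; the second
    coordinate keeps track of the level, shifted by [n], so that it makes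
    sense beyond the root. The two ancestors agree exactly when their levels
    agree and are not below the meeting point. *)
Lemma ancestor_eq n i u v : i <= n ->
  ((take (size u - i) u, size u + (n - i)) == (take (size v - (n - i)) v, size v + i))
  = (size u + n == size v + i.*2) && (size u <= meet_size u v + i).
Proof.
move=> leni; rewrite xpair_eqE andbC.
have -> : (size u + (n - i) == size v + i) = (size u + n == size v + i.*2) by lia.
case: eqP => //= e.
have -> : size v - (n - i) = size u - i by lia.
have -> : (size u <= meet_size u v + i) = (size u - i <= meet_size u v) by lia.
have -> : (size u - i <= meet_size u v) = [&& size u - i <= size u, size u - i <= size v &
   take (size u - i) u == take (size u - i) v] by exact: leq_meet_size.
by rewrite leq_subr /=; have -> : size u - i <= size v by lia.
Qed.

End TreeCombinatorics.

Section TreeKernels.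
Context (R : realType) (D : eqType).
Implicit Types (u v : seq D) (r : R).

Lemma schur_kernel_comp (T U : eqType) (s : T -> U) (kappa : U -> U -> R) C :
  schur_kernel kappa C -> schur_kernel (fun g h => kappa (s g) (s h)) C.
Proof.
move=> hk E; have [l [h0 h1 h2]] := hk [seq s g | g <- E].
exists [seq (p.1 \o s, p.2 \o s) | p <- l]; split.
- by move=> g h gE hE; rewrite big_map h0 ?map_f.
- by move=> g gE; rewrite big_map h1 ?map_f.
- by move=> g gE; rewrite big_map h2 ?map_f.
Qed.

Lemma gram_kernel_comp (T U : eqType) (s : T -> U) (kappa : U -> U -> R) :
  gram_kernel kappa -> gram_kernel (fun g h => kappa (s g) (s h)).
Proof.
move=> hk E; have [l h0] := hk [seq s g | g <- E].
by exists [seq p \o s | p <- l] => g h gE hE; rewrite big_map h0 ?map_f.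
Qed.

(** Pairs joined by a path of length [n], possibly with backtracking (in a
    tree whose root carries an infinite ray). *)
Definition even_ball n u v : bool := (tdist u v <= n)%N && ~~ odd (n - tdist u v).

(** A path of length [n] climbs [i] steps and descends [n - i]; the levels of
    the two ends determine [i]. Hence at most one term is nonzero. *)
Lemma even_ball_sum n u v : (even_ball n u v)%:R =
  \sum_(i < n.+1) ((take (size u - i) u, (size u + (n - i))%N) ==
    (take (size v - (n - i)) v, (size v + i)%N))%:R :> R.
Proof.
have h1 := meet_size_l u v; have h2 := meet_size_r u v.
rewrite (eq_bigr (fun i : 'I_n.+1 => ((size u + n == size v + i.*2)%N &&
  (size u <= meet_size u v + i)%N)%:R)); last first.
  by move=> i _; rewrite ancestor_eq// -ltnS.
rewrite /even_ball /tdist; case: (boolP (_ && _)) => hd.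
  (* The number of steps climbed from [u], given the levels of both ends. *)
  have i0n : ((size u + n - size v)./2 < n.+1)%N by lia.
  rewrite (bigD1 (Ordinal i0n))//= big1 ?addr0.
    by have -> : ((size u + n == size v + ((size u + n - size v)./2).*2) &&
      (size u <= meet_size u v + (size u + n - size v)./2))%N by lia.
  move=> i; rewrite -val_eqE /= => ine.
  by have -> : ((size u + n == size v + i.*2) && (size u <= meet_size u v + i))%N
    = false by lia.
rewrite big1// => i _.
have ilt := ltn_ord i.
by have -> : ((size u + n == size v + i.*2) && (size u <= meet_size u v + i))%N
    = false by lia.
Qed.

Lemma schur_even_ball n :
  schur_kernel (fun u v => (even_ball n u v)%:R : R) n.+1%:R.
Proof.
have -> : (n.+1%:R : R) = \sum_(i < n.+1) 1 by rewrite sumr_const card_ord.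
rewrite (_ : (fun _ _ => _) = fun u v => \sum_(i < n.+1)
   ((take (size u - i) u, (size u + (n - i))%N) ==
    (take (size v - (n - i)) v, (size v + i)%N))%:R).
  apply: schur_kernel_sum => i.
  exact: (@schur_kernel_eq R _ _ (fun u => (take (size u - i) u, size u + (n - i)))%N
    (fun v => (take (size v - (n - i)) v, size v + i))%N).
by apply/funext => u; apply/funext => v; rewrite even_ball_sum.
Qed.

(** A sphere is the difference of two consecutive even balls, of Schur norms
    at most [n + 1] and [n - 1]. *)
Lemma schur_sphere n :
  schur_kernel (fun u v => (tdist u v == n)%:R : R) (2 * n.+1%:R).
Proof.
case: n => [|[|n]].
- apply: (@schur_kernel_le _ _ _ 1%:R); first by lra.
  rewrite (_ : (fun _ _ => _) = fun u v => (even_ball 0 u v)%:R); first exact: schur_even_ball.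
  by apply/funext => u; apply/funext => v; congr (_%:R); rewrite /even_ball; lia.
- apply: (@schur_kernel_le _ _ _ 2%:R); first by lra.
  rewrite (_ : (fun _ _ => _) = fun u v => (even_ball 1 u v)%:R); first exact: schur_even_ball.
  by apply/funext => u; apply/funext => v; congr (_%:R); rewrite /even_ball; lia.
have := schur_kernelD (schur_even_ball n.+2) (schur_kernelZ (-1) (schur_even_ball n)).
rewrite normrN normr1 mul1r => h.
apply: (@schur_kernel_le _ _ _ (n.+3%:R + n.+1%:R)).
  by rewrite -natrM -natrD ler_nat; lia.
rewrite (_ : (fun _ _ => _) =
  fun u v => (even_ball n.+2 u v)%:R + -1 * (even_ball n u v)%:R); first exact: h.
apply/funext => u; apply/funext => v; rewrite mulN1r; apply/eqP.
rewrite eq_sym subr_eq -natrD eqr_nat /even_ball; lia.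
Qed.

Lemma geom_telescope r M m : (m.*2 <= M)%N ->
  \sum_(k < m.+1) (if k == 0%N :> nat then 1 else 1 - r ^+ 2) * r ^+ (M - k.*2)
    = r ^+ (M - m.*2).
Proof.
elim: m => [|m IH] hm; first by rewrite big_ord1 eqxx mul1r.
rewrite big_ord_recr /= IH; last by lia.
have -> : (M - m.*2 = 2 + (M - m.+1.*2))%N by lia.
by rewrite exprD; ring.
Qed.

(** The vector of [u] gives its ancestor at depth [k] the weight [r^(size u -
    k)], times [sqrt(1 - r^2)] except at the root. The inner product of the
    vectors of [u] and [v] sums over common ancestors, and telescopes to the
    single power [r^(tdist u v)]. *)
Lemma gram_radial r : 0 <= r -> r <= 1 -> gram_kernel (fun u v => r ^+ tdist u v).
Proof.
move=> r0 r1 E.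
pose w (k : nat) : R := if k == 0%N then 1 else Num.sqrt (1 - r ^+ 2).
have ww k : w k * w k = if k == 0%N then 1 else 1 - r ^+ 2.
  rewrite /w; case: eqP => _; first by rewrite mulr1.
  by rewrite -expr2 sqr_sqrtr// subr_ge0 exprn_ile1.
pose N := \max_(u <- E) size u.
pose T k := undup [seq take k u | u <- E].
pose p k (t : seq D) u : R := w k * r ^+ (size u - k) *
  ((k <= size u)%N%:R * (take k u == t)%:R).
exists [seq p k t | k <- iota 0 N.+1, t <- T k] => u v uE vE.
rewrite big_allpairs_dep /=.
have uN : (size u <= N)%N by rewrite /N (big_rem u uE)/= leq_max leqnn.
have h1 := meet_size_l u v; have h2 := meet_size_r u v.
transitivity (\sum_(k <- iota 0 N.+1) (k <= meet_size u v)%N%:R *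
    ((if k == 0%N then 1 else 1 - r ^+ 2) * r ^+ (size u + size v - k.*2))).
  rewrite -[iota 0 N.+1]/(index_iota 0 N.+1) big_mkord.
  rewrite -(@geom_telescope r (size u + size v) (meet_size u v)); last by lia.
  rewrite (big_ord_widen N.+1 (fun k => (if k == 0%N then 1 else 1 - r ^+ 2) * r ^+ (size u + size v - k.*2))); last by lia.
  rewrite big_mkcond /=; apply: eq_bigr => i _; rewrite ltnS.
  by case: ifP => _; rewrite ?mul1r ?mul0r.
apply: eq_bigr => k _.
transitivity (w k * w k * (r ^+ (size u - k) * r ^+ (size v - k)) *
  ((k <= size u)%N%:R * (k <= size v)%N%:R) *
  \sum_(t <- T k) (take k u == t)%:R * (take k v == t)%:R); last first.
  by rewrite mulr_sumr; apply: eq_bigr => t _; rewrite /p; ring.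
rewrite sum_eq_nat ?undup_uniq ?mem_undup ?map_f// leq_meet_size ww.
case: (leqP k (size u)) => ku /=; last by rewrite !mul0r mulr0 mul0r.
case: (leqP k (size v)) => kv /=; last by rewrite !mul0r !mulr0 mul0r.
rewrite -exprD; have -> : (size u - k + (size v - k) = size u + size v - k.*2)%N by lia.
by rewrite mulr1 mulr1 mulrC.
Qed.

(** The left side is a sum of [n + 1] equal terms, bounded by the geometric
    series. *)
Lemma geom_weight_le (rho : R) n : 0 <= rho -> rho < 1 ->
  n.+1%:R * rho ^+ n <= (1 - rho)^-1.
Proof.
move=> r0 r1; have h : 0 < 1 - rho by lra.
rewrite -[leRHS]mul1r ler_pdivlMr//.
set S := \sum_(i < n.+1) rho ^+ i.
have le1 : n.+1%:R * rho ^+ n <= S.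
  have -> : n.+1%:R * rho ^+ n = \sum_(i < n.+1) rho ^+ n.
    by rewrite sumr_const card_ord mulr_natl.
  apply: ler_sum => i _; apply: ler_wiXn2l => //; [exact: ltW|exact: leq_ord].
have le2 : n.+1%:R * rho ^+ n * (1 - rho) <= S * (1 - rho) by rewrite ler_pM2r.
apply: le_trans le2 _; have := subrX1 rho n.+1; rewrite -/S => e.
have -> : S * (1 - rho) = - ((rho - 1) * S) by ring.
by rewrite -e; have := exprn_ge0 n.+1 r0; lra.
Qed.

End TreeKernels.

(** * Radial functions on a tree, multiplied by an amenable factor *)

Section Radial.
Context (R : realType).

(** Writing the ratio as [rho^2] leaves one factor [rho^n] to absorb the
    polynomial weight, and the other to be summed. *)
Lemma geom_tail (rho eps : R) : 0 <= rho -> rho < 1 -> 0 < eps ->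
  exists N0, forall N M, (N0 <= N)%N ->
    \sum_(N <= n < M) (rho ^+ 2) ^+ n * (2 * n.+1%:R) <= eps.
Proof.
move=> r0 r1 e0; have h : 0 < 1 - rho by lra.
pose c := 2 * (1 - rho)^-1 ^+ 3.
have ih : 0 < (1 - rho)^-1 by rewrite invr_gt0.
have c0 : 0 < c by rewrite mulr_gt0// exprn_gt0.
(* The tail is at most [2 rho ^ N / (1 - rho) ^ 2], and [rho ^ N] is at most
   [(1 - rho)^-1 / (N + 1)]. *)
exists (Num.truncn (c / eps)) => N M NN.
have rN : rho ^+ N * (2 * (1 - rho)^-1 ^+ 2) <= eps.
  have := geom_weight_le N r0 r1; rewrite mulrC -ler_pdivlMr ?ltr0n// => le1.
  apply: (@le_trans _ _ ((1 - rho)^-1 / N.+1%:R * (2 * (1 - rho)^-1 ^+ 2))).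
    by rewrite ler_pM2r// mulr_gt0// exprn_gt0.
  have -> : (1 - rho)^-1 / N.+1%:R * (2 * (1 - rho)^-1 ^+ 2) = c / N.+1%:R.
    by rewrite /c exprS; ring.
  rewrite ler_pdivrMr ?ltr0n// mulrC -ler_pdivrMr//.
  apply: ltW; apply: (@lt_le_trans _ _ (Num.truncn (c / eps)).+1%:R); last by rewrite ler_nat.
  exact: truncnS_gt.
apply: le_trans rN.
have tele : (N <= M)%N -> \sum_(N <= n < M) rho ^+ n = (rho ^+ N - rho ^+ M) / (1 - rho).
  elim: M => [|M IH]; first by rewrite leqn0 => /eqP ->; rewrite big_geq// subrr mul0r.
  rewrite leq_eqVlt => /orP[/eqP ->|]; first by rewrite big_geq// subrr mul0r.
  rewrite ltnS => NM; rewrite big_nat_recr//= IH// exprS; field; lra.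
have sumle : \sum_(N <= n < M) rho ^+ n <= rho ^+ N * (1 - rho)^-1.
  have [NM|/ltnW NM] := leqP N M; last by rewrite big_geq// mulr_ge0 ?exprn_ge0// ltW.
  rewrite tele// ler_pM2r//; have := exprn_ge0 M r0; lra.
have -> : rho ^+ N * (2 * (1 - rho)^-1 ^+ 2) = (2 * (1 - rho)^-1) * (rho ^+ N * (1 - rho)^-1).
  by ring.
apply: (@le_trans _ _ ((2 * (1 - rho)^-1) * \sum_(N <= n < M) rho ^+ n)); last first.
  by rewrite ler_pM2l// mulr_gt0.
rewrite mulr_sumr; apply: ler_sum => n _.
have := geom_weight_le n r0 r1; have := exprn_ge0 n r0.
rewrite expr2 exprMn => a b.
have -> : rho ^+ n * rho ^+ n * (2 * n.+1%:R) = (2 * (n.+1%:R * rho ^+ n)) * rho ^+ n by ring.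
by rewrite ler_wpM2r// ler_pM2l.
Qed.

(** On a finite set of vertices, the cut-off kernel is the full radial kernel,
    of Schur norm at most one, minus finitely many spheres of radius at least
    [N]. *)
Lemma schur_truncated (D : eqType) (rho eps : R) : 0 <= rho -> rho < 1 -> 0 < eps ->
  exists N0, forall N, (N0 <= N)%N ->
    schur_kernel (fun u v : seq D => (tdist u v < N)%N%:R * (rho ^+ 2) ^+ tdist u v) (1 + eps).
Proof.
move=> r0 r1 e0; have [N0 hN] := geom_tail r0 r1 e0; exists N0 => N NN.
set r := rho ^+ 2; have r'0 : 0 <= r by exact: exprn_ge0.
have r'1 : r <= 1 by rewrite exprn_ile1// ltW.
apply: schur_kernel_local => E.
(* [M] exceeds all distances between points of [E]. *)
pose m := \max_(u <- E) size u; pose M := (m + m).+1.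
exists (fun u v => r ^+ tdist u v +
  -1 * \sum_(n <- index_iota N M) r ^+ n * (tdist u v == n)%:R).
  have -> : 1 + eps = 1 + `|-1| * eps by rewrite normrN normr1 mul1r.
  apply: schur_kernelD.
    by apply: gram_schur; [exact: gram_radial|move=> u; rewrite exprn_ile1].
  apply: schur_kernelZ; apply: schur_kernel_le (hN N M NN) _.
  apply: schur_kernel_sum => n.
  have -> : (rho ^+ 2) ^+ n * (2 * n.+1%:R) = `|r ^+ n| * (2 * n.+1%:R).
    by rewrite ger0_norm// exprn_ge0.
  by apply: schur_kernelZ; exact: schur_sphere.
move=> u v uE vE.
have le_m w : w \in E -> (size w <= m)%N.
  by move=> wE; rewrite /m (big_rem w wE)/= leq_max leqnn.
have dM : (tdist u v < M)%N by rewrite /tdist /M; have := le_m u uE; have := le_m v vE; lia.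
rewrite mulN1r; case: ltnP => Nd.
  rewrite mul1r big1_seq ?subr0// => n; rewrite mem_index_iota => /andP[_ /andP[Nn _]].
  by case: eqP => [e|]; [lia|rewrite mulr0].
rewrite mul0r (bigD1_seq (tdist u v)) ?iota_uniq//= ?mem_index_iota ?Nd//.
rewrite eqxx mulr1 big1 ?addr0 ?subrr// => n /negPf; rewrite eq_sym => ->.
by rewrite mulr0.
Qed.

Lemma bernoulli_le (d : R) m : 0 <= d -> d <= 1 -> 1 - m%:R * d <= (1 - d) ^+ m.
Proof.
move=> d0 d1; elim: m => [|m IH]; first by rewrite mul0r subr0.
have h : 0 <= 1 - d by lra.
rewrite exprS; apply: (@le_trans _ _ ((1 - d) * (1 - m%:R * d))); last exact: ler_wpM2l.
rewrite -[m.+1]add1n natrD -subr_ge0.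
have -> : (1 - d) * (1 - m%:R * d) - (1 - (1%:R + m%:R) * d) = m%:R * d ^+ 2 by ring.
by rewrite mulr_ge0 ?sqr_ge0.
Qed.

Lemma radial_near1 (L : nat) (eps : R) : 0 < eps ->
  exists rho : R, [/\ 0 <= rho, rho < 1 &
    forall n, (n <= L)%N -> 1 - eps <= (rho ^+ 2) ^+ n <= 1].
Proof.
move=> e0.
have [d [d0 d1 dL]] := @small_factor R (2 * L%:R) _ (mulr_ge0 (ler0n _ _) (ler0n _ _)) e0.
exists (1 - d); split; [lra|lra|] => n nL; rewrite -exprM.
have ge0 : 0 <= 1 - d by lra.
rewrite exprn_ile1 ?andbT//; last lra.
apply: le_trans (bernoulli_le (2 * n) (ltW d0) d1).
rewrite natrM; have : n%:R <= L%:R :> R by rewrite ler_nat.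
rewrite -(@ler_pM2r _ d)// => nl.
have -> : 2%:R * n%:R * d = 2 * (n%:R * d) :> R by ring.
have : d * (2 * L%:R) = 2 * (L%:R * d) by ring.
lra.
Qed.

End Radial.

Section TreeTimesAmenable.
Context (R : realType) (G : groupType) (D : eqType) (s : G -> seq D).
Context (size_s : forall g h, size (s (g^-1 * h)%g) = tdist (s g) (s h)).
Context (amenable_part : forall (K : seq G) (eps : R), 0 < eps ->
  exists psi : G -> R,
  [/\ gram psi, forall g, `|psi g| <= psi 1%g, psi 1%g = 1,
      {in K, forall g, `|psi g - 1| < eps} &
      forall N, finite_set [set g | (size (s g) < N)%N /\ psi g != 0]]).

Lemma tree_near1 (K : seq G) (eps : R) : 0 < eps ->
  exists rho (psi : G -> R), [/\ 0 <= rho, rho < 1,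
  [/\ gram psi, forall g, `|psi g| <= psi 1%g, psi 1%g = 1 &
      forall N, finite_set [set g | (size (s g) < N)%N /\ psi g != 0]] &
  {in K, forall g, `|(rho ^+ 2) ^+ size (s g) * psi g - 1| < eps}].
Proof.
move=> e0; have e2 : 0 < eps / 2 by exact: divr_gt0.
have [psi [h1 h2 h3 h4 h5]] := amenable_part K e2.
have [rho [r0 r1 hr]] := radial_near1 (\max_(g <- K) size (s g)) e2.
exists rho, psi; split=> // g gK.
have /hr /andP[] : (size (s g) <= \max_(g <- K) size (s g))%N.
  by rewrite (big_rem g gK)/= leq_max leqnn.
set x := _ ^+ _ => x1 x2; have := h4 g gK; have := h2 g; rewrite h3 => p1 p2.
have -> : x * psi g - 1 = (psi g - 1) + (x - 1) * psi g by ring.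
apply: le_lt_trans (ler_normD _ _) _; rewrite normrM.
have : `|x - 1| * `|psi g| <= `|x - 1| by rewrite ler_piMr.
have : `|x - 1| <= eps / 2 by rewrite ler_norml; lra.
lra.
Qed.

Theorem tree_gram_approximable : gram_approximable R G.
Proof.
move=> K eps e0; have [rho [psi [r0 r1 [h1 h2 h3 h4] h5]]] := tree_near1 K e0.
exists (fun g => (rho ^+ 2) ^+ size (s g) * psi g); split=> //.
  rewrite /gram (_ : (fun _ _ => _) = fun g h => (rho ^+ 2) ^+ tdist (s g) (s h) *
    psi (g^-1 * h)%g); last by apply/funext => g; apply/funext => h; rewrite size_s.
  apply: gram_kernelM h1; apply: (@gram_kernel_comp _ _ _ s (fun u v => (rho ^+ 2) ^+ tdist u v)).
  by apply: gram_radial; rewrite ?exprn_ge0// exprn_ile1// ltW.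
(* Outside a ball, [(rho ^ 2) ^ l <= rho ^ l <= (1 - rho)^-1 / (l + 1)] is below [e]. *)
move=> e e1; pose N := Num.truncn ((1 - rho)^-1 / e).
apply: sub_finite_set (h4 N.+1) => g /= eg; split; last first.
  by apply: contraTneq eg => ->; rewrite mulr0 normr0 -ltNge.
have r2 : 0 <= (rho ^+ 2) ^+ size (s g) by rewrite !exprn_ge0.
have ehr : e <= rho ^+ size (s g).
  apply: le_trans eg _; rewrite normrM ger0_norm//.
  apply: (@le_trans _ _ ((rho ^+ 2) ^+ size (s g))).
    by rewrite ler_piMr// -h3.
  rewrite -exprM mulnC exprM expr2 ler_piMl ?exprn_ge0// exprn_ile1// ltW//.
have := geom_weight_le (size (s g)) r0 r1 => gw.
have sgt : (size (s g)).+1%:R * e <= (1 - rho)^-1.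
  by apply: le_trans gw; rewrite ler_wpM2l.
rewrite -ler_pdivlMr// in sgt.
rewrite -(@ltr_nat R); apply: le_lt_trans _ (truncnS_gt _).
by apply: le_trans sgt; rewrite ler_nat.
Qed.

Theorem tree_schur_approximable : schur_approximable R G.
Proof.
move=> K eps e0; have [rho [psi [r0 r1 [h1 h2 h3 h4] h5]]] := tree_near1 K e0.
have [N0 hN] := schur_truncated D r0 r1 e0.
pose N := maxn N0 (\max_(g <- K) size (s g)).+1.
pose phi g := (size (s g) < N)%N%:R * (rho ^+ 2) ^+ size (s g) * psi g.
exists phi, (fset_set [set g | (size (s g) < N)%N /\ psi g != 0]); split.
- move=> g; rewrite in_fset_set ?h4// notin_setE /= => /not_andP gN.
  rewrite /phi; case: ltnP => sN; last by rewrite !mul0r.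
  by case: gN => [/(_ sN)//|/negP]; rewrite negbK => /eqP ->; rewrite mulr0.
- rewrite /schur_le (_ : (fun _ _ => _) = fun g h => (tdist (s g) (s h) < N)%N%:R *
    (rho ^+ 2) ^+ tdist (s g) (s h) * psi (g^-1 * h)%g); last first.
    by apply/funext => g; apply/funext => h; rewrite /phi size_s.
  rewrite -[1 + eps]mulr1; apply: schur_kernelM => //; first by lra.
    apply: (@schur_kernel_comp _ _ _ s
      (fun u v => (tdist u v < N)%N%:R * (rho ^+ 2) ^+ tdist u v)).
    by apply: hN; rewrite leq_maxl.
  by apply: gram_schur h1 _ => g; rewrite mulVg h3.
move=> g gK; rewrite /phi; case: ltnP => [_|]; first by rewrite mul1r h5.
rewrite /N geq_max ltnNge (big_rem g gK)/= leq_max leqnn andbF; by [].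
Qed.

End TreeTimesAmenable.

(** * Almost invariant finite sets *)

Section Folner.
Context (R : realType) (T : choiceType).
Local Open Scope fset_scope.
Local Open Scope ring_scope.
Implicit Types (fs : seq (T -> T)) (F : {fset T}).

(** Boxes rather than balls for the word metric: a point of a box is given by
    its vector of exponents, which bounds their number at once. *)
Fixpoint box fs (x0 : T) (N : nat) : {fset T} :=
  if fs is f :: fs' then [fset iter k f y | k in iota 0 N.+1, y in box fs' x0 N]
  else [fset x0].

Lemma boxP f fs x0 N z : reflect (exists k y, [/\ (k <= N)%N, y \in box fs x0 N & z = iter k f y])
  (z \in box (f :: fs) x0 N).
Proof.
have kE k : (k \in iota 0 N.+1) = (k <= N)%N by rewrite mem_iota add0n ltnS.
apply: (iffP idP) => [/imfset2P[k kI [y yB ->]]|[k [y [kN yB ->]]]].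
  by exists k, y; split=> //; rewrite -kE.
by apply/imfset2P; exists k; [rewrite -kE in kN|exists y].
Qed.

Lemma box0 fs x0 N : x0 \in box fs x0 N.
Proof.
elim: fs => [|f fs IH]; first by rewrite inE.
by apply/boxP; exists 0%N, x0.
Qed.

Lemma card_box fs x0 N : (#|` box fs x0 N| <= N.+1 ^ size fs)%N.
Proof.
elim: fs => [|f fs IH] /=; first by rewrite cardfs1.
rewrite expnS; apply: leq_trans (leq_mul (leqnn _) IH).
pose im := [seq iter k f y | k <- iota 0 N.+1, y <- enum_fset (box fs x0 N)].
have -> : (N.+1 * #|` box fs x0 N|)%N = size im by rewrite /im size_allpairs size_iota.
apply: (@leq_trans (size (undup im))); last exact: size_undup.
apply: uniq_leq_size; first exact: fset_uniq.
move=> z; rewrite mem_undup => /imfset2P[k kN [y yB ->]].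
by apply/allpairsP; exists (k, y).
Qed.

Lemma box_mono fs x0 N z : z \in box fs x0 N -> z \in box fs x0 N.+1.
Proof.
elim: fs z => [//|f fs IH] z /boxP[k [y [kN yB ->]]].
by apply/boxP; exists k, y; split; [exact: leqW|exact: IH|].
Qed.

Lemma iter_comm (f g : T -> T) k y : (forall x, f (g x) = g (f x)) ->
  f (iter k g y) = iter k g (f y).
Proof. by move=> h; elim: k => //= k IH; rewrite h IH. Qed.

Definition pairwise_comm fs : Prop := forall f g, List.In f fs -> List.In g fs ->
  forall x, f (g x) = g (f x).

Lemma box_step fs x0 N f z : pairwise_comm fs -> List.In f fs ->
  z \in box fs x0 N -> f z \in box fs x0 N.+1.
Proof.
elim: fs z => [//|g fs IH] z cfs fin /boxP[k [y [kN yB ->]]].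
have cfs' : pairwise_comm fs by move=> a b ha hb; apply: cfs; right.
apply/boxP; case: fin => [<-|fin].
  by exists k.+1, y; split=> //; exact: box_mono.
exists k, (f y); split; first exact: leqW.
  exact: IH.
by apply: iter_comm; apply: cfs; [right|left].
Qed.

Lemma box_ind (P : T -> Prop) fs x0 N : P x0 ->
  (forall f, List.In f fs -> forall x, P x -> P (f x)) ->
  forall z, z \in box fs x0 N -> P z.
Proof.
move=> P0; elim: fs => [|f fs IH] Pf z; first by rewrite inE => /eqP ->.
move=> /boxP[k [y [_ yB ->]]]; elim: k => [|k IHk] /=.
  by apply: IH => // g hg; apply: Pf; right.
by apply: Pf => //; left.
Qed.

Lemma growth_slow (q : R) m : 0 <= q -> q < 1 -> exists N, (N.+1 ^ m.+1)%N%:R * q ^+ N < 1.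
Proof.
move=> q0 q1; have e0 : 0 < 1 - q by lra.
have [rho [r0 r1 hr]] := radial_near1 m.+1 e0.
have [N hN] := geom_tail r0 r1 (@ltr01 R); exists N.
have := hN N N.+1 (leqnn _); rewrite big_nat1 => tail.
have /andP[qm _] := hr m.+1 (leqnn _).
have qm' : q <= (rho ^+ 2) ^+ m.+1 by lra.
have x0 : 0 <= (rho ^+ 2) ^+ N by rewrite !exprn_ge0.
(* [q] is at most the power [m + 1] of [rho ^ 2]. *)
apply: (@le_lt_trans _ _ ((N.+1%:R * (rho ^+ 2) ^+ N) ^+ m.+1)).
  rewrite natrX exprMn ler_wpM2l ?exprn_ge0//.
  by rewrite [_ ^+ N ^+ m.+1]exprAC lerXn2r ?nnegrE ?exprn_ge0.
apply: exprn_ilt1 => //; first by rewrite mulr_ge0.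
set y := _ * _ in tail *; set z := N.+1%:R * _.
have : y = 2 * z by rewrite /y /z; ring.
lra.
Qed.

(** A map sends the box of side [N] into the next one, so if some map moved
    more than a proportion [eps] of every box out of it, boxes would grow
    exponentially. But they have at most [(N + 1)^m] points. *)
Lemma folner_comm fs x0 (eps : R) : 0 < eps -> pairwise_comm fs ->
  (forall f, List.In f fs -> injective f) ->
  exists N, forall f, List.In f fs ->
    \sum_(x <- box fs x0 N) (f x \notin box fs x0 N)%:R <= eps * #|` box fs x0 N|%:R.
Proof.
move=> e0 cfs injfs; apply: contrapT => /forallNP hN.
pose c N : R := #|` box fs x0 N|%:R.
have grow N : (1 + eps) * c N <= c N.+1.
  have /existsNP[f /not_implyP[fin /negP]] := hN N; rewrite -ltNge => /ltW; rewrite -/(c N).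
  set B := box fs x0 N => hB.
  pose B' := [fset x in B | f x \notin B].
  have cB' : \sum_(x <- B) (f x \notin B)%:R = #|` [fset f x | x in B']|%:R :> R.
    rewrite card_imfset; last exact: injfs.
    rewrite /B' -natr_sum; congr (_%:R).
    have /perm_size -> : perm_eq [fset x in B | f x \notin B] [seq x <- B | f x \notin B].
      apply: uniq_perm; rewrite ?filter_uniq ?fset_uniq// => x.
      by rewrite mem_filter !inE andbC.
    by rewrite size_filter -sum1_count [RHS]big_mkcond.
  have sub : B `|` [fset f x | x in B'] `<=` box fs x0 N.+1.
    apply/fsubsetP => z; rewrite inE => /orP[/box_mono//|/imfsetP[x /=]].
    rewrite !inE => /andP[xB _] ->; exact: box_step.
  have dis : [disjoint B & [fset f x | x in B']].
    apply/fdisjointP => z zB; apply/negP => /imfsetP[x /=].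
    by rewrite !inE => /andP[_ fx] e; rewrite -e zB in fx.
  have := fsubset_leq_card sub; rewrite cardfsU (eqP dis) cardfs0 subn0.
  rewrite -(@ler_nat R) natrD -cB' -/(c N) -/(c N.+1) => h.
  by rewrite mulrDl mul1r; apply: le_trans h; rewrite lerD2l.
have cge N : (1 + eps) ^+ N <= c N.
  elim: N => [|N IH].
    by rewrite expr0 /c ler1n cardfs_gt0; apply/fset0Pn; exists x0; exact: box0.
  by rewrite exprS; apply: le_trans (grow N); rewrite ler_pM2l//; lra.
have q1 : (1 + eps)^-1 < 1 by rewrite invf_lt1; lra.
have q0 : 0 <= (1 + eps)^-1 by rewrite invr_ge0; lra.
have [N] := growth_slow (size fs) q0 q1.
rewrite ltNge => /negP; apply; rewrite exprVn ler_pdivlMr; last by apply: exprn_gt0; lra.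
rewrite mul1r.
apply: le_trans (cge N) _; rewrite ler_nat; apply: leq_trans (card_box _ _ _) _.
by apply: leq_pexp2l.
Qed.

End Folner.

Section GramOrbit.
Context (R : realType) (G : groupType) (T : choiceType) (act : T -> G -> T).
Context (act1 : forall t, act t 1%g = t).
Context (actM : forall t g h, act t (g * h)%g = act (act t g) h).
Local Open Scope fset_scope.
Local Open Scope ring_scope.

(** For a right action, the normalized coefficient of the indicator function
    of [F]. *)
Definition overlap (F : {fset T}) (g : G) : R :=
  (\sum_(t <- F) (act t g \in F)%:R) / #|` F|%:R.

(** The substitution [t = u g] exhibits the count as the inner product of the
    indicators of [F g^-1] and [F h^-1]. *)
Lemma gram_overlap F : gram (overlap F).
Proof.
move=> E; pose c : R := Num.sqrt #|` F|%:R^-1.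
have cc : c * c = #|` F|%:R^-1 by rewrite -expr2 sqr_sqrtr// invr_ge0.
exists [seq (fun g => c * (act u g \in F)%:R) |
  u <- undup [seq act t h^-1%g | t <- enum_fset F, h <- E]] => g h gE hE.
rewrite /overlap big_map.
transitivity (c * c * \sum_(u <- undup [seq act t h^-1%g | t <- enum_fset F, h <- E])
   (act u g \in F)%:R * (act u h \in F)%:R); last first.
  by rewrite mulr_sumr; apply: eq_bigr => u _; ring.
rewrite cc mulrC; congr (_ * _).
set U := undup _.
have UU : uniq U by exact: undup_uniq.
transitivity (\sum_(u <- U | act u g \in F) (act u h \in F)%:R : R); last first.
  by rewrite big_mkcond /=; apply: eq_bigr => u _; case: ifP; rewrite ?mul1r ?mul0r.
rewrite -[RHS]big_filter.
transitivity (\sum_(t <- [seq act u g | u <- U & act u g \in F]) (act t (g^-1 * h)%g \in F)%:R : R).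
  apply: perm_big; apply: uniq_perm; first exact: fset_uniq.
    rewrite map_inj_uniq ?filter_uniq// => a b e.
    by rewrite -[a]act1 -[b]act1 -(mulgV g) !actM e.
  move=> t; apply/idP/mapP => [tF|[u]]; last first.
    by rewrite mem_filter => /andP[uF _] ->.
  exists (act t g^-1%g); last by rewrite -actM mulVg act1.
  rewrite mem_filter -actM mulVg act1 tF mem_undup.
  by apply/allpairsP; exists (t, g).
by rewrite big_map; apply: eq_bigr => u _; rewrite -actM mulVKg.
Qed.

Lemma overlap1 F : F != fset0 -> overlap F 1%g = 1.
Proof.
rewrite -cardfs_gt0 => F0; rewrite /overlap.
rewrite (eq_big_seq (fun=> 1)) => [|t tF]; last by rewrite act1 tF.
by rewrite big_const_seq count_predT iter_addr_0 mulfV// pnatr_eq0 -lt0n.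
Qed.

Lemma overlap_ge0 F g : 0 <= overlap F g.
Proof. by rewrite /overlap mulr_ge0 ?invr_ge0// sumr_ge0. Qed.

Lemma overlap_le1 F g : overlap F g <= 1.
Proof.
rewrite /overlap; have [->|F0] := eqVneq F fset0.
  by rewrite big_seq_fset0 mul0r.
rewrite ler_pdivrMr ?ltr0n ?cardfs_gt0// mul1r.
apply: (@le_trans _ _ (\sum_(t <- F) 1)).
  by apply: ler_sum => t _; rewrite lern1 leq_b1.
by rewrite big_const_seq count_predT iter_addr_0.
Qed.

Lemma overlap_neq0 F g : overlap F g != 0 -> exists2 t, t \in F & act t g \in F.
Proof.
apply: contraPP => /forall2NP h; rewrite /overlap big1_seq ?mul0r ?eqxx// => t /andP[_ tF].
by case: (h t) => // /negP/negPf ->.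
Qed.

End GramOrbit.

(** * Affine actions with commuting linear parts *)

Section AffineAmenable.
Context (R : realType) (G : groupType) (n : nat) (D : eqType) (s : G -> seq D).
Context (C : G -> 'M[rat]_n) (b : G -> 'rV[rat]_n).
Context (C1 : C 1%g = 1%:M).
Context (b1 : b 1%g = 0).
Context (CM : forall g h, C (g * h)%g = C h *m C g).
Context (bM : forall g h, b (g * h)%g = b g + b h *m C g).
Context (Ccomm : forall g h, C g *m C h = C h *m C g).
Context (finite_fibers : forall N X v,
  finite_set [set g | [/\ (size (s g) < N)%N, C g = X & b g = v]]).
Local Open Scope fset_scope.
Local Open Scope ring_scope.

(** The right translation of the affine group by the image of [g]. *)
Definition affine_act (t : 'M[rat]_n * 'rV[rat]_n) (g : G) : 'M[rat]_n * 'rV[rat]_n :=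
  (C g *m t.1, t.2 + b g *m t.1).

Lemma affine_act1 t : affine_act t 1%g = t.
Proof. by case: t => X v; rewrite /affine_act C1 b1 /= mul1mx mul0mx addr0. Qed.

Lemma affine_actM t g h : affine_act t (g * h)%g = affine_act (affine_act t g) h.
Proof.
case: t => X v; rewrite /affine_act CM bM /=; congr (_, _); first by rewrite mulmxA.
by rewrite mulmxDl addrA mulmxA.
Qed.

Lemma C_unit g : C g \in unitmx.
Proof. by have := CM g g^-1%g; rewrite mulgV C1 => /esym/mulmx1_unit[]. Qed.

Lemma In_map (T U : Type) (f : T -> U) (r : seq T) y :
  List.In y [seq f x | x <- r] -> exists2 x, List.In x r & y = f x.
Proof.
elim: r => //= x r IH [<-|/IH[z zr ->]]; first by exists x => //; left.
by exists z => //; right.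
Qed.

Lemma In_mem (T : eqType) (r : seq T) x : x \in r <-> List.In x r.
Proof.
elim: r => //= y r IH; rewrite inE; split; first by case/orP=> [/eqP ->|/IH]; [left|right].
by case=> [->|/IH ->]; rewrite ?eqxx ?orbT.
Qed.

Lemma sum_setX (F1 : {fset 'M[rat]_n}) (F2 : {fset 'rV[rat]_n}) (V : nmodType)
    (f : 'M[rat]_n * 'rV[rat]_n -> V) :
  \sum_(t <- F1 `*` F2) f t =
  \sum_(X <- F1) \sum_(v <- F2) f (X, v).
Proof.
transitivity (\sum_(t <- [seq (X, v) | X <- enum_fset F1, v <- enum_fset F2]) f t); last first.
  by rewrite big_allpairs.
apply: perm_big.
apply: uniq_perm; first exact: fset_uniq.
  apply: allpairs_uniq; [exact: fset_uniq|exact: fset_uniq|].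
  by move=> [X v] [Y w] _ _ /= [-> ->].
move=> [X v]; rewrite in_fsetM; apply/andP/allpairsP => [[XF vF]|[[Y w] [XF vF [-> ->]]]] //.
by exists (X, v).
Qed.

(** Right translation by [g] multiplies the matrix [X] by [C g], independently
    of the vector, and translates the vector by [b g X]. So one first chooses
    the set of matrices, and then a set of vectors almost invariant under the
    finitely many translations [b g X]. *)
Lemma affine_folner (K : seq G) (eps : R) : 0 < eps ->
  exists F : {fset 'M[rat]_n * 'rV[rat]_n},
    [/\ F != fset0, forall t, t \in F -> t.1 \in unitmx &
        {in K, forall g, 1 - overlap R affine_act F g < eps}].
Proof.
move=> e0; have e3 : 0 < eps / 3 by exact: divr_gt0.
pose fs1 := [seq (fun X : 'M[rat]_n => C g *m X) | g <- K].
have c1 : pairwise_comm fs1.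
  move=> f f' hf hf' X; have [g _ ->] := In_map hf; have [h _ ->] := In_map hf'.
  by rewrite !mulmxA Ccomm.
have i1 f : List.In f fs1 -> injective f.
  move=> hf X Y; have [g _ ->] := In_map hf.
  by move=> /(congr1 (mulmx (invmx (C g)))); rewrite !mulKmx ?C_unit.
have [N1 h1] := @folner_comm R _ _ 1%:M _ e3 c1 i1; set F1 := box _ _ _ in h1.
have u1 X : X \in F1 -> X \in unitmx.
  apply: (@box_ind _ (fun Y => Y \in unitmx)); first exact: unitmx1.
  by move=> f hf Y Yu; have [g _ ->] := In_map hf; rewrite unitmx_mul C_unit.
pose fs2 := [seq (fun v : 'rV[rat]_n => v + b p.1 *m p.2) |
  p <- [seq (g, X) | g <- K, X <- enum_fset F1]].
have c2 : pairwise_comm fs2.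
  move=> f f' hf hf' v; have [p _ ->] := In_map hf; have [q _ ->] := In_map hf'.
  by rewrite addrAC.
have i2 f : List.In f fs2 -> injective f.
  by move=> hf; have [p _ ->] := In_map hf; exact: addIr.
have [N2 h2] := @folner_comm R _ _ 0 _ e3 c2 i2; set F2 := box _ _ _ in h2.
pose F := F1 `*` F2.
have memF X v : ((X, v) \in F) = (X \in F1) && (v \in F2).
  by rewrite in_fsetM.
have F0 : F != fset0.
  by apply/fset0Pn; exists (1%:M, 0); rewrite memF !box0.
exists F; split=> // [[X v]|g gK]; first by rewrite memF => /andP[/u1].
have cardF : #|` F|%:R = #|` F1|%:R * #|` F2|%:R :> R.
  have E (T : choiceType) (A : {fset T}) : #|` A|%:R = \sum_(x <- A) 1 :> R.
    by rewrite big_const_seq count_predT iter_addr_0.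
  rewrite !E sum_setX mulr_suml; apply: eq_bigr => X _.
  by rewrite mul1r.
have F0' : 0 < #|` F|%:R :> R by rewrite ltr0n cardfs_gt0.
rewrite -[X in X - _](@mulfV _ #|` F|%:R) ?gt_eqF// /overlap -mulrBl ltr_pdivrMr//.
set S := \sum_(t <- F) _.
have SE : #|` F|%:R - S = \sum_(t <- F) (affine_act t g \notin F)%:R.
  have -> : #|` F|%:R = \sum_(t <- F) 1 :> R by rewrite big_const_seq count_predT iter_addr_0.
  by rewrite -sumrB; apply: eq_bigr => t _; case: (_ \in F); rewrite ?subrr ?subr0.
rewrite SE sum_setX.
apply: (@le_lt_trans _ _ (2 * (eps / 3) * #|` F|%:R)); last by rewrite ltr_pM2r//; lra.
apply: (@le_trans _ _ (\sum_(X <- F1) \sum_(v <- F2)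
    ((C g *m X \notin F1)%:R + (v + b g *m X \notin F2)%:R))).
  apply: ler_sum => X _; apply: ler_sum => v _.
  rewrite /affine_act memF /= negb_and -natrD ler_nat.
  by case: (_ \in F1); case: (_ \in F2).
have gIn : List.In g K by apply/In_mem.
have A1 : \sum_(X <- F1) \sum_(v <- F2) (C g *m X \notin F1)%:R <=
    eps / 3 * #|` F|%:R :> R.
  have := h1 (fun X => C g *m X) (List.in_map (fun g (X : 'M[rat]_n) => C g *m X) K g gIn).
  rewrite cardF mulrA; set c := #|` F2|%:R => le1.
  apply: le_trans (ler_wpM2r (ler0n _ #|` F2|) le1); rewrite mulr_suml.
  by apply: ler_sum => X _; rewrite big_const_seq count_predT iter_addr_0 mulr_natr.
have A2 : \sum_(X <- F1) \sum_(v <- F2) (v + b g *m X \notin F2)%:R <=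
    eps / 3 * #|` F|%:R :> R.
  apply: (@le_trans _ _ (\sum_(X <- F1) eps / 3 * #|` F2|%:R)).
    rewrite big_seq [leRHS]big_seq; apply: ler_sum => X XF.
    apply: (h2 (fun v => v + b g *m X)).
    apply: (List.in_map (fun (p : G * 'M[rat]_n) (v : 'rV[rat]_n) => v + b p.1 *m p.2) _ (g, X)).
    by apply/In_mem/allpairsP; exists (g, X).
  by rewrite big_const_seq count_predT iter_addr_0 cardF -mulr_natr; lra.
under eq_bigr do rewrite big_split /=.
by rewrite big_split /=; lra.
Qed.

(** If [psi g] is nonzero then [g] carries a point of the finite set [F] to
    another one; as the matrices in [F] are invertible, these two points
    determine the affine image of [g]. *)
Lemma affine_amenable (K : seq G) (eps : R) : 0 < eps ->
  exists psi : G -> R,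
  [/\ gram psi, forall g, `|psi g| <= psi 1%g, psi 1%g = 1,
      {in K, forall g, `|psi g - 1| < eps} &
      forall N, finite_set [set g | (size (s g) < N)%N /\ psi g != 0]].
Proof.
move=> e0; have [F [F0 Fu FK]] := affine_folner K e0.
exists (overlap R affine_act F).
have o1 := overlap1 R affine_act1 F0.
split=> //.
- exact: gram_overlap affine_act1 affine_actM F.
- by move=> g; rewrite o1 ger0_norm ?overlap_ge0// overlap_le1.
- by move=> g gK; rewrite ler0_norm ?subr_le0 ?overlap_le1// opprB FK.
move=> N.
apply: (@sub_finite_set _ _ (\bigcup_(p in [set` F] `*` [set` F])
  [set g | [/\ (size (s g) < N)%N, C g = p.2.1 *m invmx p.1.1 &
     b g = (p.2.2 - p.1.2) *m invmx p.1.1]])).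
  move=> g [/= sg /overlap_neq0[[X v] tF uF]].
  exists ((X, v), affine_act (X, v) g) => //=.
  by split=> //; rewrite ?[v + _]addrC ?addrK mulmxK// (Fu (X, v)).
apply: bigcup_finite; first by apply: finite_setX; exact: finite_fset.
by move=> [[X v] [Y w]] _; exact: finite_fibers.
Qed.

Theorem tree_affine_approximable :
  (forall g h, size (s (g^-1 * h)%g) = tdist (s g) (s h)) ->
  schur_approximable R G /\ gram_approximable R G.
Proof.
move=> size_s; split.
  exact: tree_schur_approximable size_s affine_amenable.
exact: tree_gram_approximable size_s affine_amenable.
Qed.

End AffineAmenable.

(** * Injective endomorphisms of a lattice *)

Section Lattice.
Context (n : nat) (alpha : 'rV[int]_n -> 'rV[int]_n).
Context (alphaD : forall a b, alpha (a + b) = alpha a + alpha b).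
Context (alpha_inj : injective alpha).
Implicit Types (a g : 'rV[int]_n).

Lemma alpha0 : alpha 0 = 0.
Proof. by apply: (addIr (alpha 0)); rewrite -alphaD !add0r. Qed.

Lemma alphaN a : alpha (- a) = - alpha a.
Proof. by apply: (addIr (alpha a)); rewrite -alphaD !addNr alpha0. Qed.

Definition in_image g : Prop := exists a, g = alpha a.

(** The representative of the image itself is [0], so that membership in the
    image is the equation [coset_rep g = 0]. *)
Definition coset_rep g : 'rV[int]_n :=
  if `[< in_image g >] then 0 else xget 0 [set h | in_image (g - h)].

Lemma in_imageDr g a : in_image (g + alpha a) <-> in_image g.
Proof.
split=> -[c e]; last by exists (c + a); rewrite e alphaD.
by exists (c - a); rewrite alphaD alphaN -e addrK.
Qed.

Lemma coset_repD g a : coset_rep (g + alpha a) = coset_rep g.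
Proof.
rewrite /coset_rep; have -> : `[< in_image (g + alpha a) >] = `[< in_image g >].
  by apply: asbool_equiv_eq; exact: in_imageDr.
case: ifP => // _; congr (xget 0 _); apply/funext => h; apply/propext => /=.
by rewrite addrAC; exact: in_imageDr.
Qed.

Lemma coset_repP g : in_image (g - coset_rep g).
Proof.
rewrite /coset_rep; case: asboolP => [|_]; first by rewrite subr0.
by case: xgetP => [h _ //|/(_ g)]; case; exists 0; rewrite subrr alpha0.
Qed.

Definition coset_quo g : 'rV[int]_n := projT1 (cid (coset_repP g)).

Lemma coset_quoE g : g = coset_rep g + alpha (coset_quo g).
Proof.
by rewrite /coset_quo; case: (cid _) => a /= <-; rewrite addrC subrK.
Qed.

Lemma coset_rep_idem g : coset_rep (coset_rep g) = coset_rep g.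
Proof. by rewrite [X in _ = coset_rep X]coset_quoE coset_repD. Qed.

Lemma coset_quoD g a : coset_quo (g + alpha a) = coset_quo g + a.
Proof.
apply: alpha_inj; apply: (addrI (coset_rep (g + alpha a))); rewrite -coset_quoE.
by rewrite coset_repD alphaD addrA -coset_quoE.
Qed.

Lemma coset_rep_alpha a : coset_rep (alpha a) = 0.
Proof. by rewrite /coset_rep; case: asboolP => // -[]; exists a. Qed.

Lemma coset_quo_rep g : coset_rep g = g -> coset_quo g = 0.
Proof.
move=> e; apply: alpha_inj; rewrite alpha0; apply: (addrI g).
by rewrite addr0 -{1}e -coset_quoE.
Qed.

Lemma coset_quo_alpha a : coset_quo (alpha a) = a.
Proof.
have := coset_quoE (alpha a); rewrite coset_rep_alpha add0r => /alpha_inj.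
by [].
Qed.

Definition ratm p q (B : 'M[int]_(p, q)) : 'M[rat]_(p, q) := map_mx intr B.

Lemma ratm_inj p q : injective (@ratm p q).
Proof.
move=> A B /matrixP e; apply/matrixP => i j; have := e i j.
by rewrite !mxE => /intr_inj.
Qed.

Lemma common_denominator p q (A : 'M[rat]_(p, q)) :
  exists (D : nat) (B : 'M[int]_(p, q)), D.+1%:R *: A = ratm B.
Proof.
(* The witness is the predecessor because the statement multiplies by a
   successor, which excludes zero. *)
pose P : int := \prod_(i < p) \prod_(j < q) denq (A i j).
have P0 : 0 < P by apply: prodr_gt0 => i _; apply: prodr_gt0 => j _; exact: denq_gt0.
exists `|P|%N.-1; rewrite prednK ?absz_gt0 ?gt_eqF//.
have PA i j : exists z : int, P%:~R * A i j = z%:~R.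
  rewrite /P (bigD1 i)//= (bigD1 j)//=; set Q1 := \prod_(_ | _) _; set Q2 := \prod_(_ | _) _.
  exists (Q1 * Q2 * numq (A i j)).
  rewrite !intrM -[X in _ * X = _]divq_num_den; field.
  by rewrite intr_eq0 denq_neq0.
have PE : (`|P|%N%:R : rat) = P%:~R by rewrite -[in RHS](gez0_abs (ltW P0)).
exists (\matrix_(i, j) projT1 (cid (PA i j))).
apply/matrixP => i j; rewrite !mxE PE; by case: (cid _).
Qed.

Definition alpha_mx : 'M[rat]_n :=
  \matrix_(i, j) (alpha (delta_mx 0 i) 0 j)%:~R.

Lemma alpha_Mn a k : alpha (a *+ k) = alpha a *+ k.
Proof. by elim: k => [|k IH]; rewrite ?mulr0n ?alpha0// !mulrS alphaD IH. Qed.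

Lemma alpha_Mz a (k : int) : alpha (a *~ k) = alpha a *~ k.
Proof. by case: k => k; rewrite ?NegzE ?mulrNz -?pmulrn ?alphaN alpha_Mn. Qed.

Lemma alpha_mxE a : ratm (alpha a) = ratm a *m alpha_mx.
Proof.
have alpha_sum (I : Type) (r : seq I) (F : I -> 'rV[int]_n) :
  alpha (\sum_(i <- r) F i) = \sum_(i <- r) alpha (F i).
  by apply: (big_morph _ alphaD alpha0).
rewrite {1}(row_sum_delta a) alpha_sum; apply/rowP => j.
rewrite !mxE summxE rmorph_sum; apply: eq_bigr => i _.
have -> : a 0 i *: delta_mx 0 i = delta_mx 0 i *~ a 0 i :> 'rV_n.
  by rewrite -{1}[a 0 i]intz scaler_int.
by rewrite alpha_Mz -scaler_int !mxE rmorphM /= intz.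
Qed.

(** A rational row in the kernel has an integral multiple in the kernel. *)
Lemma alpha_mx_unit : alpha_mx \in unitmx.
Proof.
rewrite -row_free_unit; apply/inj_row_free => v v0.
have [D [B DB]] := common_denominator v.
have : alpha B = 0.
  apply: (@ratm_inj 1 n); rewrite alpha_mxE -DB -scalemxAl v0 scaler0.
  by apply/rowP => j; rewrite !mxE.
rewrite -alpha0 => /alpha_inj B0.
have /eqP : D.+1%:R *: v = 0 by rewrite DB B0; apply/rowP => j; rewrite !mxE.
by rewrite scaler_eq0 pnatr_eq0 /= => /eqP.
Qed.

(** Clear the denominators of the inverse matrix. *)
Lemma image_index : exists D : nat, forall g, in_image (g *+ D.+1).
Proof.
have [D [B DB]] := common_denominator (invmx alpha_mx); exists D => g.
exists (g *m B); apply: (@ratm_inj 1 n); rewrite alpha_mxE.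
have -> : ratm (g *m B) = ratm g *m ratm B by rewrite /ratm map_mxM.
rewrite -DB -scalemxAr -scalemxAl mulmxKV ?alpha_mx_unit//.
by rewrite scaler_nat /ratm raddfMn.
Qed.

(** The representative depends only on the class modulo [D + 1]. *)
Lemma finite_coset_rep : finite_set (range coset_rep).
Proof.
have [D hD] := image_index.
pose f (w : 'rV['I_D.+1]_n) := coset_rep (map_mx (fun i : 'I_D.+1 => (i : nat)%:Z) w).
apply: (@sub_finite_set _ _ (range f)); last first.
  by apply: finite_image; exact: finite_finset.
move=> _ [g _ <-].
pose w : 'rV['I_D.+1]_n := \row_j inord `|(g ord0 j %% D.+1%:Z)%Z|%N.
exists w => //; rewrite /f.
pose q : 'rV[int]_n := \row_j (g ord0 j %/ D.+1%:Z)%Z.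
have -> : g = map_mx (fun i : 'I_D.+1 => (i : nat)%:Z) w + q *+ D.+1.
  apply/rowP => j; rewrite !mxE mulmxnE !mxE inordK; last first.
    by rewrite -ltz_nat gez0_abs ?modz_ge0// ltz_pmod.
  by rewrite gez0_abs ?modz_ge0// addrC -mulr_natr natz -divz_eq.
by have [a ->] := hD q; rewrite coset_repD.
Qed.

End Lattice.

(** * Normal forms and the Bass-Serre tree *)

Section NormalForm.
Context (n : nat) (X : graph) (A : graph_of_groups X) (v0 : vertex X).
Local Notation Zn := 'rV[int]_n.
Context (fV : forall v, vgroup A v -> Zn) (gV : forall v, Zn -> vgroup A v).
Context (fE : forall e, egroup A e -> Zn) (gE : forall e, Zn -> egroup A e).
Context (fVK : forall v, cancel (@fV v) (@gV v)).
Context (gVK : forall v, cancel (@gV v) (@fV v)).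
Context (fEK : forall e, cancel (@fE e) (@gE e)).
Context (gEK : forall e, cancel (@gE e) (@fE e)).
Context (fVM : forall v x y, @fV v (x * y)%g = fV x + fV y).
Context (fEM : forall e x y, @fE e (x * y)%g = fE x + fE y).

Lemma gVD v a b : gV v (a + b) = (gV v a * gV v b)%g.
Proof. by apply: (can_inj (@fVK v)); rewrite fVM !gVK. Qed.

Lemma gED e a b : gE e (a + b) = (gE e a * gE e b)%g.
Proof. by apply: (can_inj (@fEK e)); rewrite fEM !gEK. Qed.

Lemma fV1 v : fV (1%g : vgroup A v) = 0.
Proof. by apply: (addrI (fV (1%g : vgroup A v))); rewrite -fVM mulg1 addr0. Qed.

(** An edge with a direction, [true] being the chosen orientation. *)
Definition dart : Type := (edge X * bool)%type.
HB.instance Definition _ := Finite.on dart.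
Implicit Types (d : dart).

Definition dsrc d : vertex X := if d.2 then source d.1 else target d.1.
Definition dtgt d : vertex X := if d.2 then target d.1 else source d.1.
Definition drev d : dart := (d.1, ~~ d.2).

Lemma drevK : involutive drev.
Proof. by case=> e b; rewrite /drev /= negbK. Qed.

Lemma dsrc_rev d : dsrc (drev d) = dtgt d.
Proof. by case: d => e []. Qed.

Lemma dtgt_rev d : dtgt (drev d) = dsrc d.
Proof. by case: d => e []. Qed.

Definition incl d (a : Zn) : Zn :=
  if d.2 then fV (smap A d.1 (gE d.1 a)) else fV (tmap A d.1 (gE d.1 a)).

Lemma inclD d a b : incl d (a + b) = incl d a + incl d b.
Proof. by rewrite /incl !gED; case: d.2; rewrite gmulfM fVM. Qed.

Lemma incl_inj d : injective (incl d).
Proof.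
move=> a b; rewrite /incl; case: d => e [] /= /(can_inj (@fVK _)).
  by move=> /(@smap_inj _ A e)/(can_inj (@gEK e)).
by move=> /(@tmap_inj _ A e)/(can_inj (@gEK e)).
Qed.

Definition rep d := coset_rep (incl d).
Definition quo d := coset_quo (inclD d).

Lemma rep_quo d g : rep d g + incl d (quo d g) = g.
Proof. by rewrite -coset_quoE. Qed.

Lemma rep_add d g a : rep d (g + incl d a) = rep d g.
Proof. exact: coset_repD (inclD d) _ _. Qed.

Lemma quo_add d g a : quo d (g + incl d a) = quo d g + a.
Proof. exact: (coset_quoD (inclD d) (@incl_inj d)). Qed.

Lemma rep_incl d a : rep d (incl d a) = 0.
Proof. exact: coset_rep_alpha. Qed.

Lemma quo_incl d a : quo d (incl d a) = a.
Proof. exact: (coset_quo_alpha (inclD d) (@incl_inj d)). Qed.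

Lemma quo_rep d g : rep d g = g -> quo d g = 0.
Proof. exact: (coset_quo_rep (inclD d) (@incl_inj d)). Qed.

(** A path from [v0], its last step first: a step is a coset representative in
    the group of its origin, and a dart. *)
Definition stack : Type := seq (Zn * dart).

(** A reduced path followed by an element of the vertex group at its end. *)
Definition state : Type := (stack * Zn)%type.

Definition cur (s : stack) : vertex X := if s is p :: _ then dtgt p.2 else v0.

Definition backtracks d (s : stack) (c : Zn) : bool :=
  if s is p :: _ then (p.2 == drev d) && (c == 0) else false.

Fixpoint valid (s : stack) : bool :=
  if s is p :: s' then [&& dsrc p.2 == cur s', rep p.2 p.1 == p.1,
    ~~ backtracks p.2 s' p.1 & valid s']
  else true.

(** Right multiplication by a dart. The vertex element is split as a
    representative times an element of the edge group, which crosses to the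
    other side of the dart; if the path then ends with a backtracking, that
    step is removed. *)
Definition step d (st : state) : state :=
  let q := incl (drev d) (quo d st.2) in
  if backtracks d st.1 (rep d st.2) then
    (behead st.1, (head (0, d) st.1).1 + q)
  else ((rep d st.2, d) :: st.1, q).

Lemma step_add d s g a : step d (s, g + incl d a) =
  ((step d (s, g)).1, (step d (s, g)).2 + incl (drev d) a).
Proof.
rewrite /step /= rep_add quo_add inclD.
by case: ifP => _ //=; rewrite addrA.
Qed.

Lemma rep0_incl d g : rep d g = 0 -> incl d (quo d g) = g.
Proof. by move=> e; have := rep_quo d g; rewrite e add0r. Qed.

(** The two branches of [step] are inverse to each other: a step just pushed
    is recognized as a backtracking, and a step just removed had a nontrivial
    representative or a different dart, so it is pushed again. *)
Lemma step_valid d st : valid st.1 -> dsrc d = cur st.1 ->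
  [/\ valid (step d st).1, cur (step d st).1 = dtgt d & step (drev d) (step d st) = st].
Proof.
case: st => s g /= vs ds.
case bt: (backtracks d s (rep d g)).
  have E : step d (s, g) = (behead s, (head (0, d) s).1 + incl (drev d) (quo d g)).
    by rewrite /step /= bt.
  rewrite E; case: s vs ds bt {E} => [//|[c d'] s] /= /and4P[/eqP d's /eqP rc nb vs] _.
  move=> /andP[/eqP d'd /eqP rg]; subst d'; rewrite -d's dsrc_rev; split=> //.
  rewrite step_add; have -> : step (drev d) (s, c) = ((c, drev d) :: s, incl (drev (drev d)) 0).
    by rewrite /step /= rc (negPf nb) quo_rep.
  by rewrite drevK /= (alpha0 (inclD d)) add0r rep0_incl.
have E : step d (s, g) = ((rep d g, d) :: s, incl (drev d) (quo d g)).
  by rewrite /step /= bt.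
rewrite E /= ds eqxx bt vs; split=> //.
  by rewrite /rep (coset_rep_idem (inclD d)) eqxx.
by rewrite /step /= drevK rep_incl !eqxx /= quo_incl rep_quo.
Qed.

(** Words of Serre's group need not be composable paths. To make every letter
    act by a permutation, a dart exchanges the states that end at its origin
    with those that end at its target when these differ, and a vertex group
    acts trivially on the states that end elsewhere. *)
Definition act_dart d (st : state) : state :=
  if cur st.1 == dsrc d then step d st
  else if cur st.1 == dtgt d then step (drev d) st else st.

Definition act_vertex v (x : Zn) (st : state) : state :=
  if cur st.1 == v then (st.1, st.2 + x) else st.

Definition act_letter (st : state) (l : gog_letter A * bool) : state :=
  match l with
  | (inl p, b) => act_vertex (tag p) (if b then fV (tagged p) else - fV (tagged p)) st
  | (inr e, b) => act_dart (e, b) st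
  end.

Definition act (w : word (gog_letter A)) (st : state) : state := foldl act_letter st w.

Lemma act_dart_valid d st : valid st.1 -> valid (act_dart d st).1.
Proof.
move=> vs; rewrite /act_dart; case: eqP => [e|_]; first by have [] := step_valid vs (esym e).
case: eqP => [e|//]; rewrite -dsrc_rev in e.
by have [] := step_valid vs (esym e).
Qed.

Lemma act_letter_valid l st : valid st.1 -> valid (act_letter st l).1.
Proof.
case: l => -[p|e] b vs /=; last exact: act_dart_valid.
by rewrite /act_vertex; case: ifP.
Qed.

Lemma act_valid w st : valid st.1 -> valid (act w st).1.
Proof. by elim: w st => [//|l w IH] st vs /=; apply/IH/act_letter_valid. Qed.

Lemma act_cat u w st : act (u ++ w) st = act w (act u st).
Proof. by rewrite /act foldl_cat. Qed.

Lemma act_dartK d st : valid st.1 -> act_dart (drev d) (act_dart d st) = st.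
Proof.
move=> vs; rewrite {2}/act_dart; case: eqP => [e|ne].
  have [vs' c' K] := step_valid vs (esym e).
  by rewrite /act_dart c' dsrc_rev eqxx.
case: eqP => [e|ne']; last first.
  by rewrite /act_dart dsrc_rev dtgt_rev (introF eqP ne') (introF eqP ne).
rewrite -dsrc_rev in e; have [vs' c' K] := step_valid vs (esym e).
rewrite /act_dart c' dtgt_rev !dsrc_rev; case: eqP => [e'|_].
  by case: ne; rewrite e dsrc_rev e'.
by rewrite eqxx; exact: K.
Qed.

(** At the origin of [d] this is the compatibility of [step] with the edge
    group; elsewhere the middle factor acts trivially and the outer ones
    cancel. *)
Lemma act_dart_conj d a st : valid st.1 ->
  act_dart (drev d) (act_vertex (dtgt d) (incl (drev d) a) (act_dart d st)) =
  act_vertex (dsrc d) (incl d a) st.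
Proof.
move=> vs; have [e|ne] := eqVneq (cur st.1) (dsrc d); last first.
  rewrite [RHS]/act_vertex (negPf ne) -[RHS](act_dartK d vs); congr act_dart.
  rewrite /act_vertex; case: eqP => // c'; case: (negP ne).
  move: c'; rewrite /act_dart (negPf ne); case: eqP => [e|ne' /ne' //].
  rewrite -dsrc_rev in e; have [_ -> _] := step_valid vs (esym e).
  by rewrite dtgt_rev => c''; rewrite e dsrc_rev c'' eqxx in ne.
case: st vs e => s g /= vs e.
rewrite [RHS]/act_vertex /= e eqxx -[RHS](act_dartK d (st := (s, g + incl d a)) vs).
have [_ c' _] := @step_valid d (s, g) vs (esym e).
congr act_dart; rewrite /act_dart /= e eqxx step_add /act_vertex c' eqxx.
by [].
Qed.

Lemma incl_smap e (a : egroup A e) : incl (e, true) (fE a) = fV (smap A e a).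
Proof. by rewrite /incl /= fEK. Qed.

Lemma incl_tmap e (a : egroup A e) : incl (e, false) (fE a) = fV (tmap A e a).
Proof. by rewrite /incl /= fEK. Qed.

Lemma act_rel u w : gog_rel u w -> forall st, valid st.1 -> act u st = act w st.
Proof.
case=> {u w} [v g h|e a] st vs.
  rewrite /act /= /act_vertex /=; case e: (cur st.1 == v); rewrite /= e //.
  by rewrite fVM addrA.
have := @act_dart_conj (e, true) (fE a) st vs.
by rewrite /drev /= incl_smap incl_tmap.
Qed.

Lemma act_letterK l b st : valid st.1 -> act [:: (l, b); (l, ~~ b)] st = st.
Proof.
move=> vs; rewrite /act; case: l => [p|e] /=; last exact: act_dartK (e, b) st vs.
rewrite /act_vertex /=; case c: (cur st.1 == tag p); rewrite /= c //.
by case: b; rewrite /= ?addrK ?subrK; case: (st).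
Qed.

(** The relations of Serre's group hold for the action, which is the whole
    content of the normal form theorem. *)
Lemma act_word_eq u w : word_eq (@gog_rel X A) u w ->
  forall st, valid st.1 -> act u st = act w st.
Proof.
elim=> {u w} [u w r|l b|u u' w w' _ IH1 _ IH2|//|u w _ IH|u w x _ IH1 _ IH2] st vs.
- exact: act_rel.
- exact: act_letterK.
- by rewrite !act_cat IH1// IH2//; exact: act_valid.
- by rewrite IH.
- by rewrite IH1// IH2.
Qed.

Definition actP (x : path_group A) (st : state) : state := act (repr x) st.

Lemma actP_valid x st : valid st.1 -> valid (actP x st).1.
Proof. exact: act_valid. Qed.

Lemma actP_pclass w st : valid st.1 -> actP (pclass (@gog_rel X A) w) st = act w st.
Proof. by move=> vs; apply: act_word_eq => //; exact: repr_pclass. Qed.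

Lemma actPM x y st : valid st.1 -> actP (x * y)%g st = actP y (actP x st).
Proof. by move=> vs; rewrite [LHS]actP_pclass// act_cat. Qed.

Definition dval d : path_group A := pclass _ [:: (eletter A d.1, d.2)].

Lemma dval_edge e : dval (e, true) = of_edge A e.
Proof. by []. Qed.

Lemma dval_rev d : dval (drev d) = (dval d)^-1%g.
Proof. by rewrite [RHS](pinvE (@gog_rel X A)). Qed.

Definition ov v (a : Zn) : path_group A := of_vertex (gV v a).

Lemma ovD v a b : ov v (a + b) = (ov v a * ov v b)%g.
Proof. by rewrite /ov gVD of_vertexM. Qed.

Lemma ov_fV v (g : vgroup A v) : ov v (fV g) = of_vertex g.
Proof. by rewrite /ov fVK. Qed.

Lemma gV0 v : gV v 0 = 1%g.
Proof. by rewrite -(fV1 v) fVK. Qed.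

Lemma ov0 v : ov v 0 = 1%g.
Proof. by rewrite /ov gV0 of_vertex1. Qed.

Lemma edge_conj e (a : egroup A e) :
  (of_edge A e * of_vertex (tmap A e a) * (of_edge A e)^-1)%g = of_vertex (smap A e a).
Proof.
rewrite [X in (_ * X)%g](pinvE (@gog_rel X A)).
rewrite [X in (X * _)%g](pmulE (@gog_rel X A)) [LHS](pmulE (@gog_rel X A)).
by apply/pclassE/word_eq_rel; exact: gog_rel_edge.
Qed.

Lemma dval_conj d a :
  (dval d * ov (dtgt d) (incl (drev d) a))%g = (ov (dsrc d) (incl d a) * dval d)%g.
Proof.
case: d => e b; have := edge_conj (gE e a).
rewrite -!ov_fV -!incl_smap -!incl_tmap gEK => h.
case: b; first by rewrite dval_edge -h mulgVK.
have -> : dval (e, false) = (of_edge A e)^-1%g by rewrite -dval_edge -dval_rev.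
by rewrite /drev /= -h !mulgA mulVg mul1g.
Qed.

Fixpoint eval_stack (s : stack) : path_group A :=
  if s is p :: s' then (eval_stack s' * ov (dsrc p.2) p.1 * dval p.2)%g else 1%g.

Definition eval (st : state) : path_group A :=
  (eval_stack st.1 * ov (cur st.1) st.2)%g.

Lemma eval_step d st : valid st.1 -> dsrc d = cur st.1 ->
  eval (step d st) = (eval st * dval d)%g.
Proof.
case: st => s g /= vs ds; rewrite /eval /step /=; case: ifPn => bt; last first.
  rewrite /= -[RHS]mulgA -ds -{3}[g](rep_quo d) ovD -!mulgA; congr (_ * (_ * _))%g.
  exact: dval_conj.
case: s vs ds bt => [//|[c d'] s] /= /and4P[/eqP d's _ _ _] ds /andP[/eqP d'd /eqP rg].
subst d'; rewrite -d's dsrc_rev dtgt_rev ovD dval_rev -{2}(rep0_incl rg).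
rewrite -!mulgA; congr (_ * (_ * _))%g.
by rewrite -dval_conj mulKg.
Qed.

(** Values of path words with a given number of edges. *)
Inductive path_len : vertex X -> vertex X -> nat -> path_group A -> Prop :=
| path_len_vertex v (g : vgroup A v) : path_len v v 0 (of_vertex g)
| path_len_dart d : path_len (dsrc d) (dtgt d) 1 (dval d)
| path_lenM u v w j k x y :
    path_len u v j x -> path_len v w k y -> path_len u w (j + k)%N (x * y)%g.

Lemma path_lenV u v k x : path_len u v k x -> path_len v u k x^-1%g.
Proof.
elim=> {u v k x} [v g|d|u v w j k x y _ IH1 _ IH2].
- by rewrite -of_vertexV; exact: path_len_vertex.
- by have := path_len_dart (drev d); rewrite dval_rev dsrc_rev dtgt_rev.
- by rewrite invgM addnC; exact: path_lenM IH2 IH1.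
Qed.

Lemma path_len_of_path u v x : gog_path u v x -> exists k, path_len u v k x.
Proof.
elim=> {u v x} [v g|e|e|u v w x y _ [j IH1] _ [k IH2]].
- by exists 0%N; exact: path_len_vertex.
- by exists 1%N; exact: path_len_dart (e, true).
- exists 1%N; rewrite -dval_edge -dval_rev; exact: path_len_dart (e, false).
- by exists (j + k)%N; exact: path_lenM IH1 IH2.
Qed.

Lemma tdist_step d y st :
  (tdist y (rev (step d st).1) <= tdist y (rev st.1) + 1)%N.
Proof.
case: st => s g; rewrite /step /= addn1; case: ifPn => bt /=.
  case: s bt => [//|p s] _ /=; rewrite rev_cons.
  by have /andP[] := tdist_rcons y (rev s) p.
rewrite rev_cons; by have /andP[] := tdist_rcons y (rev s) (rep d g, d).
Qed.

(** On composable paths the action is multiplication of the values, and each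
    edge moves the end of a path by at most one in the tree. *)
Lemma act_path u v k x : path_len u v k x -> forall st, valid st.1 -> cur st.1 = u ->
  [/\ cur (actP x st).1 = v, eval (actP x st) = (eval st * x)%g &
    forall y, (tdist y (rev (actP x st).1) <= tdist y (rev st.1) + k)%N].
Proof.
elim=> {u v k x} [v g|d|u v w j k x y _ IH1 _ IH2] st vs cs.
- subst v; have -> : actP (of_vertex g) st = (st.1, st.2 + fV g).
    by rewrite actP_pclass// /act /= /act_vertex /= eqxx.
  split=> // [|y]; last by rewrite addn0.
  by rewrite /eval /= ovD ov_fV mulgA.
- have -> : actP (dval d) st = step d st.
    by rewrite actP_pclass// /act /= -surjective_pairing /act_dart cs eqxx.
  split=> [||y]; [by have [] := step_valid vs (esym cs)|exact: eval_step|exact: tdist_step].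
have [c1 e1 t1] := IH1 st vs cs.
have [c2 e2 t2] := IH2 _ (actP_valid x vs) c1.
rewrite actPM//; split=> // [|z]; first by rewrite e2 e1 mulgA.
by apply: leq_trans (t2 z) _; rewrite addnA leq_add2r.
Qed.

Lemma eval_suffix (p r : stack) : valid (p ++ r) ->
  exists2 q, path_len (cur r) (cur (p ++ r)) (size p) q &
    eval_stack (p ++ r) = (eval_stack r * q)%g.
Proof.
elim: p => [|[c d] p IH] /=.
  move=> _; exists 1%g; last by rewrite mulg1.
  by rewrite -(of_vertex1 A (cur r)); exact: path_len_vertex.
move=> /and4P[/eqP ds _ _ /IH[q qp qe]].
exists (q * (ov (dsrc d) c * dval d))%g; last by rewrite qe !mulgA.
rewrite -addn1; apply: path_lenM qp _; rewrite -ds -[1%N]add0n.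
by apply: path_lenM (path_len_dart d); exact: path_len_vertex.
Qed.

Local Notation G := (bass_serre_pi1 A v0).

Definition nf (g : G) : state := actP (val g) ([::], 0).

Lemma val_path (g : G) : gog_path v0 v0 (val g).
Proof. by have /asboolP := valP g. Qed.

Lemma nf_valid g : valid (nf g).1.
Proof. exact: actP_valid. Qed.

Lemma nfP g : cur (nf g).1 = v0 /\ eval (nf g) = val g.
Proof.
have [k /act_path h] := path_len_of_path (val_path g).
have [c e _] := h ([::], 0) erefl erefl; split=> //.
by rewrite [LHS]e /eval /= ov0 !mul1g.
Qed.

Lemma nf_inj : injective nf.
Proof.
move=> g h e; apply: val_inj; have [_ <-] := nfP g; have [_ <-] := nfP h.
by rewrite e.
Qed.

(** The vertex [g v0] of the tree, as a path from the root. *)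
Definition tree_word (g : G) : stack := rev (nf g).1.

(** Both sides are the least number of edges of a path word with value [g^-1
    h]: the word that climbs from the vertex of [g] to the last common
    ancestor and descends to that of [h] bounds the left side by the right
    one, and the reduced word of [g^-1 h], applied to the vertex of [g], gives
    the converse. *)
Lemma size_tree_word g h :
  size (tree_word (g^-1 * h)%g) = tdist (tree_word g) (tree_word h).
Proof.
have [cg eg] := nfP g; have [ch eh] := nfP h; have [cw ew] := nfP (g^-1 * h)%g.
have vg := nf_valid g; have vh := nf_valid h; have vw := nf_valid (g^-1 * h)%g.
apply/anti_leq/andP; split.
  pose m := meet_size (tree_word g) (tree_word h).
  have m1 := meet_size_l (tree_word g) (tree_word h).
  have m2 := meet_size_r (tree_word g) (tree_word h).
  rewrite !size_rev in m1 m2.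
  have E : drop (size (nf g).1 - m) (nf g).1 = drop (size (nf h).1 - m) (nf h).1.
    have := meet_size_take (tree_word g) (tree_word h).
    by rewrite -/m !take_rev => /(can_inj revK).
  (* The path to the last common ancestor. *)
  set r := drop _ (nf g).1 in E.
  have vg' := vg; rewrite -(cat_take_drop (size (nf g).1 - m) (nf g).1) -/r in vg'.
  have vh' := vh; rewrite -(cat_take_drop (size (nf h).1 - m) (nf h).1) -E in vh'.
  have [q1 p1 e1] := eval_suffix vg'; have [q2 p2 e2] := eval_suffix vh'.
  rewrite {1}/r cat_take_drop in p1 e1; rewrite E cat_take_drop -E in p2 e2.
  rewrite cg size_take_min in p1; rewrite ch size_take_min in p2.
  have wE : val (g^-1 * h)%g =
      (ov v0 (- (nf g).2) * q1^-1 * (q2 * ov v0 (nf h).2))%g.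
    have -> : val (g^-1 * h)%g = ((val g)^-1 * val h)%g by [].
    have -> : ov v0 (- (nf g).2) = (ov v0 (nf g).2)^-1%g.
      by apply: (mulgI (ov v0 (nf g).2)); rewrite -ovD subrr ov0 mulgV.
    by rewrite -eg -eh /eval cg ch e1 e2 !invgM -!mulgA mulKg.
  have wp := path_lenM (path_lenM (path_len_vertex (gV v0 (- (nf g).2))) (path_lenV p1))
     (path_lenM p2 (path_len_vertex (gV v0 (nf h).2))).
  rewrite -/(ov _ _) -/(ov _ _) -wE in wp.
  have [_ _ /(_ [::])] := act_path wp (st := ([::], 0)) erefl erefl.
  rewrite -/(nf _) !tdist_nil -/(tree_word _) /= => le1.
  apply: leq_trans le1 _; rewrite /tdist !size_rev -/m.
  have arith a b k : (k <= a -> k <= b -> 0 + (0 + minn (a - k) a + (minn (b - k) b + 0)) <=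
    a + b - k.*2)%N by clear; lia.
  exact: arith m1 m2.
have := @eval_suffix (nf (g^-1 * h)%g).1 [::]; rewrite cats0 => /(_ vw)[q qp qe].
have wE : val (g^-1 * h)%g = (q * ov v0 (nf (g^-1 * h)%g).2)%g.
  by rewrite -[LHS]ew /eval qe cw /= mul1g.
rewrite cw in qp.
have wp := path_lenM qp (path_len_vertex (gV v0 (nf (g^-1 * h)%g).2)).
rewrite -/(ov _ _) -wE addn0 in wp.
have [_ _ /(_ (tree_word g))] := act_path wp vg cg.
rewrite {1}/nf -actPM// (_ : (val g * val (g^-1 * h))%g = val h); last first.
  by have -> : val (g^-1 * h)%g = ((val g)^-1 * val h)%g by []; rewrite mulVKg.
by rewrite -/(nf h) -!/(tree_word _) tdist_self add0n size_rev.
Qed.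

(** * The affine action of the fundamental group *)

(** The linear map that turns the embedding of the edge group at the end of
    [d] into the one at its origin; vectors are rows. *)
Definition dart_mx d : 'M[rat]_n :=
  invmx (alpha_mx (incl (drev d))) *m alpha_mx (incl d).

Lemma incl_mx_unit d : alpha_mx (incl d) \in unitmx.
Proof. exact: alpha_mx_unit (inclD d) (@incl_inj d). Qed.

Lemma dart_mxK d : dart_mx (drev d) *m dart_mx d = 1%:M.
Proof.
rewrite /dart_mx drevK -mulmxA (mulmxA (alpha_mx (incl (drev d)))) mulmxV ?incl_mx_unit//.
by rewrite mul1mx mulVmx ?incl_mx_unit.
Qed.

Lemma incl_dart d a : ratm (incl (drev d) a) *m dart_mx d = ratm (incl d a).
Proof.
rewrite !(alpha_mxE (inclD _)) /dart_mx mulmxA mulmxK//.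
exact: incl_mx_unit.
Qed.

Definition affine : Type := ('M[rat]_n * 'rV[rat]_n)%type.

Definition aff_letter (t : affine) (l : gog_letter A * bool) : affine :=
  match l with
  | (inl p, b) => (t.1, t.2 + ratm (if b then fV (tagged p) else - fV (tagged p)) *m t.1)
  | (inr e, b) => (dart_mx (e, b) *m t.1, t.2)
  end.

Definition aff (w : word (gog_letter A)) (t : affine) : affine := foldl aff_letter t w.

Lemma ratmD p q (a b : 'M[int]_(p, q)) : ratm (a + b) = ratm a + ratm b.
Proof. exact: raddfD. Qed.

Lemma aff_rel u w : gog_rel u w -> forall t, aff u t = aff w t.
Proof.
case=> {u w} [v g h|e a] [Y y]; rewrite /aff /aff_letter /=.
  by rewrite fVM ratmD mulmxDl addrA.
rewrite mulmxA (dart_mxK (e, true)) mul1mx -(incl_tmap a) -(incl_smap a).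
by rewrite mulmxA (incl_dart (e, true)).
Qed.

Lemma aff_word_eq u w : word_eq (@gog_rel X A) u w -> forall t, aff u t = aff w t.
Proof.
elim=> {u w} [u w r|l b|u u' w w' _ IH1 _ IH2|//|u w _ IH|u w x _ IH1 _ IH2] t.
- exact: aff_rel.
- case: t => Y y; rewrite /aff; case: l => [p|e] /=; last first.
    by have := dart_mxK (e, b); rewrite mulmxA /drev /= => ->; rewrite mul1mx.
  by rewrite -addrA -mulmxDl -ratmD; case: b; rewrite /= ?subrr ?addNr;
     rewrite (_ : ratm 0 = 0) ?mul0mx ?addr0//; apply/rowP => j; rewrite !mxE.
- by rewrite /aff !foldl_cat -!/(aff _ _) IH1 IH2.
- by rewrite IH.
- by rewrite IH1.
Qed.

(** Composition of affine maps of row vectors, the first factor acting first;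
    the group acts on the left, whence the exchange of the factors in [affPM]. *)
Definition aff_mul (s t : affine) : affine := (s.1 *m t.1, t.2 + s.2 *m t.1).

Definition affP (x : path_group A) : affine := aff (repr x) (1%:M, 0).

Lemma aff_mulE w t : aff w t = aff_mul (aff w (1%:M, 0)) t.
Proof.
have letter s l : aff_letter (aff_mul s t) l = aff_mul (aff_letter s l) t.
  case: l => -[p|e] b; rewrite /aff_letter /aff_mul /=; congr (_, _).
    by rewrite mulmxDl addrA mulmxA.
  by rewrite mulmxA.
have -> : t = aff_mul (1%:M, 0) t :> affine.
  by case: (t) => Y y; rewrite /aff_mul /= mul1mx mul0mx addr0.
have {2}-> : aff_mul (1%:M, 0) t = t.
  by case: (t) => Y y; rewrite /aff_mul /= mul1mx mul0mx addr0.
rewrite /aff; elim: w (1%:M, 0) => [//|l w IH] s /=.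
by rewrite letter IH.
Qed.

Lemma affP_pclass w : affP (pclass (@gog_rel X A) w) = aff w (1%:M, 0).
Proof. by apply: aff_word_eq; exact: repr_pclass. Qed.

Lemma affPM x y : affP (x * y)%g = aff_mul (affP y) (affP x).
Proof. by rewrite [LHS]affP_pclass /aff foldl_cat -!/(aff _ _) aff_mulE. Qed.

Lemma affP1 : affP 1%g = (1%:M, 0).
Proof. by rewrite [LHS]affP_pclass. Qed.

Lemma affP_unit x : (affP x).1 \in unitmx.
Proof.
by have := affPM x x^-1%g; rewrite mulgV affP1 => -[/esym/mulmx1_unit[]].
Qed.

Lemma affP_ov v a : affP (ov v a) = (1%:M, ratm a).
Proof.
by rewrite [LHS]affP_pclass /aff /aff_letter /= gVK mulmx1 add0r.
Qed.

(** The vertex element of the normal form acts by a translation, and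
    translations act faithfully. *)
Lemma tree_word_aff_inj (g h : G) : tree_word g = tree_word h ->
  (affP (val g)).2 = (affP (val h)).2 -> g = h.
Proof.
move=> /(can_inj revK) es eb; apply: nf_inj.
have [cg eg] := nfP g; have [ch eh] := nfP h.
rewrite [nf g]surjective_pairing [nf h]surjective_pairing es; congr (_, _).
apply: (@ratm_inj 1 n).
move: eb; rewrite -eg -eh /eval !affPM !affP_ov /= es => /addrI.
move=> /(congr1 (mulmx^~ (invmx (affP (eval_stack (nf h).1)).1))).
by rewrite !mulmxK ?affP_unit.
Qed.

Lemma finite_stacks (W : set (Zn * dart)) N : finite_set W ->
  finite_set [set s : stack | (size s < N)%N /\ {in s, forall p, W p}].
Proof.
move=> finW; elim: N => [|N IH]; first by apply: (@sub_finite_set _ _ set0) => // s [].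
apply: (@sub_finite_set _ _ ([set [::]] `|`
  [set (p.1 :: p.2 : stack) | p in W `*` [set s : stack | (size s < N)%N /\ {in s, forall p, W p}]])).
  move=> [|p s] [/= ss sW]; [by left|right; exists (p, s) => //; split=> /=].
    by apply: sW; rewrite inE eqxx.
  by split=> // q qs; apply: sW; rewrite inE qs orbT.
rewrite finite_setU; split; first exact: finite_set1.
by apply: finite_image; exact: finite_setX.
Qed.

Lemma finite_reps : finite_set [set p : Zn * dart | range (rep p.2) p.1].
Proof.
apply: (@sub_finite_set _ _ (\bigcup_(d in [set: dart]) [set (c, d) | c in range (rep d)])).
  by move=> [c d] /= cd; exists d => //; exists c.
apply: bigcup_finite; first exact: finite_finset.
move=> d _; apply: finite_image.
exact: finite_coset_rep (inclD d) (@incl_inj d).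
Qed.

Lemma valid_reps s : valid s -> {in s, forall p, range (rep p.2) p.1}.
Proof.
elim: s => [//|[c d] s IH] /= /and4P[_ /eqP rc _ /IH h] p.
by rewrite inE => /orP[/eqP ->|/h//]; exists c.
Qed.

(** Local finiteness of the tree leaves finitely many paths of bounded length,
    and the affine image then determines the element. *)
Lemma finite_fibers N (Y : 'M[rat]_n) (y : 'rV[rat]_n) :
  finite_set [set g : G | [/\ (size (tree_word g) < N)%N,
    (affP (val g)).1 = Y & (affP (val g)).2 = y]].
Proof.
set S := [set g | _].
have inj : {in S &, injective (fun g : G => (nf g).1)}.
  move=> g h; rewrite !inE => -[_ _ gy] [_ _ hy] e.
  by apply: tree_word_aff_inj; rewrite ?gy// /tree_word e.
rewrite -(eq_finite_set (inj_card_eq inj)).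
apply: sub_finite_set (finite_stacks N finite_reps) => _ [g [sg _ _] <-] /=.
by split; [rewrite size_rev in sg|apply: valid_reps; exact: nf_valid].
Qed.

Definition lin_letter (Y : 'M[rat]_n) (l : edge X * bool) : 'M[rat]_n := dart_mx l *m Y.

Definition lin (w : word (edge X)) (Y : 'M[rat]_n) : 'M[rat]_n := foldl lin_letter Y w.

Lemma lin_word_eq u w : word_eq (fun _ _ : word (edge X) => False) u w ->
  forall Y, lin u Y = lin w Y.
Proof.
elim=> {u w} [u w []|e b|u u' w w' _ IH1 _ IH2|//|u w _ IH|u w x _ IH1 _ IH2] Y.
- by have := dart_mxK (e, b); rewrite /lin /= /lin_letter mulmxA /drev /= => ->; rewrite mul1mx.
- by rewrite /lin !foldl_cat -!/(lin _ _) IH1 IH2.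
- by rewrite IH.
- by rewrite IH1.
Qed.

Lemma linE w Y : lin w Y = lin w 1%:M *m Y.
Proof.
elim/last_ind: w => [|w l IH]; first by rewrite mul1mx.
by rewrite /lin !foldl_rcons -!/(lin _ _) /lin_letter IH mulmxA.
Qed.

Definition linP (y : free_group (edge X)) : 'M[rat]_n := lin (repr y) 1%:M.

Lemma linP_pclass w : linP (pclass (fun _ _ : word (edge X) => False) w) = lin w 1%:M.
Proof. by apply: lin_word_eq; exact: repr_pclass. Qed.

Lemma linPM x y : linP (x * y)%g = linP y *m linP x.
Proof. by rewrite [LHS]linP_pclass /lin foldl_cat -!/(lin _ _) linE. Qed.

(** Vertex groups act by translations, so the linear part sees only the
    underlying edge path in the graph. *)
Lemma linear_part_edge_path u v x : gog_path u v x ->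
  exists2 y, edge_path u v y & linP y = (affP x).1.
Proof.
elim=> {u v x} [v g|e|e|u v w x y _ [x' px ex] _ [y' py ey]].
- exists 1%g; first exact: edge_path1.
  by rewrite [LHS]linP_pclass -ov_fV affP_ov.
- exists (pgen _ e); first exact: edge_path_edge.
  by rewrite linP_pclass affP_pclass.
- exists (pgen _ e)^-1%g; first exact: edge_path_edgeV.
  rewrite -dval_edge -dval_rev affP_pclass.
  by rewrite [X in linP X](pinvE (fun _ _ : word (edge X) => False)) linP_pclass.
- exists (x' * y')%g; first exact: edge_pathM px py.
  by rewrite linPM affPM ex ey.
Qed.

Lemma linear_part_comm : (forall x y : graph_pi1 v0, (x * y = y * x)%g) ->
  forall g h : G, (affP (val g)).1 *m (affP (val h)).1 =
    (affP (val h)).1 *m (affP (val g)).1.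
Proof.
move=> comm g h.
have [y py ey] := linear_part_edge_path (val_path g).
have [z pz ez] := linear_part_edge_path (val_path h).
have yP : y \in subgroup_pred (edge_loop_subgroup v0) by apply/asboolP.
have zP : z \in subgroup_pred (edge_loop_subgroup v0) by apply/asboolP.
have /(congr1 val) /= e := comm (exist _ y yP) (exist _ z zP).
by rewrite -ey -ez -!linPM; congr linP; rewrite e.
Qed.

Lemma bass_serre_approximable (R : realType) :
  (forall g h : G, (affP (val g)).1 *m (affP (val h)).1 =
    (affP (val h)).1 *m (affP (val g)).1) ->
  schur_approximable R G /\ gram_approximable R G.
Proof.
move=> comm.
apply: (@tree_affine_approximable R G n _ tree_word (fun g => (affP (val g)).1)
  (fun g => (affP (val g)).2)).
- by rewrite (affP1 : affP (val (1%g : G)) = _).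
- by rewrite (affP1 : affP (val (1%g : G)) = _).
- by move=> g h; rewrite (affPM _ _ : affP (val (g * h)%g) = _).
- by move=> g h; rewrite (affPM _ _ : affP (val (g * h)%g) = _).
- exact: comm.
- exact: finite_fibers.
- exact: size_tree_word.
Qed.

End NormalForm.

(** * The corollary *)

(** With at most one generator, any two letters are equal or inverse to each
    other. *)
Lemma presented_group_abelian (S : choiceType) (rel : word S -> word S -> Prop) :
  (forall s t : S, s = t) ->
  forall x y : presented_group rel, (x * y = y * x)%g.
Proof.
move=> S1 x y; rewrite -(pclass_repr x) -(pclass_repr y).
rewrite [LHS](pmulE rel) [RHS](pmulE rel); apply/pclassE.
move: (repr x) (repr y) => u v.
have l1 (l l' : S * bool) : word_eq rel [:: l; l'] [:: l'; l].
  case: l l' => s b [t c]; rewrite (S1 t s); have [->|] := eqVneq b c.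
    exact: word_eq_refl.
  move=> bc; have -> : c = ~~ b by case: b c bc => -[].
  apply: word_eq_trans (word_eq_cancel _ _ _) _; apply: word_eq_sym.
  by have := word_eq_cancel rel s (~~ b); rewrite negbK.
have l2 l w : word_eq rel (l :: w) (rcons w l).
  elim: w => [|l' w IH]; first exact: word_eq_refl.
  rewrite -[l :: _]/([:: l; l'] ++ w); apply: word_eq_trans.
    apply: word_eq_cat (l1 l l') (word_eq_refl _ _).
  exact: (word_eq_cat (word_eq_refl _ [:: l']) IH).
elim: u v => [|l u IH] v; first by rewrite cats0; exact: word_eq_refl.
apply: word_eq_trans (l2 l (u ++ v)) _; rewrite -cats1.
apply: word_eq_trans (word_eq_cat (IH v) (word_eq_refl _ [:: l])) _.
rewrite -catA cats1.
exact: word_eq_cat (word_eq_refl _ v) (word_eq_sym (l2 l u)).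
Qed.

Theorem corollary1p7 (R : realType) (n : nat) (hn : (1 <= n)%N)
  (X : graph) (hX : graph_connected X)
  (A : graph_of_groups X)
  (hV : forall v : vertex X, iso_Zn n (vgroup A v))
  (hE : forall e : edge X, iso_Zn n (egroup A e))
  (v0 : vertex X) (d : nat)
  (hd : group_iso (free_group 'I_d) (graph_pi1 v0))
  (hcase : d = 0%N \/ d = 1%N \/ n = 1%N) :
  haagerup_property R (bass_serre_pi1 A v0) /\
  cowling_haagerup R (bass_serre_pi1 A v0) = 1%E.
Proof.
have inv (H : groupType) : iso_Zn n H ->
    exists fg : (H -> 'rV[int]_n) * ('rV[int]_n -> H), [/\ cancel fg.1 fg.2,
      cancel fg.2 fg.1 & forall x y, fg.1 (x * y)%g = fg.1 x + fg.1 y].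
  by move=> [f [[g fK gK] fM]]; exists (f, g).
pose cV v := cid (inv _ (hV v)); pose cE e := cid (inv _ (hE e)).
have fVK v : cancel (projT1 (cV v)).1 (projT1 (cV v)).2 by case: (projT2 (cV v)).
have gVK v : cancel (projT1 (cV v)).2 (projT1 (cV v)).1 by case: (projT2 (cV v)).
have fVM v := let: And3 _ _ h := projT2 (cV v) in h.
have fEK e : cancel (projT1 (cE e)).1 (projT1 (cE e)).2 by case: (projT2 (cE e)).
have gEK e : cancel (projT1 (cE e)).2 (projT1 (cE e)).1 by case: (projT2 (cE e)).
have fEM e := let: And3 _ _ h := projT2 (cE e) in h.
suff [hs hg] : schur_approximable R (bass_serre_pi1 A v0) /\
    gram_approximable R (bass_serre_pi1 A v0).
  by split; [exact: haagerup_of_gram|exact: cowling_haagerup_eq1].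
apply: (bass_serre_approximable fVK gVK fEK gEK fVM fEM).
have [d1|n1] : (d <= 1)%N \/ n = 1%N by case: hcase => [->|[->|]]; [left|left|right].
  apply: (linear_part_comm fVK gVK fEK gEK fVM fEM) => x y; have [f [f' fK f'K]] := hd.
  rewrite -(f'K x) -(f'K y) -!gmulfM; congr (f _).
  apply: presented_group_abelian => s t; apply: val_inj => /=.
  by have := ltn_ord s; have := ltn_ord t; lia.
move=> g h; move: (affP _ _ (val g)).1 (affP _ _ (val h)).1.
by rewrite n1 => Y Z; rewrite [Y]mx11_scalar [Z]mx11_scalar -!scalar_mxM mulrC.
Qed.
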